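(* Let $(V,\sigma)$ be a braided vector space, let $M_{11}=m\colon V\otimes V\to V$ be a linear map, and let $\Join_\sigma\colon T^c(V)\underline{\otimes}T^c(V)\to T^c(V)$ be the map built from $\sigma$ and $M_{11}$ as in the context. Then $(T^c(V),\Join_\sigma,\beta)$ is a Yang-Baxter algebra if and only if $(V,M_{11},\sigma)$ is a Yang-Baxter algebra.
   Context: $K$ is a ground field of characteristic $0$; all objects are over $K$. All algebras are assumed to be associative and unital. A braiding on a vector space $V$ is an invertible $\sigma\in\mathrm{End}(V\otimes V)$ with $(\sigma\otimes \mathrm{id}_V)(\mathrm{id}_V\otimes\sigma)(\sigma\otimes \mathrm{id}_V)=(\mathrm{id}_V\otimes\sigma)(\sigma\otimes \mathrm{id}_V)(\mathrm{id}_V\otimes\sigma)$ on $V^{\otimes 3}$; $(V,\sigma)$ is then a braided vector space. On $V^{\otimes n}$ put $\sigma_i=\mathrm{id}_V^{\otimes(i-1)}\otimes\sigma\otimes\mathrm{id}_V^{\otimes(n-i-1)}$ for $1\le i\le n-1$. Operators compose from right to left. For $w$ in the symmetric group $\mathfrak S_n$ with reduced expression $w=s_{i_1}\cdots s_{i_l}$, $s_i=(i,i+1)$, put $T^\sigma_w=\sigma_{i_1}\cdots\sigma_{i_l}$ (well defined). Yang-Baxter (YB) algebra: a triple $(A,m,\sigma)$ with $A=(A,m)$ an (associative, unital) algebra with product $m$ and unit $1_A$, and $\sigma$ a braiding on $A$, such that $(\mathrm{id}_A\otimes m)\sigma_1\sigma_2=\sigma(m\otimes\mathrm{id}_A)$,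 $(m\otimes\mathrm{id}_A)\sigma_2\sigma_1=\sigma(\mathrm{id}_A\otimes m)$, and, for any $a\in A$, $\sigma(1_A\otimes a)=a\otimes 1_A$ and $\sigma(a\otimes 1_A)=1_A\otimes a$. $T(V)=\bigoplus_{n\ge0}V^{\otimes n}$ with $V^{\otimes 0}=K$; $\otimes$ denotes the tensor product inside $T(V)$ and $\underline{\otimes}$ the tensor product between copies of $T(V)$. For $i,j\ge1$ let $\chi_{ij}\in\mathfrak S_{i+j}$ be given by $\chi_{ij}(k)=j+k$ for $1\le k\le i$ and $\chi_{ij}(i+k)=k$ for $1\le k\le j$. The map $\beta\colon T(V)\underline{\otimes}T(V)\to T(V)\underline{\otimes}T(V)$ is defined by $\beta_{ij}=T^\sigma_{\chi_{ij}}$ on $V^{\otimes i}\underline{\otimes}V^{\otimes j}$ for $i,j\geq 1$, and $\beta_{0i},\beta_{i0}$ are the usual flips. $T^c(V)=(T(V),\delta,\varepsilon)$, where $\delta(v_1\otimes\cdots\otimes v_n)=\sum_{i=0}^n(v_1\otimes\cdots\otimes v_i)\underline{\otimes}(v_{i+1}\otimes\cdots\otimes v_n)$ is deconcatenation and $\varepsilon\colon T(V)\to K$ is the projection. Define linear maps $M_{pq}\colon V^{\otimes p}\underline{\otimes}V^{\otimes q}\to V$ ($p,q\ge0$) by $M_{00}=0$, $M_{10}=\mathrm{id}_V=M_{01}$, $M_{11}=m$ the given map, and $M_{pq}=0$ otherwise; let $M=(M_{pq})_{p,q\ge0}\colon T^c(V)\underline{\otimes}T^c(V)\to V$ be the resulting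 map. Put $\bigtriangleup_\beta=(\mathrm{id}_{T^c(V)}\otimes\beta\otimes\mathrm{id}_{T^c(V)})\circ(\delta\otimes\delta)$, $\bigtriangleup_\beta^{(0)}=\mathrm{id}$, and inductively $\bigtriangleup_\beta^{(n)}=(\bigtriangleup_\beta\otimes\mathrm{id}_{T^c(V)}^{\otimes 2(n-1)})\circ\bigtriangleup_\beta^{(n-1)}$ for $n\ge1$. Then $$\Join_\sigma=\varepsilon\otimes\varepsilon+\sum_{n\ge1}M^{\otimes n}\circ\bigtriangleup_\beta^{(n-1)}\colon T^c(V)\underline{\otimes}T^c(V)\to T^c(V)$$ (the sum is finite on each element; $M^{\otimes n}$ takes values in $V^{\otimes n}$ and $\varepsilon\otimes\varepsilon$ in $K=V^{\otimes 0}$). The unit $1\in K$ satisfies $1\Join_\sigma x=x\Join_\sigma 1=x$ for all $x\in T^c(V)$.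
   Formalization: With unital algebras the ''only if'' fails (V=K, σ=flip, m=0: shuffle algebra, but (V,0) has no unit); proved instead: the equivalence with all axioms on V except those on the unit, and the literal equivalence whenever (V,M_11) has a unit. *)

(* Defs.v *)
From HB Require Import structures.
From mathcomp Require Import all_boot all_order all_fingroup all_algebra.
From mathcomp Require Import boolp classical_sets fsbigop.
From mathcomp Require Import generic_quotient freeg zify.

Set Implicit Arguments.
Unset Strict Implicit.
Unset Printing Implicit Defensive.

Import GRing.Theory.
Local Open Scope quotient_scope.
Local Open Scope ring_scope.

Inductive lspan (K : fieldType) (Z : lmodType K) (P : Z -> Prop) : Z -> Prop :=
| lspan0 : lspan P 0
| lspanD c z v : P z -> lspan P v -> lspan P (c *: z + v).

Section Span.
Variables (K : fieldType) (Z : lmodType K).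
Implicit Types P : Z -> Prop.

Lemma lspan_add P u v : lspan P u -> lspan P v -> lspan P (u + v).
Proof.
elim=> [|c z u' h _ IH] hv; first by rewrite add0r.
by rewrite -addrA; apply: lspanD => //; apply: IH.
Qed.

Lemma lspan_scale P c u : lspan P u -> lspan P (c *: u).
Proof.
elim=> [|d z u' h _ IH]; first by rewrite scaler0; apply: lspan0.
by rewrite scalerDr scalerA; apply: lspanD.
Qed.

Lemma lspan_gen P u : P u -> lspan P u.
Proof.
by move=> h; rewrite -[u]scale1r -[_ *: _]addr0; apply: lspanD => //; apply: lspan0.
Qed.

Lemma lspan_sum P (I : Type) (r : seq I) (F : I -> Z) :
  (forall i, lspan P (F i)) -> lspan P (\sum_(i <- r) F i).
Proof.
by move=> h; elim/big_ind: _ => // [|u v]; [apply: lspan0 | apply: lspan_add].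
Qed.

End Span.

Lemma lspan_linear (K : fieldType) (Z Z' : lmodType K) (P : Z -> Prop)
    (Q : Z' -> Prop) (f : Z -> Z') u :
  linear f -> (forall z, P z -> lspan Q (f z)) -> lspan P u -> lspan Q (f u).
Proof.
move=> L h; elim=> [|c z v hz _ IH].
  by have := L (-1) 0 0; rewrite scaler0 addr0 scaleN1r addNr => ->; apply: lspan0.
by rewrite L; apply: lspan_add => //; apply: lspan_scale; apply: h.
Qed.

Lemma lspan_map (K : fieldType) (Z Z' : lmodType K) (P : Z -> Prop)
    (Q : Z' -> Prop) (f : {linear Z -> Z'}) u :
  (forall z, P z -> lspan Q (f z)) -> lspan P u -> lspan Q (f u).
Proof. by apply: lspan_linear => a x y; rewrite linearP. Qed.

(* [pmod R] is the free [K]-vector space on [S] divided by the span of all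
   [<<z>> - (a *: <<x>> + <<y>>)] with [R a x y z]. *)
Section Presented.
Variables (K : fieldType) (S : choiceType) (R : K -> S -> S -> S -> Prop).

Local Notation gen x := (<< 1 *g x >> : {freeg S / K}).

Definition relator (u : {freeg S / K}) : Prop :=
  exists a x y z, R a x y z /\ u = gen z - (a *: gen x + gen y).

Local Notation relspan := (lspan relator).

Definition pequiv (u v : {freeg S / K}) : bool := `[< relspan (u - v) >].

Lemma pequiv_refl : reflexive pequiv.
Proof. by move=> u; apply/asboolP; rewrite subrr; apply: lspan0. Qed.

Lemma pequiv_sym : symmetric pequiv.
Proof.
suff h u v : pequiv u v -> pequiv v u by move=> u v; apply/idP/idP; apply: h.
by move=> /asboolP/(lspan_scale (-1)) huv; apply/asboolP; rewrite -opprB -scaleN1r.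
Qed.

Lemma pequiv_trans : transitive pequiv.
Proof.
move=> v u w /asboolP huv /asboolP hvw; apply/asboolP.
by rewrite -(subrKA v); apply: lspan_add.
Qed.

Canonical pequiv_equiv := EquivRel pequiv pequiv_refl pequiv_sym pequiv_trans.

Definition pmod := {eq_quot pequiv}.

HB.instance Definition _ := Choice.on pmod.
HB.instance Definition _ := Quotient.on pmod.
HB.instance Definition _ : EqQuotient _ pequiv pmod := EqQuotient.on pmod.

Lemma pmod_eqP (u v : {freeg S / K}) : \pi_pmod u = \pi_pmod v <-> relspan (u - v).
Proof. by split=> [/eqmodP/asboolP|h] //; apply/eqmodP/asboolP. Qed.

Lemma pmod_repr (u : {freeg S / K}) : relspan (repr (\pi_pmod u) - u).
Proof. by apply/pmod_eqP; rewrite reprK. Qed.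

Definition padd (x y : pmod) := \pi_pmod (repr x + repr y).
Definition popp (x : pmod) := \pi_pmod (- repr x).
Definition pscale (a : K) (x : pmod) := \pi_pmod (a *: repr x).

Lemma paddE u v : padd (\pi u) (\pi v) = \pi_pmod (u + v).
Proof. by apply/pmod_eqP; rewrite opprD addrACA; apply: lspan_add; apply: pmod_repr. Qed.
Lemma poppE u : popp (\pi u) = \pi_pmod (- u).
Proof.
by apply/pmod_eqP; rewrite -opprD -scaleN1r; apply: lspan_scale; apply: pmod_repr.
Qed.
Lemma pscaleE a u : pscale a (\pi u) = \pi_pmod (a *: u).
Proof. by apply/pmod_eqP; rewrite -scalerBr; apply: lspan_scale; apply: pmod_repr. Qed.

Lemma paddA : associative padd.
Proof. by elim/quotW=> u; elim/quotW=> v; elim/quotW=> w; rewrite !paddE addrA. Qed.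
Lemma paddC : commutative padd.
Proof. by elim/quotW=> u; elim/quotW=> v; rewrite !paddE addrC. Qed.
Lemma padd0 : left_id (\pi_pmod 0) padd.
Proof. by elim/quotW=> u; rewrite paddE add0r. Qed.
Lemma paddN : left_inverse (\pi_pmod 0) popp padd.
Proof. by elim/quotW=> u; rewrite poppE paddE addNr. Qed.

HB.instance Definition _ := GRing.isZmodule.Build pmod paddA paddC padd0 paddN.

Lemma piD u v : \pi_pmod (u + v) = \pi_pmod u + \pi_pmod v.
Proof. by rewrite -paddE. Qed.

Lemma pscaleA a b x : pscale a (pscale b x) = pscale (a * b) x.
Proof. by elim/quotW: x => u; rewrite !pscaleE scalerA. Qed.
Lemma pscale1 : left_id 1 pscale.
Proof. by elim/quotW=> u; rewrite pscaleE scale1r. Qed.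
Lemma pscaleDr : right_distributive pscale +%R.
Proof.
move=> a; elim/quotW=> u; elim/quotW=> v.
by rewrite -piD !pscaleE -piD scalerDr.
Qed.
Lemma pscaleDl x : {morph pscale^~ x : a b / a + b}.
Proof.
by elim/quotW: x => u a b; rewrite !pscaleE -piD scalerDl.
Qed.

HB.instance Definition _ :=
  GRing.Zmodule_isLmodule.Build K pmod pscaleA pscale1 pscaleDr pscaleDl.

Lemma pi_linear : linear (fun u => \pi_pmod u).
Proof.
move=> a u v; rewrite -paddE -pscaleE; reflexivity.
Qed.

Definition pgen (x : S) : pmod := \pi_pmod (gen x).

Lemma pgen_rel a x y z : R a x y z -> pgen z = a *: pgen x + pgen y.
Proof.
move=> h; rewrite /pgen -pi_linear; apply/pmod_eqP.
by apply: lspan_gen; exists a, x, y, z.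
Qed.

Definition respects (Z : lmodType K) (f : S -> Z) :=
  forall a x y z, R a x y z -> f z = a *: f x + f y.

(* The value at [x] of the linear map extending [f]; meaningful when [f]
   respects the relations. *)
Definition pext (Z : lmodType K) (f : S -> Z) (x : pmod) : Z := fglift f (repr x).

Lemma fglift_linear (Z : lmodType K) (f : S -> Z) : linear (fglift f).
Proof.
have D := lift_is_additive f.
have hD : {morph fglift f : u v / u + v}.
  move=> u v; have := D u (- v); rewrite opprK => ->.
  have := D 0 v; have := D 0 0; rewrite !subrr => -> ; rewrite sub0r sub0r => ->.
  by rewrite opprK.
have h0 : fglift f 0 = 0 by have := D 0 0; rewrite !subrr.
move=> a u v; rewrite hD; congr (_ + _).
rewrite -[in RHS](freeg_sumE u) (_ : a *: u = \sum_(z <- dom u) << (a * coeff z u) *g z >>) //.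
rewrite !(big_morph (fglift f) hD h0) scaler_sumr; apply: eq_bigr => z _.
by rewrite !liftU scalerA.
Qed.

HB.instance Definition _ (Z : lmodType K) (f : S -> Z) :=
  GRing.isLinear.Build K {freeg S / K} Z _ (fglift f) (fglift_linear f).

Lemma pext_linear_fun (Z : lmodType K) a (f g : S -> Z) x :
  pext (fun s => a *: f s + g s) x = a *: pext f x + pext g x.
Proof.
rewrite /pext; move: (repr x) => u.
have E (h : S -> Z) : fglift h u = \sum_(z <- dom u) coeff z u *: h z.
  rewrite -[in LHS](freeg_sumE u) linear_sum; apply: eq_bigr => z _.
  exact: liftU.
rewrite !E scaler_sumr -big_split; apply: eq_bigr => z _ /=.
by rewrite scalerDr !scalerA mulrC.
Qed.

Section Lift.
Variables (Z : lmodType K) (f : S -> Z) (fP : respects f).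

Lemma fglift_relspan u : relspan u -> fglift f u = 0.
Proof.
elim=> [|c _ v [a [x [y [z [h ->]]]]] _ IH]; first exact: linear0.
by rewrite fglift_linear IH addr0 linearB /= fglift_linear !liftU !scale1r (fP h) subrr scaler0.
Qed.

Lemma pextE u : pext f (\pi u) = fglift f u.
Proof.
by have /fglift_relspan := pmod_repr u; rewrite linearB => /eqP; rewrite subr_eq0 => /eqP.
Qed.

Definition plift : pmod -> Z := let _ := fP in pext f.

Lemma plift_linear : linear plift.
Proof.
move=> a; rewrite /plift; elim/quotW=> u; elim/quotW=> v.
by rewrite -pi_linear !pextE fglift_linear.
Qed.
HB.instance Definition _ := GRing.isLinear.Build K pmod Z _ plift (plift_linear).

Lemma pext_gen x : pext f (pgen x) = f x.
Proof. by rewrite pextE liftU scale1r. Qed.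

Lemma plift_gen x : plift (pgen x) = f x.
Proof. exact: pext_gen. Qed.

End Lift.

Lemma pmod_ind (P : pmod -> Prop) : P 0 ->
  (forall c s x, P x -> P (c *: pgen s + x)) -> forall x, P x.
Proof.
move=> P0 PD; elim/quotW=> u; rewrite -(freeg_sumE u).
have pi0 : \pi_pmod (0 : {freeg S / K}) = 0 by [].
elim: (dom u) => [|s r IH]; first by rewrite big_nil pi0.
rewrite big_cons.
have -> : << coeff s u *g s >> = coeff s u *: gen s.
  by apply/eqP/freeg_eqP => z; rewrite coeffZ !coeffU mul1r.
by rewrite pi_linear; apply: PD.
Qed.

Lemma pmod_ext (Z : lmodType K) (f g : {linear pmod -> Z}) :
  (forall s, f (pgen s) = g (pgen s)) -> f =1 g.
Proof.
move=> h; elim/pmod_ind=> [|c s x IH]; first by rewrite !linear0.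
by rewrite !linearP h IH.
Qed.

End Presented.

Inductive tens_rel (K : fieldType) (U W : lmodType K) :
    K -> U * W -> U * W -> U * W -> Prop :=
| tens_rel_l a u u' w : tens_rel a (u, w) (u', w) (a *: u + u', w)
| tens_rel_r a u w w' : tens_rel a (u, w) (u, w') (u, a *: w + w').

Definition tens (K : fieldType) (U W : lmodType K) := pmod (@tens_rel K U W).
HB.instance Definition _ (K : fieldType) (U W : lmodType K) :=
  GRing.Lmodule.on (tens U W).

Reserved Notation "U ⊗ W" (at level 40, left associativity).
Reserved Notation "u ⊠ w" (at level 40, left associativity).
Notation "U ⊗ W" := (tens U W) : type_scope.
Notation "U ⊗ W" := (tens U W) : ring_scope.

Definition tpair (K : fieldType) (U W : lmodType K) (u : U) (w : W) : (U ⊗ W) :=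
  pgen (@tens_rel K U W) (u, w).
Notation "u ⊠ w" := (tpair u w) : ring_scope.

Section Tensor.
Variable K : fieldType.
Implicit Types U V W Z : lmodType K.

Definition bilin U W Z (f : U -> W -> Z) :=
  (forall w, linear (f^~ w)) /\ (forall u, linear (f u)).

Lemma tpair_bilin U W : bilin (@tpair K U W).
Proof. by split=> [w a u u'|u a w w']; apply: pgen_rel; constructor. Qed.

Lemma tpair0l U W (w : W) : (0 : U) ⊠ w = 0.
Proof.
by have := (tpair_bilin U W).1 w (-1) 0 0; rewrite scaler0 addr0 scaleN1r addNr.
Qed.

Lemma tpair0r U W (u : U) : u ⊠ (0 : W) = 0.
Proof.
by have := (tpair_bilin U W).2 u (-1) 0 0; rewrite scaler0 addr0 scaleN1r addNr.
Qed.

Lemma bilin_respects U W Z (f : U -> W -> Z) :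
  bilin f -> respects (@tens_rel K U W) (fun p => f p.1 p.2).
Proof. by case=> hl hr a x y z; case=> *; [apply: hl | apply: hr]. Qed.

Definition tlift U W Z (f : U -> W -> Z) (fP : bilin f) : {linear U ⊗ W -> Z} :=
  plift (bilin_respects fP).


Lemma tliftE U W Z (f : U -> W -> Z) (fP : bilin f) u w : tlift fP (u ⊠ w) = f u w.
Proof. exact: plift_gen. Qed.

Lemma tens_ext U W Z (f g : {linear U ⊗ W -> Z}) :
  (forall u w, f (u ⊠ w) = g (u ⊠ w)) -> f =1 g.
Proof. by move=> h; apply: pmod_ext => -[u w]; apply: h. Qed.

Lemma tensmap_bilin U U' W W' (f : {linear U -> U'}) (g : {linear W -> W'}) :
  bilin (fun u w => f u ⊠ g w).
Proof.
split=> [w a u u'|u a w w']; rewrite linearP; first exact: (tpair_bilin U' W').1.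
exact: (tpair_bilin U' W').2.
Qed.

Definition tensmap U U' W W' (f : {linear U -> U'}) (g : {linear W -> W'}) :
  {linear U ⊗ W -> U' ⊗ W'} := tlift (tensmap_bilin f g).


Lemma tensmapE U U' W W' (f : {linear U -> U'}) (g : {linear W -> W'}) u w :
  tensmap f g (u ⊠ w) = f u ⊠ g w.
Proof. exact: tliftE. Qed.

Lemma assoc_r_bilin U V W (w : W) : bilin (fun (u : U) (v : V) => u ⊠ (v ⊠ w)).
Proof.
split=> [v a u u'|u a v v']; first exact: (tpair_bilin U (V ⊗ W)).1.
by rewrite (tpair_bilin V W).1 (tpair_bilin U (V ⊗ W)).2.
Qed.

Lemma assoc_bilin U V W :
  bilin (fun (p : U ⊗ V) (w : W) => tlift (@assoc_r_bilin U V W w) p).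
Proof.
split=> [w|p a w w']; first exact: linearP.
rewrite /tlift /= /plift -pext_linear_fun; congr (pext _ p).
apply/funext => -[u v] /=.
by rewrite (tpair_bilin V W).2 (tpair_bilin U (V ⊗ W)).2.
Qed.

Definition assoc U V W : {linear (U ⊗ V) ⊗ W -> U ⊗ (V ⊗ W)} := tlift (@assoc_bilin U V W).


Lemma assocE U V W (u : U) (v : V) (w : W) : assoc U V W (u ⊠ v ⊠ w) = u ⊠ (v ⊠ w).
Proof. by rewrite /assoc !tliftE. Qed.

Lemma unassoc_l_bilin U V W (u : U) : bilin (fun (v : V) (w : W) => u ⊠ v ⊠ w).
Proof.
split=> [w a v v'|v a w w']; last exact: (tpair_bilin (U ⊗ V) W).2.
by rewrite (tpair_bilin U V).2 (tpair_bilin (U ⊗ V) W).1.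
Qed.

Lemma unassoc_bilin U V W :
  bilin (fun (u : U) (q : V ⊗ W) => tlift (@unassoc_l_bilin U V W u) q).
Proof.
split=> [q a u u'|u]; last exact: linearP.
rewrite /tlift /= /plift -pext_linear_fun; congr (pext _ q).
apply/funext => -[v w] /=.
by rewrite (tpair_bilin U V).1 (tpair_bilin (U ⊗ V) W).1.
Qed.

Definition unassoc U V W : {linear U ⊗ (V ⊗ W) -> (U ⊗ V) ⊗ W} :=
  tlift (@unassoc_bilin U V W).


Lemma unassocE U V W (u : U) (v : V) (w : W) : unassoc U V W (u ⊠ (v ⊠ w)) = u ⊠ v ⊠ w.
Proof. by rewrite /unassoc !tliftE. Qed.

Definition op1 (A : lmodType K) (s : {linear A ⊗ A -> A ⊗ A}) :
    {linear A ⊗ A ⊗ A -> A ⊗ A ⊗ A} := tensmap s idfun.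
Definition op2 (A : lmodType K) (s : {linear A ⊗ A -> A ⊗ A}) :
    {linear A ⊗ A ⊗ A -> A ⊗ A ⊗ A} :=
  unassoc A A A \o tensmap idfun s \o assoc A A A.

Definition braiding (A : lmodType K) (s : {linear A ⊗ A -> A ⊗ A}) : Prop :=
  bijective s /\ op1 s \o op2 s \o op1 s =1 op2 s \o op1 s \o op2 s.

Definition assoc_product (A : lmodType K) (mu : {linear A ⊗ A -> A}) : Prop :=
  mu \o tensmap mu idfun =1 mu \o tensmap idfun mu \o assoc A A A.

Definition YB_compatible (A : lmodType K) (mu : {linear A ⊗ A -> A})
    (s : {linear A ⊗ A -> A ⊗ A}) : Prop :=
  tensmap idfun mu \o assoc A A A \o op1 s \o op2 s =1 s \o tensmap mu idfun /\
  tensmap mu idfun \o op2 s \o op1 s =1 s \o tensmap idfun mu \o assoc A A A.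

Definition unit_of (A : lmodType K) (mu : {linear A ⊗ A -> A}) (e : A) : Prop :=
  forall a, mu (e ⊠ a) = a /\ mu (a ⊠ e) = a.

Definition braid_unit (A : lmodType K) (s : {linear A ⊗ A -> A ⊗ A}) (e : A) : Prop :=
  forall a, s (e ⊠ a) = a ⊠ e /\ s (a ⊠ e) = e ⊠ a.

Definition nonunital_YB_algebra (A : lmodType K) (mu : {linear A ⊗ A -> A})
    (s : {linear A ⊗ A -> A ⊗ A}) : Prop :=
  [/\ braiding s, assoc_product mu & YB_compatible mu s].

(* [e] is the unit of the algebra [(A, mu)]. *)
Definition YB_algebra (A : lmodType K) (mu : {linear A ⊗ A -> A}) (e : A)
    (s : {linear A ⊗ A -> A ⊗ A}) : Prop :=
  [/\ nonunital_YB_algebra mu s, unit_of mu e & braid_unit s e].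

End Tensor.

(* [talg V], the direct sum of the [V^{⊗n}], is obtained at once as the quotient of
   the free vector space on all words in [V] by multilinearity in every letter;
   [word [:: v_1; ...; v_n]] is the pure tensor of the [v_i] and [word [::]] is
   the unit of [K = V^{⊗0}]. *)

Inductive talg_rel (K : fieldType) (V : lmodType K) :
    K -> seq V -> seq V -> seq V -> Prop :=
| Talg_rel a l x y r :
    talg_rel a (l ++ x :: r) (l ++ y :: r) (l ++ (a *: x + y) :: r).

Definition talg (K : fieldType) (V : lmodType K) := pmod (@talg_rel K V).
HB.instance Definition _ (K : fieldType) (V : lmodType K) := GRing.Lmodule.on (talg V).

Definition word (K : fieldType) (V : lmodType K) (s : seq V) : talg V :=
  pgen (@talg_rel K V) s.

Section TensorAlgebra.
Variable K : fieldType.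
Implicit Types V W Z : lmodType K.

Definition multilin V Z (f : seq V -> Z) :=
  forall a l x y r,
    f (l ++ (a *: x + y) :: r) = a *: f (l ++ x :: r) + f (l ++ y :: r).

Lemma multilin_respects V Z (f : seq V -> Z) :
  multilin f -> respects (@talg_rel K V) f.
Proof. by move=> h a x y z [] *; apply: h. Qed.

Definition wlift V Z (f : seq V -> Z) (fP : multilin f) : {linear talg V -> Z} :=
  plift (multilin_respects fP).


Lemma wliftE V Z (f : seq V -> Z) (fP : multilin f) s : wlift fP (word s) = f s.
Proof. exact: plift_gen. Qed.

Lemma word_multilin V : multilin (@word K V).
Proof. by move=> a l x y r; apply: pgen_rel. Qed.

Lemma talg_ext V Z (f g : {linear talg V -> Z}) :
  (forall s, f (word s) = g (word s)) -> f =1 g.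
Proof. exact: pmod_ext. Qed.

Definition bimultilin V W Z (f : seq V -> seq W -> Z) :=
  (forall t, multilin (f^~ t)) /\ (forall s, multilin (f s)).

Lemma wlift2_inner V W Z (f : seq V -> seq W -> Z) (fP : bimultilin f) (y : talg W) :
  multilin (fun s => wlift (fP.2 s) y).
Proof.
move=> a l x x' r; rewrite /wlift /= /plift -pext_linear_fun; congr (pext _ y).
by apply/funext => t; apply: fP.1.
Qed.

Lemma wlift2_bilin V W Z (f : seq V -> seq W -> Z) (fP : bimultilin f) :
  bilin (fun x y => wlift (wlift2_inner fP y) x).
Proof.
split=> [y|x a y y']; first exact: linearP.
rewrite /wlift /= /plift -pext_linear_fun; congr (pext _ x).
by apply/funext => s; apply: (linearP (wlift (fP.2 s))).
Qed.

Definition wlift2 V W Z (f : seq V -> seq W -> Z) (fP : bimultilin f) :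
  {linear talg V ⊗ talg W -> Z} := tlift (wlift2_bilin fP).


Lemma wlift2E V W Z (f : seq V -> seq W -> Z) (fP : bimultilin f) s t :
  wlift2 fP (word s ⊠ word t) = f s t.
Proof. by rewrite /wlift2 tliftE !wliftE. Qed.

Lemma ttalg_ext V W Z (f g : {linear talg V ⊗ talg W -> Z}) :
  (forall s t, f (word s ⊠ word t) = g (word s ⊠ word t)) -> f =1 g.
Proof.
move=> h; apply: tens_ext => x y; move: x; apply: pmod_ind => [|c s x IHx].
  by rewrite tpair0l !linear0.
rewrite (tpair_bilin _ _).1 !linearP IHx; congr (_ *: _ + _).
move: y {IHx}; apply: pmod_ind => [|d t y IHy].
  by rewrite tpair0r !linear0.
by rewrite (tpair_bilin _ _).2 !linearP IHy (h s t).
Qed.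

Lemma tcat_bimultilin V : bimultilin (fun s t : seq V => word (s ++ t)).
Proof.
split=> [t|s] a l x y r; first by rewrite -!catA word_multilin.
by rewrite !catA word_multilin.
Qed.
Definition tcat V : {linear talg V ⊗ talg V -> talg V} := wlift2 (@tcat_bimultilin V).
Notation "x ** y" := (tcat _ (x ⊠ y)) (at level 40, left associativity) : ring_scope.

Lemma tcatE V (s t : seq V) : word s ** word t = word (s ++ t).
Proof. exact: wlift2E. Qed.

Lemma tcatl V (y : talg V) : linear (fun x => x ** y).
Proof. by move=> a x x'; rewrite (tpair_bilin _ _).1 linearP. Qed.
Lemma tcatr V (x : talg V) : linear (fun y => x ** y).
Proof. by move=> a y y'; rewrite (tpair_bilin _ _).2 linearP. Qed.

Definition inj1 V (v : V) : talg V := word [:: v].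
Lemma inj1_linear V : linear (@inj1 V).
Proof. by move=> a x y; apply: (word_multilin a [::] x y [::]). Qed.
HB.instance Definition _ V := GRing.isLinear.Build K V (talg V) _ (@inj1 V) (@inj1_linear V).

Lemma inj2_bilin V : bilin (fun u v : V => word [:: u; v]).
Proof.
split=> [v a x y|u a x y]; first exact: (word_multilin a [::] x y [:: v]).
exact: (word_multilin a [:: u] x y [::]).
Qed.
Definition inj2 V : {linear V ⊗ V -> talg V} := tlift (@inj2_bilin V).

Lemma inj2E V (u v : V) : inj2 V (u ⊠ v) = word [:: u; v].
Proof. exact: tliftE. Qed.

Lemma talgmap_multilin V W (f : {linear V -> W}) :
  multilin (fun s => word (map f s)).
Proof. by move=> a l x y r; rewrite !map_cat /= linearP word_multilin. Qed.
Definition talgmap V W (f : {linear V -> W}) : {linear talg V -> talg W} :=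
  wlift (talgmap_multilin f).
Lemma talgmapE V W (f : {linear V -> W}) s : talgmap f (word s) = word (map f s).
Proof. exact: wliftE. Qed.

(* On degree [n >= 1] this is [f ⊗ id^{⊗(n-1)}]; it is [0] in degree [0]. *)

Definition head_word V (f : {linear V -> V ⊗ V}) (s : seq V) : talg V :=
  if s is a :: r then inj2 V (f a) ** word r else 0.
Lemma head_word_multilin V (f : {linear V -> V ⊗ V}) : multilin (head_word f).
Proof.
move=> a [|z l] x y r /=; first by rewrite !linearP tcatl.
by rewrite word_multilin tcatr.
Qed.
Definition apply_head V (f : {linear V -> V ⊗ V}) : {linear talg V -> talg V} :=
  wlift (head_word_multilin f).

(* Positions are counted from [0]: on degree [n > i+1] this extends to
   [id^{⊗i} ⊗ s ⊗ id^{⊗(n-i-2)}]; in lower degrees it is the identity. *)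

Fixpoint sigma_word V (s : {linear V ⊗ V -> V ⊗ V}) (i : nat) (t : seq V) : talg V :=
  match i, t with
  | 0, x :: y :: r => inj2 V (s (x ⊠ y)) ** word r
  | i'.+1, x :: r => word [:: x] ** sigma_word s i' r
  | _, _ => word t
  end.

Lemma sigma_word_multilin V (s : {linear V ⊗ V -> V ⊗ V}) i : multilin (sigma_word s i).
Proof.
elim: i => [|i IH] a [|z l] x y r /=.
- case: r => [|z r]; first exact: (word_multilin a [::]).
  by rewrite (tpair_bilin _ _).1 !linearP tcatl.
- case: l => [|z' l] /=; first by rewrite (tpair_bilin _ _).2 !linearP tcatl.
  by rewrite word_multilin tcatr.
- by rewrite (word_multilin a [::]) tcatl.
- by rewrite IH tcatr.
Qed.
Definition sigma_at V (s : {linear V ⊗ V -> V ⊗ V}) i : {linear talg V -> talg V} :=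
  wlift (sigma_word_multilin s i).

Lemma split_multilin V i :
  multilin (fun s : seq V => word (take i s) ⊠ word (drop i s)).
Proof.
move=> a l x y r; rewrite !take_cat !drop_cat; case: ltnP => _.
  by rewrite word_multilin (tpair_bilin _ _).2.
case: (i - size l)%N => [|k] /=.
  by rewrite (word_multilin a [::]) (tpair_bilin _ _).2.
by rewrite word_multilin (tpair_bilin _ _).1.
Qed.
Definition split_at V i : {linear talg V -> talg V ⊗ talg V} :=
  wlift (@split_multilin V i).

Lemma delta_multilin V : multilin (fun s : seq V =>
  \sum_(0 <= i < (size s).+1) word (take i s) ⊠ word (drop i s)).
Proof.
move=> a l x y r; rewrite scaler_sumr !size_cat /= -big_split /=.
by apply: eq_bigr => i _; rewrite split_multilin.
Qed.
Definition delta V : {linear talg V -> talg V ⊗ talg V} := wlift (@delta_multilin V).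

Lemma eps_multilin V : multilin (fun s : seq V => (nilp s)%:R : K^o).
Proof. by move=> a [|z l] x y r; rewrite /= scaler0 addr0. Qed.
Definition eps V : {linear talg V -> K^o} := wlift (@eps_multilin V).

End TensorAlgebra.
Notation "x ** y" := (tcat _ (x ⊠ y)) (at level 40, left associativity) : ring_scope.

(* [adj i] is the transposition [s_{i+1}] exchanging [i] and [i+1] in ['I_n].
   Products of permutations are read from right to left here, so that
   [s_i s_j] is [adj j * adj i] in the group ['S_n]. *)
Section Reduced.
Variable n : nat.
Implicit Types (w : 'S_n) (i : 'I_n.-1).

Definition lo i : 'I_n := widen_ord (leq_pred n) i.
Lemma hi_subproof i : (i.+1 < n)%N.
Proof. by rewrite -ltn_predRL. Qed.
Definition hi i : 'I_n := Ordinal (hi_subproof i).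

Definition adj i : 'S_n := tperm (lo i) (hi i).

Definition word_perm (s : seq 'I_n.-1) : 'S_n := foldr (fun i w => (w * adj i)%g) 1%g s.

Definition inversions w : nat :=
  #|[set p : 'I_n * 'I_n | (p.1 < p.2)%N && (w p.2 < w p.1)%N]|.

(* Since [adj i * w = w s_i], a descent [i] of [w] may be taken as last letter. *)
Fixpoint bubble k w : seq 'I_n.-1 :=
  if k is k'.+1 then
    if [pick i | (w (hi i) < w (lo i))%N] is Some i
    then rcons (bubble k' (adj i * w)%g) i else [::]
  else [::].

Definition reduced_expr w := bubble (inversions w) w.

Definition is_reduced w (s : seq 'I_n.-1) : Prop :=
  word_perm s = w /\ forall s', word_perm s' = w -> (size s <= size s')%N.

Lemma word_perm_rcons s i : word_perm (rcons s i) = (adj i * word_perm s)%g.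
Proof.
elim: s => [|j s IH] /=; first by rewrite mul1g mulg1.
by rewrite IH mulgA.
Qed.

Lemma adjV i : (adj i * adj i = 1)%g.
Proof. exact: tperm2. Qed.

Lemma adj_val i (x : 'I_n) : val (adj i x) =
  if x == i :> nat then i.+1 else if x == i.+1 :> nat then i : nat else x.
Proof.
rewrite /adj; case: tpermP => [->|->|/eqP h1 /eqP h2] /=; first by rewrite eqxx.
  by rewrite eqxx; case: ifP => [/eqP|//]; lia.
by rewrite (negbTE (h1 : (x != i :> nat))) (negbTE (h2 : (x != i.+1 :> nat))).
Qed.

Lemma swap_lt (i x y : nat) : (x < y)%N -> ~~ ((x == i) && (y == i.+1)) ->
  let sw z := if z == i then i.+1 else if z == i.+1 then i else z in
  (sw x < sw y)%N && ~~ ((sw x == i) && (sw y == i.+1)).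
Proof.
move=> xy ne /=.
case: (x =P i) ne => ex; case: (y =P i) => ey; case: (y =P i.+1) => ey';
  case: (x =P i.+1) => ex' //= _; lia.
Qed.

Lemma inversions_adj w i :
  (w (hi i) < w (lo i))%N -> inversions w = (inversions (adj i * w)%g).+1.
Proof.
move=> h; pose phi (p : 'I_n * 'I_n) := (adj i p.1, adj i p.2).
have phiK : involutive phi.
  by move=> [x y]; rewrite /phi /= -!permM adjV !perm1.
rewrite /inversions (cardsD1 (lo i, hi i)) !inE /= ltnSn h add1n; congr _.+1.
rewrite -(card_imset _ (inv_inj phiK)); apply: eq_card => -[x y].
rewrite !inE; apply/imsetP/idP.
  move=> [[x' y']]; rewrite !inE /= => /and3P[ne xy wyx] [-> ->].
  rewrite !permM -!(permM (adj i) (adj i)) adjV !perm1 wyx andbT !adj_val.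
  by move: ne; rewrite xpair_eqE -!val_eqE => /(swap_lt xy)/andP[].
move=> /andP[/= xy]; rewrite !permM => wyx; exists (phi (x, y)); last by rewrite phiK.
rewrite !inE /= wyx andbT xpair_eqE -!val_eqE /= !adj_val.
rewrite andbC; apply: swap_lt xy _; apply/negP => /andP[/eqP ex /eqP ey].
have exl : x = lo i by apply: val_inj.
have eyh : y = hi i by apply: val_inj.
by move: wyx; rewrite exl eyh tpermL tpermR ltnNge (ltnW h).
Qed.

Lemma inversions_adj_le w i : (inversions (adj i * w)%g <= (inversions w).+1)%N.
Proof.
have [h|h] := ltnP (w (hi i)) (w (lo i)); first by rewrite (inversions_adj h) leqW.
have := @inversions_adj (adj i * w)%g i; rewrite mulgA adjV mul1g => -> //.
rewrite !permM tpermL tpermR ltn_neqAle h andbT; apply/negP => /eqP/val_inj/perm_inj.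
by move=> /(congr1 val) /=; lia.
Qed.

Lemma incr_id w : (forall i, ~~ (w (hi i) < w (lo i))%N) -> w = 1%g.
Proof.
move=> h.
have mono (x y : 'I_n) : (x < y)%N -> (w x < w y)%N.
  move: y => [y hy] /=; elim: y hy => // y IH hy xy.
  have hi0 : (y < n.-1)%N by rewrite ltn_predRL.
  have hy' : (y < n)%N by apply: ltnW.
  have step : (w (Ordinal hy') < w (Ordinal hy))%N.
    have := h (Ordinal hi0); rewrite -leqNgt.
    have -> : lo (Ordinal hi0) = Ordinal hy' by apply: val_inj.
    have -> : hi (Ordinal hi0) = Ordinal hy by apply: val_inj.
    rewrite leq_eqVlt => /orP[/eqP/val_inj/perm_inj/(congr1 val) /=|//]; lia.
  move: xy; rewrite ltnS leq_eqVlt => /orP[/eqP e|xy].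
    by have -> : x = Ordinal hy' by apply: val_inj.
  exact: ltn_trans (IH hy' xy) step.
have ge (u : 'S_n) : (forall x y : 'I_n, (x < y)%N -> (u x < u y)%N) ->
    forall x : 'I_n, (x <= u x)%N.
  move=> um [x hx] /=; elim: x hx => // x IH hx.
  by have := um (Ordinal (ltnW hx)) (Ordinal hx) (ltnSn _); apply: leq_ltn_trans (IH _).
have monoV (x y : 'I_n) : (x < y)%N -> ((w^-1)%g x < (w^-1)%g y)%N.
  move=> xy; rewrite ltnNge leq_eqVlt; apply/negP => /orP[/eqP/val_inj/perm_inj e|].
    by rewrite e ltnn in xy.
  by move=> /mono; rewrite !permKV ltnNge (ltnW xy).
apply/permP => x; rewrite perm1; apply/val_inj/eqP; rewrite eqn_leq (ge w mono) andbT.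
by have := ge _ monoV (w x); rewrite permK.
Qed.

Lemma inversions1 : inversions 1%g = 0.
Proof.
by apply: eq_card0 => -[x y]; rewrite !inE /= !perm1; lia.
Qed.

Lemma size_word_perm s : (inversions (word_perm s) <= size s)%N.
Proof.
elim/last_ind: s => [|s i IH]; first by rewrite inversions1.
rewrite word_perm_rcons size_rcons.
by apply: leq_trans (inversions_adj_le _ _) _.
Qed.

Lemma bubbleP k w : inversions w = k -> word_perm (bubble k w) = w /\ size (bubble k w) = k.
Proof.
elim: k w => [|k IH] w hk /=.
  split=> //; apply/esym/incr_id => i; apply/negP => /inversions_adj.
  by rewrite hk.
case: pickP => [i hi|h]; last first.
  have e : w = 1%g by apply: incr_id => i; rewrite h.
  by move: hk; rewrite e inversions1.
have := inversions_adj hi; rewrite hk => -[/esym/IH[e1 e2]].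
by rewrite word_perm_rcons e1 mulgA adjV mul1g size_rcons e2.
Qed.

Lemma reduced_exprP w : is_reduced w (reduced_expr w).
Proof.
have [e1 e2] := bubbleP (erefl (inversions w)); split=> // s es.
by rewrite e2 -es size_word_perm.
Qed.

End Reduced.

(* Counting points from [0], [k < i] is sent to [j + k] and [i + k] to [k]. *)
Definition chi_fun i j (k : 'I_(i + j)) : 'I_(i + j) :=
  cast_ord (addnC j i) (match split k with
                        | inl a => rshift j a
                        | inr b => lshift i b
                        end).
Lemma chi_funE i j (k : 'I_(i + j)) :
  val (chi_fun k) = if (k < i)%N then (j + k)%N else (k - i)%N.
Proof.
by rewrite /chi_fun; case: splitP => a e /=; have := ltn_ord a; case: (ltnP k i) => /=; lia.
Qed.
Lemma chi_inj i j : injective (@chi_fun i j).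
Proof.
move=> x y /(congr1 val); rewrite !chi_funE => e; apply: val_inj => /=.
by have := ltn_ord x; have := ltn_ord y; move: e; case: (ltnP x i); case: (ltnP y i) => /=; lia.
Qed.
Definition chi i j : 'S_(i + j) := perm (@chi_inj i j).

Section Beta.
Variables (K : fieldType) (V : lmodType K) (s : {linear V ⊗ V -> V ⊗ V}).
Local Notation T := (talg V).

(* [σ_{i_1} ... σ_{i_l}] on degree [n], for a reduced expression [i_1, ..., i_l] of
   [w]; when [s] is a braiding the choice of the latter does not matter. *)
Definition braid_op n (w : 'S_n) : {linear T -> T} :=
  foldr (fun (i : 'I_n.-1) (f : {linear T -> T}) => sigma_at s i \o f : {linear T -> T})
        idfun (reduced_expr w).

Definition beta_word (t u : seq V) : T ⊗ T :=
  match t, u with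
  | _ :: _, _ :: _ =>
      split_at V (size u) (braid_op (chi (size t) (size u)) (word (t ++ u)))
  | _, _ => word u ⊠ word t
  end.

Lemma beta_word_bimultilin : bimultilin beta_word.
Proof.
split=> [u|t] a l x y r.
  case: u => [|z u].
    have E t : beta_word t [::] = word [::] ⊠ word t by case: t.
    by rewrite !E word_multilin (tpair_bilin _ _).2.
  have E v : beta_word (l ++ v :: r) (z :: u) =
     split_at V (size u).+1 (braid_op (chi (size l + (size r).+1) (size u).+1)
       (word (l ++ v :: r ++ z :: u))).
    have -> : beta_word (l ++ v :: r) (z :: u) = split_at V (size u).+1
       (braid_op (chi (size (l ++ v :: r)) (size u).+1) (word ((l ++ v :: r) ++ z :: u))).
      by case: l.
    by rewrite size_cat -catA.
  by rewrite !E word_multilin !linearP.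
case: t => [|z t].
  by rewrite /= word_multilin (tpair_bilin _ _).1.
have E v : beta_word (z :: t) (l ++ v :: r) =
   split_at V (size l + (size r).+1) (braid_op (chi (size t).+1 (size l + (size r).+1))
     (word ((z :: t ++ l) ++ v :: r))).
  have -> : beta_word (z :: t) (l ++ v :: r) = split_at V (size (l ++ v :: r))
     (braid_op (chi (size t).+1 (size (l ++ v :: r))) (word ((z :: t) ++ l ++ v :: r))).
    by case: l.
  by rewrite size_cat /= -catA.
by rewrite !E word_multilin !linearP.
Qed.

Definition beta : {linear T ⊗ T -> T ⊗ T} := wlift2 beta_word_bimultilin.

Definition mid (b : {linear T ⊗ T -> T ⊗ T}) : {linear T ⊗ (T ⊗ T) -> T ⊗ (T ⊗ T)} :=
  assoc T T T \o tensmap b idfun \o unassoc T T T.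

(* [id ⊗ b ⊗ id] on the four-fold tensor power of [T] *)
Definition tens_interchange (b : {linear T ⊗ T -> T ⊗ T}) :
    {linear (T ⊗ T) ⊗ (T ⊗ T) -> (T ⊗ T) ⊗ (T ⊗ T)} :=
  unassoc T T (T ⊗ T) \o tensmap idfun (mid b) \o assoc T T (T ⊗ T).

Lemma tens_interchangeE (b : {linear T ⊗ T -> T ⊗ T}) x y z t :
  tens_interchange b ((x ⊠ y) ⊠ (z ⊠ t)) =
  unassoc T T (T ⊗ T) (x ⊠ assoc T T T (b (y ⊠ z) ⊠ t)).
Proof.
rewrite -[LHS]/(unassoc _ _ _ (tensmap idfun (mid b) (assoc _ _ _ _))) assocE tensmapE.
by rewrite -[mid b _]/(assoc _ _ _ (tensmap b idfun (unassoc _ _ _ _))) unassocE tensmapE.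
Qed.

Definition cop_beta : {linear T ⊗ T -> (T ⊗ T) ⊗ (T ⊗ T)} :=
  tens_interchange beta \o tensmap (delta V) (delta V).

(* [Δ_β^{(n)}], with values in [(T ⊗ T)^{⊗(n+1)}], the part of degree [n+1] of
   the tensor algebra of [T ⊗ T] *)
Fixpoint cop_beta_iter n : {linear T ⊗ T -> talg (T ⊗ T)} :=
  if n is n'.+1 then apply_head cop_beta \o cop_beta_iter n' else @inj1 K (T ⊗ T).

Variable m : {linear V ⊗ V -> V}.

Definition M_word (t u : seq V) : V :=
  match t, u with
  | [:: x], [::] => x
  | [::], [:: y] => y
  | [:: x], [:: y] => m (x ⊠ y)
  | _, _ => 0
  end.

Lemma M_word_bimultilin : bimultilin M_word.
Proof.
split=> [u|t] a l x y r.
  case: l => [|z [|z' l]] /=; case: r => [|z'' r] //=; rewrite ?scaler0 ?addr0 //.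
  by case: u => [|v [|v' u]] //=; rewrite ?scaler0 ?addr0 // (tpair_bilin _ _).1 linearP.
case: t => [|v [|v' t]] /=; case: l => [|z [|z' l]] /=; case: r => [|z'' r] //=;
  rewrite ?scaler0 ?addr0 //.
by rewrite (tpair_bilin _ _).2 linearP.
Qed.
Definition Mmap : {linear T ⊗ T -> V} := wlift2 M_word_bimultilin.

Lemma eps2_bilin : bilin (fun x y : T => ((eps V x : K) * (eps V y : K)) *: word [::] : T).
Proof.
split=> [y|x] a z z'; rewrite linearP.
  by rewrite [X in X *: _]mulrDl scalerDl -mulrA scalerA.
by rewrite [X in X *: _]mulrDr scalerDl mulrCA scalerA.
Qed.
Definition eps2 : {linear T ⊗ T -> T} := tlift eps2_bilin.

(* [M^{⊗n} Δ_β^{(n-1)}], for [n >= 1] *)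
Definition join_term n : {linear T ⊗ T -> T} := talgmap Mmap \o cop_beta_iter n.-1.

Definition join_fun (x : T ⊗ T) : T :=
  eps2 x + \sum_(n \in [set n : nat | (0 < n)%N]) join_term n x.

Definition homog (A : lmodType K) n : talg A -> Prop :=
  lspan (fun x => exists2 t, size t = n & x = word t).
Definition bihomog i j : T ⊗ T -> Prop :=
  lspan (fun x => exists t u, [/\ size t = i, size u = j & x = word t ⊠ word u]).

Lemma pair_lspan (A B C : lmodType K) (P : A -> Prop) (Q : B -> Prop) (R : C -> Prop)
    (f : {linear A ⊗ B -> C}) x y :
  (forall a b, P a -> Q b -> lspan R (f (a ⊠ b))) ->
  lspan P x -> lspan Q y -> lspan R (f (x ⊠ y)).
Proof.
move=> h hx hy; have [L1 L2] := tpair_bilin A B.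
elim: hx => [|c a v Pa _ IH]; first by rewrite tpair0l linear0; apply: lspan0.
rewrite L1 linearP; apply: lspan_add IH; apply: lspan_scale.
elim: hy => [|d b v' Qb _ IH]; first by rewrite tpair0r linear0; apply: lspan0.
by rewrite L2 linearP; apply: lspan_add IH; apply: lspan_scale; apply: h.
Qed.

Lemma homog_cat (A : lmodType K) i j (x y : talg A) :
  homog i x -> homog j y -> homog (i + j) (x ** y).
Proof.
apply: pair_lspan => _ _ [t <- ->] [u <- ->]; rewrite tcatE.
by apply: lspan_gen; exists (t ++ u); rewrite ?size_cat.
Qed.

Lemma homog_inj2 (A : lmodType K) (x : A ⊗ A) : homog 2 (inj2 A x).
Proof.
move: x; apply: pmod_ind => [|c [u v] x IH]; first by rewrite linear0; apply: lspan0.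
rewrite linearP; apply: lspan_add IH; apply: lspan_scale; apply: lspan_gen.
by exists [:: u; v] => //; rewrite -inj2E.
Qed.

Lemma homog_word (A : lmodType K) (t : seq A) : homog (size t) (word t).
Proof. by apply: lspan_gen; exists t. Qed.

Lemma homog_sigma i n (x : T) : homog n x -> homog n (sigma_at s i x).
Proof.
apply: lspan_map => _ [t <- ->]; rewrite /sigma_at wliftE.
elim: i t => [|i IH] [|x0 [|y0 r]] /=; rewrite -/(homog _ _).
- exact: (homog_word [::]).
- exact: (homog_word [:: x0]).
- by apply: (@homog_cat V 2 (size r)); [apply: homog_inj2 | apply: homog_word].
- exact: (homog_word [::]).
- by apply: (@homog_cat V 1 0); [exact: (homog_word [:: x0]) | exact: (IH [::])].
- by apply: (@homog_cat V 1 (size r).+1); [exact: (homog_word [:: x0]) | exact: (IH (y0 :: r))].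
Qed.

Lemma homog_braid_op k (w : 'S_k) n (x : T) : homog n x -> homog n (braid_op w x).
Proof.
by rewrite /braid_op; elim: (reduced_expr w) => //= i r IH hx; apply/homog_sigma/IH.
Qed.

Lemma bihomog_beta t u : bihomog (size u) (size t) (beta (word t ⊠ word u)).
Proof.
rewrite wlift2E.
case: t => [|z t]; first by apply: lspan_gen; exists u, [::].
case: u => [|z' u]; first by apply: lspan_gen; exists [::], (z :: t).
rewrite /beta_word; set t' := z :: t; set u' := z' :: u.
have : homog (size t' + size u') (braid_op (chi (size t') (size u')) (word (t' ++ u'))).
  by apply: homog_braid_op; rewrite -size_cat; apply: homog_word.
apply: lspan_map => _ [v hv ->]; rewrite /split_at wliftE; apply: lspan_gen.
exists (take (size u') v), (drop (size u') v); split=> //.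
  by rewrite size_takel // hv leq_addl.
by rewrite size_drop hv addnK.
Qed.

(* words of length [n] and total degree [d] in [(T ⊗ T)^{⊗n}] *)
Definition multihomog n d : talg (T ⊗ T) -> Prop :=
  lspan (fun x => exists ps : seq (seq V * seq V),
    [/\ size ps = n, sumn [seq (size p.1 + size p.2)%N | p <- ps] = d
      & x = word [seq word p.1 ⊠ word p.2 | p <- ps]]).

Lemma linear_big_sum (Z Z' : lmodType K) (f : Z -> Z') : linear f ->
  forall (I : Type) (r : seq I) (F : I -> Z), f (\sum_(i <- r) F i) = \sum_(i <- r) f (F i).
Proof.
move=> L I r F; elim: r => [|i r IH].
  by rewrite !big_nil; have := L (-1) 0 0; rewrite scaler0 addr0 scaleN1r addNr.
by rewrite !big_cons -[F i]scale1r L IH !scale1r.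
Qed.

Lemma multihomog_cop t u :
  multihomog 2 (size t + size u) (inj2 (T ⊗ T) (cop_beta (word t ⊠ word u))).
Proof.
have [L1 L2] := tpair_bilin T T.
rewrite -[cop_beta _]/(tens_interchange beta (tensmap (delta V) (delta V) (word t ⊠ word u))).
rewrite tensmapE /delta !wliftE.
set F := (X in tens_interchange _ X).
have -> : F = \sum_(0 <= i < (size t).+1) \sum_(0 <= j < (size u).+1)
    ((word (take i t) ⊠ word (drop i t)) ⊠ (word (take j u) ⊠ word (drop j u))).
  have [B1 B2] := tpair_bilin (T ⊗ T) (T ⊗ T).
  rewrite /F (linear_big_sum (B1 _)); apply: eq_bigr => i _.
  by rewrite (linear_big_sum (B2 _)).
rewrite !linear_sum; rewrite -/(multihomog _ _ _).
rewrite big_mkord; apply: lspan_sum => i.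
rewrite !linear_sum big_mkord; apply: lspan_sum => j.
rewrite tens_interchangeE.
have hb := bihomog_beta (drop i t) (take j u).
set a := word (take i t); set d := word (drop j u).
pose G y := inj2 _ (unassoc T T (T ⊗ T) (a ⊠ assoc T T T (y ⊠ d))).
have Glin : linear G.
  by move=> c y y'; rewrite /G (tpair_bilin _ _).1 linearP (tpair_bilin _ _).2 !linearP.
apply: (lspan_linear Glin _ hb) => _ [v [w [hv hw ->]]]; rewrite /= /G assocE unassocE inj2E.
apply: lspan_gen; exists [:: (take i t, v); (w, drop j u)]; split=> //=.
have hi := ltn_ord i; have hj := ltn_ord j.
by rewrite hv hw size_drop !size_takel ?size_drop //; lia.
Qed.

Lemma multihomog_iter n t u :
  multihomog n.+1 (size t + size u) (cop_beta_iter n (word t ⊠ word u)).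
Proof.
elim: n => [|n IH] /=.
  by apply: lspan_gen; exists [:: (t, u)]; rewrite /= addn0.
apply: lspan_map IH => _ [[|p ps] [//= [sz] sm ->]].
rewrite /apply_head wliftE /=.
have hc := multihomog_cop p.1 p.2.
have L := tcatl (word [seq word p.1 ⊠ word p.2 | p <- ps]).
apply: (lspan_linear L _ hc) => _ [qs [h1 h2 ->]]; rewrite tcatE -map_cat.
apply: lspan_gen; exists (qs ++ ps); split=> //; first by rewrite size_cat h1 sz.
by rewrite map_cat sumn_cat h2.
Qed.

Lemma talgmap_M0 n d x : multihomog n d x -> (d < n)%N -> talgmap Mmap x = 0.
Proof.
move=> hx dn; elim: hx => [|c z v [ps [h1 h2 ->]] _ IH]; first by rewrite linear0.
rewrite linearP IH addr0 /= talgmapE.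
suff -> : word (map Mmap [seq word p.1 ⊠ word p.2 | p <- ps]) = 0 by rewrite scaler0.
have : has (fun p : seq V * seq V => size p.1 + size p.2 == 0)%N ps.
  apply/negPn/negP => /hasPn h; move: dn; rewrite -h1 -h2 ltnNge => /negP; apply.
  elim: ps h {h1 h2} => //= p ps IHp h.
  have := h p (mem_head _ _); have := IHp (fun q hq => h q (mem_behead (s := p :: ps) hq)); lia.
move=> /hasP[[a b] hp /=]; rewrite addn_eq0 !size_eq0 => /andP[/eqP ea /eqP eb].
move: hp; rewrite {}ea {}eb => /splitPr[p1 p2].
rewrite !map_cat /= wlift2E /=.
have := word_multilin (-1) (map Mmap [seq word p.1 ⊠ word p.2 | p <- p1]) 0 0
  (map Mmap [seq word p.1 ⊠ word p.2 | p <- p2]).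
by rewrite scaler0 addr0 scaleN1r addNr.
Qed.

Lemma join_term_eq0 x : exists N, forall n, (N <= n)%N -> join_term n x = 0.
Proof.
have [B1 B2] := tpair_bilin T T.
pose P (x : T ⊗ T) := exists N, forall n, (N <= n)%N -> join_term n x = 0.
have P0 : P 0 by exists 0%N => n _; rewrite linear0.
have PD c y z : P y -> P z -> P (c *: y + z).
  move=> [N hN] [N' hN']; exists (maxn N N') => n; rewrite geq_max => /andP[h1 h2].
  by rewrite linearP hN // hN' // scaler0 addr0.
rewrite -/(P x); move: x; apply: pmod_ind => // c [a b] x IH.
rewrite -/(tpair a b); apply: (PD) IH => {c x}.
move: a; apply: pmod_ind => [|c t a IHa]; first by rewrite tpair0l.
rewrite B1; apply: (PD) IHa => {c a}.
move: b; apply: pmod_ind => [|c u b IHb]; first by rewrite tpair0r.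
rewrite B2; apply: (PD) IHb => {c b}.
exists (size t + size u).+2 => -[//|n] hn.
by apply: talgmap_M0 (multihomog_iter n t u) _; apply: ltnW.
Qed.

Lemma join_funE x : exists N, forall N', (N <= N')%N ->
  join_fun x = eps2 x + \sum_(1 <= n < N') join_term n x.
Proof.
have [N hN] := join_term_eq0 x; exists N => N' NN'; congr (_ + _).
rewrite (fsbigE (index_iota 1 N')) ?iota_uniq //.
- rewrite big_seq_cond [RHS]big_seq; apply: eq_bigl => n; rewrite mem_index_iota.
  by case: (ltnP 0 n) => // n0; rewrite mem_set // andbT.
- by move=> n /=; rewrite mem_index_iota => /andP[].
- move=> n /= n0; rewrite mem_index_iota n0 /= -leqNgt => h.
  by apply: hN; apply: leq_trans h.
Qed.

Lemma join_linear : linear join_fun.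
Proof.
move=> a x y.
have [N1 h1] := join_funE x; have [N2 h2] := join_funE y.
have [N3 h3] := join_funE (a *: x + y).
pose N := (N1 + N2 + N3)%N.
rewrite (h1 N) ?(h2 N) ?(h3 N) /N; try lia.
rewrite linearP scalerDr scaler_sumr addrACA -big_split; congr (_ + _).
by apply: eq_bigr => n _; rewrite linearP.
Qed.

HB.instance Definition _ := GRing.isLinear.Build K (T ⊗ T) T _ join_fun join_linear.

Definition join : {linear T ⊗ T -> T} := join_fun.

End Beta.

(* Main.v *)
Require Import Defs.
From HB Require Import structures.
From mathcomp Require Import all_boot all_order all_fingroup all_algebra.
From mathcomp Require Import boolp zify.
Set Implicit Arguments.
Unset Strict Implicit.
Unset Printing Implicit Defensive.
Import GRing.Theory.
Local Open Scope ring_scope.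

(** An element of the tensor algebra of [T = talg V] is a combination of rows of slots, each
    slot holding a tensor over [V]. The braiding [beta], the product [join], the appending of
    a letter and [m] on letters act on neighbouring slots of such rows, like the boxes of a
    string diagram ([at_slot], [local]), and the assertions are identities between diagrams.

    The braiding. The operator of a permutation does not depend on the reduced expression
    chosen for it ([braid_op_descent]), so [beta] may be computed from an expression that
    carries one block of letters through another, letter by letter. Cutting this expression
    in two shows that [beta] slides past concatenation on either side ([beta_cat_l],
    [beta_cat_r]). Since words arise from the empty word by appending letters, identities for
    [beta] reduce to identities on letters by induction on the sizes of the slots: the
    Yang-Baxter equation ([beta_yb]), the bijectivity ([beta_bijective]), and the fact that
    [beta] slides past [m] on letters ([lmul_slidel], [lmul_slider]), which for letters is the
    compatibility of [m] with [s].

    The product. Splitting off the last factor of the iterated coproduct gives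
    [join = ε ⊗ ε + (join ⊗ M) Δ], the two factors being concatenated ([join_rec]). As
    [M] lives in the bidegrees [(1,0)], [(0,1)] and [(1,1)], this is a quasi-shuffle rule
    ([join_slots]): for letters [x] and [y], the product of [tx] and [uy] is the sum of three
    terms, with last letter [y], [x], or [m (x ⊠ y)], where [x] has first been moved to the
    right by [beta]. Expanding by this rule, and moving all crossings past it, proves by
    induction on the total size that [beta] slides past [join] and that [join] is associative
    ([join_slidel_step], [join_slider_step], [join_assoc_step]). For associativity,
    seven terms on either side are matched, and in one of them that of [m] is used.

    Conversely, the component of [join] in degree one is [M] ([pr1_join]). Restricting the
    identities of the tensor algebra to letters and projecting them to letters therefore gives
    back those for [m] and [s].

    Finally, if [m] has a unit [e], then [s] exchanges [e] with every element as soon as it is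
    onto and compatible with [m] ([unit_braid_unit]); so the unital version of the equivalence
    is the same as the other one. *)

(** * Linear maps on tensor algebras *)

Lemma linear_fun0 (K : fieldType) (Z Z' : lmodType K) (f : Z -> Z') : linear f -> f 0 = 0.
Proof. by move=> L; have := L (-1) 0 0; rewrite scaler0 addr0 scaleN1r addNr. Qed.

Section Words.
Variables (K : fieldType) (A : lmodType K).
Local Notation TA := (talg A).

Lemma linear_eq_words (Z : lmodType K) (f g : TA -> Z) : linear f -> linear g ->
  (forall w, f (word w) = g (word w)) -> f =1 g.
Proof.
move=> lf lg h; apply: pmod_ind => [|c w x IH].
  by rewrite !linear_fun0.
by rewrite lf lg IH; congr (_ *: _ + _); apply: h.
Qed.

Lemma linear_eq_lspan (Z Z' : lmodType K) (P : Z -> Prop) (f g : Z -> Z') x :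
  linear f -> linear g -> (forall z, P z -> f z = g z) -> lspan P x -> f x = g x.
Proof.
move=> lf lg h; elim=> [|c z v Pz _ IH].
  by rewrite !linear_fun0.
by rewrite lf lg IH h.
Qed.

Lemma tcatA (x y z : TA) : x ** (y ** z) = x ** y ** z.
Proof.
move: x; apply: linear_eq_words => [||w].
- by move=> a x x'; rewrite tcatl.
- by move=> a x x'; rewrite !tcatl.
move: y; apply: linear_eq_words => [||w1].
- by move=> a x x'; rewrite tcatl tcatr.
- by move=> a x x'; rewrite tcatr tcatl.
move: z; apply: linear_eq_words => [||w2].
- by move=> a x x'; rewrite !tcatr.
- by move=> a x x'; rewrite !tcatr.
by rewrite !tcatE catA.
Qed.

Lemma tcat1 (x : TA) : x ** word [::] = x.
Proof.
move: x; apply: linear_eq_words => [a x y|a x y|w] //; first by rewrite tcatl.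
by rewrite tcatE cats0.
Qed.

Lemma tcat1l (x : TA) : word [::] ** x = x.
Proof.
move: x; apply: linear_eq_words => [a x y|a x y|w] //; first by rewrite tcatr.
by rewrite tcatE.
Qed.

Lemma tcat0l (x : TA) : 0 ** x = 0.
Proof. by rewrite tpair0l linear0. Qed.

Lemma tcat0r (x : TA) : x ** 0 = 0.
Proof. by rewrite tpair0r linear0. Qed.

Lemma homog_wordE n (w : seq A) : size w = n -> homog n (word w).
Proof. by move=> <-; apply: homog_word. Qed.

(** * Operators acting at one place of a word *)

Section At.
Variables (k : nat) (f : {linear TA -> TA}).

Fixpoint at_word (i : nat) (w : seq A) : TA :=
  match i, w with
  | 0, _ => if (size w < k)%N then 0 else f (word (take k w)) ** word (drop k w)
  | i'.+1, a :: r => word [:: a] ** at_word i' r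
  | _, _ => 0
  end.

Lemma at_word_multilin i : multilin (at_word i).
Proof.
elim: i => [|i IH] a l x y r /=.
  rewrite !size_cat /=; case: ifP => _; first by rewrite scaler0 addr0.
  rewrite !take_cat !drop_cat; case: ltnP => _.
    by rewrite word_multilin tcatr.
  case: (k - size l)%N => [|j] /=; first by rewrite (word_multilin a [::]) tcatr.
  by rewrite word_multilin linearP tcatl.
case: l => [|z l] /=; first by rewrite (word_multilin a [::]) tcatl.
by rewrite IH tcatr.
Qed.

(** On words that are too short the value is [0], not the identity as for [sigma_at]:
    relations between such operators then hold on the whole tensor algebra. *)
Definition at_slot i : {linear TA -> TA} := wlift (at_word_multilin i).

Lemma at_slotE i w : at_slot i (word w) = at_word i w.
Proof. exact: wliftE. Qed.

Lemma at_cons i a Y : at_slot i.+1 (word [:: a] ** Y) = word [:: a] ** at_slot i Y.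
Proof.
move: Y; apply: linear_eq_words => [c x y|c x y|w].
- by rewrite tcatr linearP.
- by rewrite linearP tcatr.
by rewrite tcatE !at_slotE.
Qed.

Lemma at_nil i : at_slot i.+1 (word [::]) = 0.
Proof. by rewrite at_slotE. Qed.

Lemma at_small n i X : homog n X -> (n < i + k)%N -> at_slot i X = 0.
Proof.
move=> hX ni; apply: (@linear_eq_lspan TA TA _ (at_slot i) (fun _ => 0) X _ _ _ hX).
- exact: linearP.
- by move=> c x y; rewrite scaler0 addr0.
move=> _ [w wn ->]; rewrite at_slotE; elim: i n w ni wn {hX} => [|i IH] n [|a w] //=.
- by rewrite add0n => ni wn; rewrite [(0 < k)%N](_ : _ = true) //; lia.
- by move=> ni wn; rewrite [(_ < k)%N](_ : _ = true) //; lia.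
- by move=> ni wn; rewrite (IH n.-1) ?tcat0r //; lia.
Qed.

Lemma at0_word w Y : size w = k -> at_slot 0 (word w ** Y) = f (word w) ** Y.
Proof.
move=> wk; move: Y; apply: linear_eq_words => [c x y|c x y|v].
- by rewrite tcatr linearP.
- by rewrite tcatr.
rewrite tcatE at_slotE /= size_cat wk ltnNge leq_addr /=.
by rewrite -wk take_size_cat // drop_size_cat.
Qed.

Lemma at0_homog X Y : homog k X -> at_slot 0 (X ** Y) = f X ** Y.
Proof.
move=> hX; apply: (@linear_eq_lspan TA TA _ (fun X => at_slot 0 (X ** Y))
   (fun X => f X ** Y) X _ _ _ hX).
- by move=> c x y; rewrite tcatl linearP.
- by move=> c x y; rewrite linearP tcatl.
by move=> _ [w wk ->]; rewrite at0_word.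
Qed.

Lemma at_homog l n i X : (forall x, homog k x -> homog l (f x)) ->
  homog (n + k) X -> homog (n + l) (at_slot i X).
Proof.
move=> hf; apply: lspan_map => _ [w wn ->]; rewrite -/(homog _ _).
have [ni|ni] := ltnP (n + k) (i + k).
  rewrite (@at_small (n + k)%N) //; first exact: lspan0.
  by rewrite -wn; apply: homog_word.
elim: i n w wn ni => [|i IH] n w wn ni.
  rewrite -(cat_take_drop k w) -tcatE at0_word; last by rewrite size_takel //; lia.
  rewrite addnC; apply: homog_cat; last first.
    by apply: homog_wordE; rewrite size_drop; lia.
  by apply/hf/homog_wordE; rewrite size_takel //; lia.
case: n wn ni => [|n] wn ni; first lia.
case: w wn => [|a w] wn; first by rewrite at_nil; apply: lspan0.
rewrite -[word _](tcatE [:: a] w) at_cons -addn1 addnAC addnC; apply: homog_cat.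
  exact: (homog_word [:: a]).
by apply: IH; move: wn ni => /=; lia.
Qed.

Lemma at_shift n j X Y : homog n X -> at_slot (n + j) (X ** Y) = X ** at_slot j Y.
Proof.
move=> hX; apply: (@linear_eq_lspan TA TA _ (fun X => at_slot (n + j) (X ** Y))
   (fun X => X ** at_slot j Y) X _ _ _ hX).
- by move=> c x y; rewrite tcatl linearP.
- by move=> c x y; rewrite tcatl.
move=> _ [w <- ->]; elim: w {hX} => [|a w IH]; first by rewrite !tcat1l.
by rewrite -[word _](tcatE [:: a] w) -!tcatA /= at_cons IH.
Qed.

Lemma at_catl n i X Y : homog n X -> (i + k <= n)%N -> at_slot i (X ** Y) = at_slot i X ** Y.
Proof.
move=> hX ni; apply: (@linear_eq_lspan TA TA _ (fun X => at_slot i (X ** Y))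
   (fun X => at_slot i X ** Y) X _ _ _ hX).
- by move=> c x y; rewrite tcatl linearP.
- by move=> c x y; rewrite linearP tcatl.
move=> _ [w wn ->]; elim: i n w wn ni {hX} => [|i IH] n w wn ni.
  rewrite -(cat_take_drop k w) -tcatE -tcatA.
  by rewrite !at0_word ?tcatA // size_takel //; lia.
case: w wn => [|a w] wn; first by move: wn ni => /=; lia.
rewrite -[word _](tcatE [:: a] w) -!tcatA !at_cons -tcatA; congr (_ ** _).
by apply: (IH n.-1); move: wn ni => /=; lia.
Qed.

End At.

(** Boxes on disjoint strands commute. The left one turns [k] strands into [l], whence
    the two positions of the right one. *)
Lemma at_comm k l k' (f g : {linear TA -> TA}) i j X :
  (forall x, homog k x -> homog l (f x)) ->
  at_slot k' g (i + l + j) (at_slot k f i X) = at_slot k f i (at_slot k' g (i + k + j) X).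
Proof.
move=> hf; move: X; apply: linear_eq_words => [c x y|c x y|w]; rewrite ?linearP //.
elim: i w => [|i IH] w.
  rewrite !add0n; have [wk|wk] := ltnP (size w) k.
    rewrite (@at_small k f _ 0 _ (homog_word w)) // linear0.
    rewrite (@at_small k' g _ _ _ (homog_word w)) ?linear0 //; lia.
  have hk : homog k (word (take k w)).
    exact/homog_wordE/size_takel.
  rewrite -(cat_take_drop k w) -tcatE at0_homog // (at_shift _ _ _ _ hk).
  by rewrite at0_homog // (at_shift _ _ _ _ (hf _ hk)).
case: w => [|a w]; first by rewrite !addSn !at_nil !linear0.
by rewrite -[word _](tcatE [:: a] w) !addSn !at_cons IH.
Qed.

(** [F i] is one diagram with [n] inputs and [m] outputs placed at strand [i]: the
    strands on its left and on its right pass through unchanged. *)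
Record local (n m : nat) (F : nat -> TA -> TA) : Prop := Local {
  local_linear : forall i, linear (F i);
  local_cons : forall i a Y, F i.+1 (word [:: a] ** Y) = word [:: a] ** F i Y;
  local_homog : forall X, homog n X -> homog m (F 0 X);
  local_catl : forall X Y, homog n X -> F 0 (X ** Y) = F 0 X ** Y
}.

Lemma local_at k l (f : {linear TA -> TA}) c d : (forall x, homog k x -> homog l (f x)) ->
  local (c + k + d) (c + l + d) (fun i => at_slot k f (c + i)).
Proof.
move=> hf; split.
- by move=> i; apply: linearP.
- by move=> i a Y; rewrite addnS at_cons.
- by move=> X hX; rewrite addn0 addnAC; apply: at_homog; rewrite // addnAC.
- by move=> X Y hX; apply: at_catl hX _; lia.
Qed.

Lemma local_comp n m p F G : local n m F -> local m p G ->
  local n p (fun i X => G i (F i X)).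
Proof.
move=> [F1 F2 F4 F5] [G1 G2 G4 G5]; split.
- by move=> i a x y; rewrite F1 G1.
- by move=> i a Y; rewrite F2 G2.
- by move=> X hX; apply/G4/F4.
- by move=> X Y hX; rewrite F5 // G5 //; apply: F4.
Qed.

Lemma local_add n m F G : local n m F -> local n m G ->
  local n m (fun i X => F i X + G i X).
Proof.
move=> [F1 F2 F4 F5] [G1 G2 G4 G5]; split.
- by move=> i a x y; rewrite F1 G1 scalerDr addrACA.
- by move=> i a Y; rewrite F2 G2 -[word _ ** _]scale1r -tcatr scale1r.
- by move=> X hX; apply: lspan_add; [apply: F4 | apply: G4].
- by move=> X Y hX; rewrite F5 // G5 // -[F 0 X ** _]scale1r -tcatl scale1r.
Qed.

(** The outer strands being passive, two diagrams with [n] inputs agree as soon as they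
    agree on words of length [n]. Words without room for the [n] inputs are beyond the reach
    of [local] and form a separate premise. *)
Lemma local_eq n m m' F G : local n m F -> local n m' G ->
  (forall i w, (size w < i + n)%N -> F i (word w) = G i (word w)) ->
  (forall w, size w = n -> F 0 (word w) = G 0 (word w)) ->
  forall i X, F i X = G i X.
Proof.
move=> [F1 F2 F4 F5] [G1 G2 G4 G5] small base i X.
move: X; apply: linear_eq_words; [exact: F1 | exact: G1 |] => w.
have [wn|wn] := ltnP (size w) (i + n); first exact: small.
elim: i w wn => [|i IH] w wn.
  have hs : size (take n w) = n by rewrite size_takel.
  have hn : homog n (word (take n w)) by apply: homog_wordE.
  by rewrite -(cat_take_drop n w) -tcatE F5 // G5 // base.
case: w wn => [|a w] wn; first by move: wn; rewrite addSn.
by rewrite -[word _](tcatE [:: a] w) F2 G2 IH.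
Qed.

(** * Boxes with one, two or three inputs *)

Section OnLetters.
Variable Z : lmodType K.

Lemma on1_multilin (f : {linear A -> Z}) :
  multilin (fun w : seq A => if w is [:: a] then f a else 0).
Proof.
move=> a [|z [|z' l]] x y [|z'' r] /=; rewrite ?scaler0 ?addr0 //.
by rewrite linearP.
Qed.
Definition on1 f : {linear TA -> Z} := wlift (on1_multilin f).

Lemma on2_multilin (f : {linear A ⊗ A -> Z}) :
  multilin (fun w : seq A => if w is [:: a; b] then f (a ⊠ b) else 0).
Proof.
move=> a [|z [|z' l]] x y r /=; last by case: l => [|? ?]; rewrite /= scaler0 addr0.
  case: r => [|z [|z' r]]; rewrite ?scaler0 ?addr0 //.
  by rewrite (tpair_bilin _ _).1 linearP.
case: r => [|z' r]; rewrite ?scaler0 ?addr0 //.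
by rewrite (tpair_bilin _ _).2 linearP.
Qed.
Definition on2 f : {linear TA -> Z} := wlift (on2_multilin f).

Lemma on1E f a : on1 f (inj1 a) = f a.
Proof. exact: wliftE. Qed.

Lemma on2E f z : on2 f (inj2 A z) = f z.
Proof.
rewrite -[LHS]/((on2 f \o inj2 A) z); move: z; apply: tens_ext => a b /=.
by rewrite inj2E wliftE.
Qed.

End OnLetters.

Lemma inj1_inj : injective (@inj1 K A).
Proof. by move=> a b /(congr1 (on1 idfun)); rewrite !on1E. Qed.

Lemma inj2_inj : injective (inj2 A).
Proof. by move=> a b /(congr1 (on2 idfun)); rewrite !on2E. Qed.

Lemma on3_multilin :
  multilin (fun w : seq A => if w is [:: a; b; c] then a ⊠ b ⊠ c else 0).
Proof.
have [L1 L2] := tpair_bilin A A; have [M1 M2] := tpair_bilin (A ⊗ A) A.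
move=> a [|z [|z' [|z'' l]]] x y r /=.
- by case: r => [|z [|z' [|z'' r]]]; rewrite ?scaler0 ?addr0 // L1 M1.
- by case: r => [|z' [|z'' r]]; rewrite ?scaler0 ?addr0 // L2 M1.
- by case: r => [|z'' r]; rewrite ?scaler0 ?addr0 // M2.
by case: l => [|? ?]; rewrite /= scaler0 addr0.
Qed.
Definition on3 : {linear TA -> A ⊗ A ⊗ A} := wlift on3_multilin.

Definition inj3 (z : A ⊗ A ⊗ A) : TA := tcat A (tensmap (inj2 A) (@inj1 K A) z).
Lemma inj3_linear : linear inj3.
Proof. by move=> c x y; rewrite /inj3 !linearP. Qed.
HB.instance Definition _ :=
  GRing.isLinear.Build K (A ⊗ A ⊗ A) (talg A) _ inj3 inj3_linear.

Lemma inj3E z c : inj3 (z ⊠ c) = inj2 A z ** inj1 c.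
Proof. by rewrite /inj3 tensmapE. Qed.

Lemma tens_fext (U W Z : lmodType K) (f g : U ⊗ W -> Z) : linear f -> linear g ->
  (forall u w, f (u ⊠ w) = g (u ⊠ w)) -> f =1 g.
Proof.
move=> lf lg h; apply: pmod_ind => [|c [u w] x IH].
  by rewrite !linear_fun0.
by rewrite lf lg IH; congr (_ *: _ + _); apply: h.
Qed.

Lemma tens3_fext (U W X Z : lmodType K) (f g : U ⊗ W ⊗ X -> Z) : linear f -> linear g ->
  (forall a b c, f (a ⊠ b ⊠ c) = g (a ⊠ b ⊠ c)) -> f =1 g.
Proof.
move=> lf lg h; apply: tens_fext => // z c; move: z.
have [L _] := tpair_bilin (U ⊗ W) X.
by apply: tens_fext => [k x y|k x y|a b]; rewrite ?L ?lf ?lg ?h.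
Qed.

Lemma inj3_inj : injective inj3.
Proof.
have h : on3 \o inj3 =1 idfun.
  apply: tens3_fext => [x y z|x y z|a b c] /=; rewrite ?linearP //.
  by rewrite inj3E inj2E tcatE wliftE.
by move=> x y /(congr1 on3); rewrite -![on3 _]/((on3 \o inj3) _) !h.
Qed.

Lemma inj3_unassoc a z : inj3 (unassoc A A A (a ⊠ z)) = inj1 a ** inj2 A z.
Proof.
have [L1 L2] := tpair_bilin A (A ⊗ A).
move: z; apply: pmod_ind => [|k [b c] z IH]; first by rewrite tpair0r !linear0 tcat0r.
rewrite L2 !linearP tcatr /= IH; congr (_ *: _ + _).
by rewrite -/(tpair b c) unassocE inj3E !inj2E !tcatE.
Qed.

Definition at2 (f : {linear A ⊗ A -> TA}) := at_slot 2 (on2 f).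

Lemma homog_inj1 (a : A) : homog 1 (inj1 a).
Proof. exact: (homog_word [:: a]). Qed.

Lemma homog_inj3 (z : A ⊗ A ⊗ A) : homog 3 (inj3 z).
Proof.
move: z; apply: pmod_ind => [|c [p a] z IH]; first by rewrite linear0; apply: lspan0.
rewrite linearP; apply: lspan_add IH; apply: lspan_scale.
rewrite -/(tpair p a) -[X in lspan _ X]/(inj3 _) inj3E.
by apply: (@homog_cat _ _ 2 1); [apply: homog_inj2 | apply: homog_inj1].
Qed.

Lemma on2_homog l (f : {linear A ⊗ A -> TA}) :
  (forall z, homog l (f z)) -> forall x, homog 2 x -> homog l (on2 f x).
Proof.
by move=> hf x; apply: lspan_map => _ [[|a [|b []]] // _ ->]; rewrite wliftE; apply: hf.
Qed.

Lemma at2_0 f z Y : at2 f 0 (inj2 A z ** Y) = f z ** Y.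
Proof. by rewrite /at2 at0_homog ?on2E //; apply: homog_inj2. Qed.

Lemma at2_0w f a b r : at2 f 0 (word [:: a, b & r]) = f (a ⊠ b) ** word r.
Proof. by rewrite -(at2_0 f (a ⊠ b) (word r)) inj2E tcatE. Qed.

Lemma at2_0z f z : at2 f 0 (inj2 A z) = f z.
Proof. by rewrite -[inj2 A z]tcat1 at2_0 tcat1. Qed.

Lemma at2_0t f z : at2 f 0 (inj3 z) = tcat A (tensmap f (@inj1 K A) z).
Proof.
move: z; apply: tens_fext => [a x y|a x y|z c]; rewrite ?linearP //.
by rewrite inj3E at2_0 tensmapE.
Qed.

Lemma at2_1t f z : at2 f 1 (inj3 z) = tcat A (tensmap (@inj1 K A) f (assoc A A A z)).
Proof.
move: z; apply: tens3_fext => [x y z|x y z|a b c]; rewrite ?linearP //.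
by rewrite inj3E inj2E tcatE at_slotE assocE tensmapE /= wliftE tcat1.
Qed.

Section Square.
Variable s : {linear A ⊗ A -> A ⊗ A}.
Definition braid_at := at2 (inj2 A \o s).

Lemma homog_braid_at n i X : homog n X -> homog n (braid_at i X).
Proof.
have [n2|n2] := ltnP n 2.
  move=> hX; rewrite /braid_at /at2 (@at_small 2 _ n) //; [exact: lspan0 | lia].
rewrite -(subnK n2); apply: at_homog; apply: on2_homog => z; exact: homog_inj2.
Qed.

Lemma braid_at_0t z : braid_at 0 (inj3 z) = inj3 (op1 s z).
Proof.
rewrite /braid_at at2_0t; move: z.
apply: tens_fext => [x y z|x y z|z c]; rewrite ?linearP //.
by rewrite /op1 !tensmapE inj3E.
Qed.

Lemma op2E a b c : op2 s (a ⊠ b ⊠ c) = unassoc A A A (a ⊠ s (b ⊠ c)).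
Proof. by rewrite -[LHS]/(unassoc _ _ _ (tensmap _ _ (assoc _ _ _ _))) assocE tensmapE. Qed.

Lemma braid_at_1t z : braid_at 1 (inj3 z) = inj3 (op2 s z).
Proof.
rewrite /braid_at at2_1t; move: z.
apply: tens3_fext => [x y z|x y z|a b c]; rewrite ?linearP //.
by rewrite assocE tensmapE op2E inj3_unassoc.
Qed.

End Square.

Section Product.
Variable m : {linear A ⊗ A -> A}.
Definition mul_at := at2 (@inj1 K A \o m).

Lemma homog_mul_at n i X : homog n.+1 X -> homog n (mul_at i X).
Proof.
case: n => [|n] hX.
  by rewrite /mul_at /at2 (@at_small 2 _ 1) //; [exact: lspan0 | lia].
rewrite -addn1; apply: (@at_homog 2 _ 1); last by rewrite addn2.
by apply: on2_homog => z; exact: homog_inj1.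
Qed.

Lemma mul_at_0t z : mul_at 0 (inj3 z) = inj2 A (tensmap m idfun z).
Proof.
rewrite /mul_at at2_0t; move: z.
apply: tens_fext => [x y z|x y z|z c]; rewrite ?linearP //.
by rewrite !tensmapE inj2E tcatE.
Qed.

Lemma mul_at_1t z : mul_at 1 (inj3 z) = inj2 A (tensmap idfun m (assoc A A A z)).
Proof.
rewrite /mul_at at2_1t; move: z.
apply: tens3_fext => [x y z|x y z|a b c]; rewrite ?linearP //.
by rewrite assocE !tensmapE inj2E tcatE.
Qed.

End Product.

Lemma word3E (w : seq A) : size w = 3 -> exists z, word w = inj3 z.
Proof.
case: w => [|a [|b [|c []]]] // _; exists (a ⊠ b ⊠ c).
by rewrite inj3E inj2E tcatE.
Qed.

Lemma braid_at_yb (s : {linear A ⊗ A -> A ⊗ A}) : braiding s -> forall i X,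
  braid_at s i (braid_at s i.+1 (braid_at s i X)) =
  braid_at s i.+1 (braid_at s i (braid_at s i.+1 X)).
Proof.
move=> [_ hs].
have h z : homog 2 ((inj2 A \o s) z) by apply: homog_inj2.
have L0 := local_at 0 1 (on2_homog h); have L1 := local_at 1 0 (on2_homog h).
apply: (local_eq (local_comp (local_comp L0 L1) L0) (local_comp (local_comp L1 L0) L1)).
  move=> i w wi; have hw := homog_word w.
  rewrite -/(at2 _) -/(braid_at _) !add1n !add0n.
  have z X : homog (size w) X -> braid_at s i.+1 X = 0.
    by move=> hX; apply: at_small hX _; lia.
  by rewrite !z ?linear0 //; [exact: lspan0 | exact: homog_braid_at].
move=> w /word3E[z ->].
rewrite -/(at2 _) -/(braid_at _) /=.
rewrite !(braid_at_0t, braid_at_1t); congr inj3; exact: hs.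
Qed.

Lemma braid_at_comm (s : {linear A ⊗ A -> A ⊗ A}) i j X : (i.+1 < j)%N ->
  braid_at s j (braid_at s i X) = braid_at s i (braid_at s j X).
Proof.
move=> ij; rewrite -(subnKC ij) -[i.+2]addn2.
by apply: at_comm => x; apply: on2_homog => z; exact: homog_inj2.
Qed.

End Words.
Arguments at_slot {K A} k f i.

(** * Identities between string diagrams *)

(* Positions of boxes are numerals, and they are passed explicitly when rewriting. *)
Local Close Scope ring_scope.
Unset Implicit Arguments.

Section Diagrams.
Variable Z : zmodType.
Implicit Types F G B C N J : nat -> Z -> Z.

(** A diagram acts on a row of strands, and its position is that of its leftmost input.
    To the right of a box with two outputs another box keeps its position ([far2]); to the
    right of a box merging two strands into one its position moves by one ([far1]). *)
Definition far2 F G := forall i j X, (i.+1 < j)%N -> G j (F i X) = F i (G j X).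
Definition far1 F G := forall i j X, (i < j)%N -> G j (F i X) = F i (G j.+1 X).
(** A strand that crosses the output of a box may as well cross its two inputs, from the
    right ([slidel]) or from the left ([slider]). *)
Definition slidel B F := forall i X, B i (F i X) = F i.+1 (B i (B i.+1 X)).
Definition slider B F := forall i X, B i (F i.+1 X) = F i (B i.+1 (B i X)).
Definition yang_baxter B := forall i X, B i (B i.+1 (B i X)) = B i.+1 (B i (B i.+1 X)).

Section YangBaxterSteps.
Variables B C : nat -> Z -> Z.
Hypotheses (BB : far2 B B) (BC : far2 B C) (CB : far1 C B).
Hypotheses (Cl : slidel B C) (Cr : slider B C).

(** For one of the three strands being a merge of two pieces, the crossings slide past
    the merge and move the pieces one after the other. So the relation follows from its
    instances for the pieces; the strand cut in two is the first here, and the second and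
    the third in the next two lemmas. *)
Lemma yb_step0 X : B 1 (B 2 (B 1 X)) = B 2 (B 1 (B 2 X)) ->
  B 0 (B 1 (B 0 (B 2 (B 1 X)))) = B 1 (B 0 (B 1 (B 2 (B 1 X)))) ->
  B 0 (B 1 (B 0 (C 0 X))) = B 1 (B 0 (B 1 (C 0 X))).
Proof.
move=> e1 e2; rewrite (Cl 0) (Cl 1) -(BC 0 2) // (CB 0 1) // (Cl 0) (Cl 1).
congr (C 2 _).
by rewrite (BB 0 2) // e2 e1 (BB 0 2).
Qed.

Lemma yb_step1 X : B 1 (B 2 (B 1 (B 0 X))) = B 2 (B 1 (B 2 (B 0 X))) ->
  B 0 (B 1 (B 0 (B 2 X))) = B 1 (B 0 (B 1 (B 2 X))) ->
  B 0 (B 1 (B 0 (C 1 X))) = B 1 (B 0 (B 1 (C 1 X))).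
Proof.
move=> e1 e2; rewrite (Cr 0) (CB 0 1) // (Cl 0) (Cl 1) -(BC 0 2) // (Cr 1).
by congr (C 1 _); rewrite e1 -(BB 0 2) // (BB 0 2 X) // e2.
Qed.

Lemma yb_step2 X : B 0 (B 1 (B 0 X)) = B 1 (B 0 (B 1 X)) ->
  B 1 (B 2 (B 1 (B 0 (B 1 X)))) = B 2 (B 1 (B 2 (B 0 (B 1 X)))) ->
  B 0 (B 1 (B 0 (C 2 X))) = B 1 (B 0 (B 1 (C 2 X))).
Proof.
move=> e1 e2; rewrite -(BC 0 2) // !(Cr 1) !(Cr 0) (CB 0 1) //.
by congr (C 0 _); rewrite -(BB 0 2) // e1 e2 (BB 0 2).
Qed.
End YangBaxterSteps.

Section InverseSteps.
Variables B B' C : nat -> Z -> Z.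
Hypotheses (Cl : slidel B C) (Cr : slider B C).
Hypotheses (Cl' : slidel B' C) (Cr' : slider B' C).

Lemma inverse_step0 X : B' 0 (B 0 (B 1 X)) = B 1 X -> B' 1 (B 1 X) = X ->
  B' 0 (B 0 (C 0 X)) = C 0 X.
Proof. by move=> e1 e2; rewrite Cl Cr' e1 e2. Qed.

Lemma inverse_step1 X : B' 1 (B 1 (B 0 X)) = B 0 X -> B' 0 (B 0 X) = X ->
  B' 0 (B 0 (C 1 X)) = C 1 X.
Proof. by move=> e1 e2; rewrite Cr Cl' e1 e2. Qed.
End InverseSteps.

Section MergeSteps.
Variables B C N : nat -> Z -> Z.
Hypotheses (BB : far2 B B) (BC : far2 B C) (CB : far1 C B) (NC : far1 N C).
Hypotheses (CN : far1 C N).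
Hypotheses (Cl : slidel B C) (Cr : slider B C).

(** Here the strand that crosses the box [N] is cut in two. *)
Lemma slidel_step X : B 0 (N 0 X) = N 1 (B 0 (B 1 X)) ->
  B 1 (N 1 (B 0 (B 1 X))) = N 2 (B 1 (B 2 (B 0 (B 1 X)))) ->
  B 0 (N 0 (C 2 X)) = N 1 (B 0 (B 1 (C 2 X))).
Proof.
move=> e1 e2; rewrite -(NC 0 1) // (Cr 0) e1 e2 (Cr 1) (Cr 0) (CN 0 1) //.
by rewrite (BB 0 2).
Qed.

Lemma slider_step X : B 1 (N 2 X) = N 1 (B 2 (B 1 X)) ->
  B 0 (N 1 (B 2 (B 1 X))) = N 0 (B 1 (B 0 (B 2 (B 1 X)))) ->
  B 0 (N 1 (C 0 X)) = N 0 (B 1 (B 0 (C 0 X))).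
Proof.
move=> e1 e2; rewrite (CN 0 1) // (Cl 0) e1 e2 (Cl 0) (Cl 1) (NC 0 1) //.
by rewrite (BB 0 2).
Qed.
End MergeSteps.

Lemma sum33 (a1 a2 a3 b1 b2 b3 c1 c2 c3 : Z) :
  ((a1 + b1 + c1) + (a2 + b2 + c2) + (a3 + b3 + c3) =
  (a1 + a2 + a3) + (b1 + b2 + b3) + (c1 + c2 + c3))%R.
Proof.
rewrite (addrACA (a1 + b1)%R) (addrACA a1) (addrACA (a1 + a2 + (b1 + b2))%R).
by rewrite (addrACA (a1 + a2)%R).
Qed.

Lemma regroup (a b c d e f g : Z) :
  (a + (b + d + f) + (c + e + g) = (a + b + c) + d + (e + f + g))%R.
Proof.
rewrite -!addrA; congr (a + (b + _))%R; rewrite [RHS]addrCA; congr (d + _)%R.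
by rewrite addrCA [(f + _)%R]addrCA.
Qed.

Section QuasiShuffle.
Variables B C N J : nat -> Z -> Z.
Hypotheses (addB : forall i X Y, B i (X + Y)%R = (B i X + B i Y)%R).
Hypotheses (addC : forall i X Y, C i (X + Y)%R = (C i X + C i Y)%R).
Hypotheses (addJ : forall i X Y, J i (X + Y)%R = (J i X + J i Y)%R).
Hypotheses (BB : far2 B B) (BC : far2 B C) (BN : far2 B N).
Hypotheses (CB : far1 C B) (CC : far1 C C) (CN : far1 C N) (CJ : far1 C J).
Hypothesis (NC : far1 N C).
Hypotheses (JB : far1 J B) (JC : far1 J C) (JN : far1 J N).
Hypotheses (yb : yang_baxter B).
Hypotheses (Cl : slidel B C) (Cr : slider B C).
Hypotheses (Nl : slidel B N) (Nr : slider B N).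
Hypothesis NA : forall i X, N i (N i X) = N i (N i.+1 X).
(* With slots [t; x; u; y], [x] and [y] being letters: the last letter of the product of
   [tx] and [uy] is [y]; or [x], moved through [uy]; or the product of [x], moved through
   [u], and [y]. *)
Hypothesis rec : forall i X, J i (C i (C i.+2 X)) =
  (C i (J i (C i X)) + C i (J i (B i.+1 (C i.+2 X))) + C i (J i (N i.+2 (B i.+1 X))))%R.

(** The slots of [X] are [t; x; u; y; v], and [P] is the relation to be shown. Expanding
    the product of [tx] and [uy] on both sides, the terms correspond: their last letter is
    [y], [x], or the product of [x] and [y]. *)
Lemma join_slidel_step X :
  let P W := B 0 (J 0 W) = J 1 (B 0 (B 1 W)) in
  P (B 2 (C 0 X)) -> P (B 2 (B 1 (C 2 X))) -> P (B 2 (N 2 (B 1 X))) ->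
  P (C 0 (C 2 X)).
Proof.
move=> P p1 p2 p3; rewrite /P rec !addB !(Cl 0) !(JB 0 1) // p1 p2 p3.
have -> : B 0 (B 1 (C 0 (C 2 X))) = C 1 (C 3 (B 0 (B 1 (B 2 (B 3 X))))).
  by rewrite (CB 0 1) // (Cl 2) (Cl 0) -(BC 1 3) // -(BC 0 3).
rewrite rec; congr (_ + _ + _)%R; congr (C 1 (J 1 _)).
- by rewrite (CB 0 2) // (CB 0 1) // (Cl 0).
- by rewrite (yb 1) -(BB 0 2) // (Cl 2) -(BC 1 3) // -(BC 0 3).
- rewrite (Nl 2) -(BN 1 3) // -(BN 0 3) // (BB 1 3) // (yb 1).
  by rewrite -(BB 0 2).
Qed.

(** The mirror image of [join_slidel_step], with slots [v; t; x; u; y]. *)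
Lemma join_slider_step X :
  let P W := B 0 (J 1 W) = J 0 (B 1 (B 0 W)) in
  P (C 1 X) -> P (B 2 (C 3 X)) -> P (N 3 (B 2 X)) -> P (C 1 (C 3 X)).
Proof.
move=> P p1 p2 p3; have e : B 1 (B 0 (C 1 (C 3 X))) = C 0 (C 2 (B 3 (B 2 (B 1 (B 0 X))))).
  by rewrite (Cr 0) -(BC 0 3) // -(BC 1 3) // (CB 0 1) // (Cr 2).
rewrite /P e (rec 1) !addB !(Cr 0) p1 p2 p3 (rec 0).
congr (_ + _ + _)%R; congr (C 0 _); rewrite (JB 0 1) //; congr (J 0 _).
- by rewrite (Cr 0) (CB 0 1) // (CB 0 2).
- by rewrite -(BB 0 2) // -(yb 1) -(BC 0 3) // -(BC 1 3) // (Cr 2).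
- by rewrite -(BN 0 3) // -(BN 1 3) // (Nr 2) -(BB 0 2) // -(yb 1) (BB 1 3).
Qed.

Hypothesis Jr : slider B J.

(** The slots of [X] are [t; x; u; y; v; z], and [P W] says that the first three slots of
    [W] associate. Expanding twice gives nine terms for each bracketing of [tx], [uy] and
    [vz]. On the left, the three terms with last letter [z] recombine into one; on the
    right, so do those with last letter [x]. The seven pairs that remain have as last letter
    the product of a nonempty subset of [x], [y], [z], and are instances of [P]; for the
    whole set the associativity of [N] enters. *)
Lemma join_assoc_step X :
  let P W := J 0 (J 0 W) = J 0 (J 1 W) in
  P (C 0 (C 2 X)) -> P (B 2 (C 3 (C 0 X))) -> P (N 3 (B 2 (C 0 X))) ->
  P (B 2 (C 3 (B 1 (C 2 X)))) -> P (N 3 (B 2 (B 1 (C 2 X)))) ->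
  P (B 2 (C 3 (N 2 (B 1 X)))) -> P (N 3 (B 2 (N 2 (B 1 X)))) ->
  P (C 0 (C 2 (C 4 X))).
Proof.
move=> P p1 p2 p3 p4 p5 p6 p7.
have JJ W1 W2 : P W1 -> W1 = W2 -> C 0 (J 0 (J 0 W1)) = C 0 (J 0 (J 1 W2)).
  by move=> -> ->.
have split1 (W : Z) : J 0 (C 0 (C 2 (J 0 W))) = (C 0 (J 0 (C 0 (J 0 W))) +
    C 0 (J 0 (J 0 (B 2 (C 3 W)))) + C 0 (J 0 (J 0 (N 3 (B 2 W)))))%R.
  by rewrite rec (JC 0 2) // !(JB 0 1) // (JN 0 2).
have split2 (W : Z) : J 0 (C 0 (C 2 (J 2 W))) = (C 0 (J 0 (J 1 (C 0 W))) +
    C 0 (J 0 (B 1 (C 2 (J 2 W)))) + C 0 (J 0 (J 1 (N 3 (B 2 (B 1 W))))))%R.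
  by rewrite rec (CJ 0 1) // (Jr 1) (JN 1 2).
have lhs : J 0 (J 0 (C 0 (C 2 (C 4 X)))) =
   (J 0 (C 0 (C 2 (J 0 (C 0 X)))) + J 0 (C 0 (C 2 (J 0 (B 1 (C 2 X))))) +
   J 0 (C 0 (C 2 (J 0 (N 2 (B 1 X))))))%R.
  rewrite rec !addJ; congr (_ + _ + _)%R; congr (J 0 _).
  - by rewrite -(CC 0 3) // -(JC 0 2).
  - by rewrite -(CC 2 3) // -(BC 1 3) // -(JC 0 2).
  - by rewrite -(BC 1 4) // -(NC 2 3) // -(JC 0 2).
have rhs : J 0 (J 1 (C 0 (C 2 (C 4 X)))) =
   (J 0 (C 0 (C 2 (J 2 (C 2 X)))) + J 0 (C 0 (C 2 (J 2 (B 3 (C 4 X))))) +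
   J 0 (C 0 (C 2 (J 2 (N 4 (B 3 X))))))%R.
  by rewrite (CJ 0 1) // rec !addC !addJ.
rewrite /P lhs rhs !split1 !split2.
(* The three terms of the left-hand side with last letter [z]. *)
have bring : (C 0 (J 0 (C 0 (J 0 (C 0 X)))) + C 0 (J 0 (C 0 (J 0 (B 1 (C 2 X))))) +
   C 0 (J 0 (C 0 (J 0 (N 2 (B 1 X))))))%R = C 0 (J 0 (J 0 (C 0 (C 2 X)))).
  by rewrite rec !addJ !addC.
(* The three terms of the right-hand side with last letter [x]. *)
have bring' : (C 0 (J 0 (B 1 (C 2 (J 2 (C 2 X))))) + C 0 (J 0 (B 1 (C 2 (J 2 (B 3 (C 4 X)))))) +
   C 0 (J 0 (B 1 (C 2 (J 2 (N 4 (B 3 X)))))))%R = C 0 (J 0 (J 1 (B 2 (B 1 (C 2 (C 4 X)))))).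
  by rewrite -(Jr 1) rec !(addB, addJ, addC).
have q1 := JJ _ _ p1 erefl.
have /(JJ _ _ p2) q2 : B 2 (C 3 (C 0 X)) = C 0 (B 3 (C 4 X)).
  by rewrite (CC 0 3) // (CB 0 2).
have /(JJ _ _ p3) q3 : N 3 (B 2 (C 0 X)) = C 0 (N 4 (B 3 X)).
  by rewrite (CB 0 2) // (CN 0 3).
have /(JJ _ _ p4) q4 : B 2 (C 3 (B 1 (C 2 X))) = B 2 (B 1 (C 2 (C 4 X))).
  by rewrite (BC 1 3) // (CC 2 3).
have q5 := JJ _ _ p5 erefl.
have /(JJ _ _ p6) q6 : B 2 (C 3 (N 2 (B 1 X))) = N 3 (B 2 (B 1 (B 3 (C 4 X)))).
  by rewrite (NC 2 3) // (Nl 2) (BC 1 4) // (BB 1 3).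
have /(JJ _ _ p7) q7 : N 3 (B 2 (N 2 (B 1 X))) = N 3 (B 2 (B 1 (N 4 (B 3 X)))).
  by rewrite (Nl 2) NA (BB 1 3) // (BN 2 4) // (BN 1 4).
rewrite [LHS]sum33 bring q1 q2 q3 q4 q5 q6 q7 [RHS]sum33 bring'.
exact: regroup.
Qed.
End QuasiShuffle.
End Diagrams.
Arguments far2 {Z} F G.
Arguments far1 {Z} F G.
Arguments slidel {Z} B F.
Arguments slider {Z} B F.
Arguments yang_baxter {Z} B.

Set Implicit Arguments.
Local Open Scope ring_scope.

(** * Reduced expressions of a permutation *)

Section Matsumoto.
Variables (K : fieldType) (V : lmodType K) (s : {linear V ⊗ V -> V ⊗ V}).
Hypothesis sP : braiding s.
Local Notation T := (talg V).
Local Notation S := (braid_at s).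
Local Notation sg := (sigma_at s).

(** The two conventions for short words differ only below degree [i + 2]. *)
Lemma sigma_at_local i n (x : T) : homog n x -> (i.+1 < n)%N -> sg i x = S i x.
Proof.
move=> hx ni; apply: (@linear_eq_lspan _ _ _ _ (sg i) (S i) x _ _ _ hx); try exact: linearP.
move=> _ [w wn ->]; rewrite /braid_at /at2 at_slotE /sigma_at wliftE.
elim: i n w wn ni {hx} => [|i IH] n [|a w] wn ni; try by move: wn ni => /=; lia.
  case: w wn => [|b w] wn; first by move: wn ni => /=; lia.
  by rewrite /= wliftE take0 drop0.
by rewrite /= (IH n.-1) //; move: wn ni => /=; lia.
Qed.

Lemma sigma_at_yb i n (x : T) : homog n x -> (i.+2 < n)%N ->
  sg i (sg i.+1 (sg i x)) = sg i.+1 (sg i (sg i.+1 x)).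
Proof.
move=> hx ni; rewrite !(@sigma_at_local _ n) //; try lia; try by rewrite ?braid_at_yb.
all: repeat (apply: homog_braid_at); exact: hx.
Qed.

Lemma sigma_at_comm i j n (x : T) : homog n x -> (i.+1 < j)%N -> (j.+1 < n)%N ->
  sg j (sg i x) = sg i (sg j x).
Proof.
move=> hx ij ni; have ni' : (i.+1 < n)%N by lia.
have hS k : homog n (S k x) by apply: homog_braid_at.
rewrite (sigma_at_local hx ni) (sigma_at_local hx ni').
rewrite (sigma_at_local (hS i) ni) (sigma_at_local (hS j) ni').
exact: braid_at_comm.
Qed.

Section Perm.
Variable n : nat.
Implicit Types (w : 'S_n) (i j : 'I_n.-1).

Definition descent w i := (w (hi i) < w (lo i))%N.

Lemma braid_op_pick w : (0 < inversions w)%N ->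
  exists2 i, descent w i & forall x, braid_op s w x = braid_op s (adj i * w)%g (sg i x).
Proof.
rewrite /braid_op /reduced_expr; case e : (inversions w) => [|k] // _ /=.
case: pickP => [i hi|h]; last first.
  by move: e; rewrite (incr_id (w := w)) ?inversions1 // => i; rewrite h.
exists i => // x; have := inversions_adj hi; rewrite e => -[<-].
elim: (bubble _ _) x => [|j l IH] x //=; by rewrite IH.
Qed.

Lemma adj_braid i j : j = i.+1 :> nat -> (adj i * (adj j * adj i) = adj j * (adj i * adj j))%g.
Proof.
move=> ij; apply/permP => x; apply: val_inj; rewrite !permM !adj_val ij.
by do ![case: eqP => //=]; lia.
Qed.

Lemma adj_comm i j : (i.+1 < j)%N -> (adj i * adj j = adj j * adj i)%g.
Proof.
move=> ij; apply/permP => x; apply: val_inj; rewrite !permM !adj_val.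
by do ![case: eqP => //=]; lia.
Qed.

Lemma adj_lo i j : (i.+1 < j)%N || (j.+1 < i)%N -> adj i (lo j) = lo j.
Proof. by move=> ij; apply: val_inj; rewrite adj_val /=; do ![case: eqP => //=]; lia. Qed.

Lemma adj_hi i j : (i.+1 < j)%N || (j.+1 < i)%N -> adj i (hi j) = hi j.
Proof. by move=> ij; apply: val_inj; rewrite adj_val /=; do ![case: eqP => //=]; lia. Qed.

(** [braid_op] is computed from one particular reduced expression; this removes the
    choice. By induction on the number of inversions: removing either of two descents of [w]
    leads, in one or two further steps, to a common permutation, along two paths that are
    exchanged by a commutation or by a braid relation. *)
Lemma braid_op_descent w i x : homog n x -> descent w i ->
  braid_op s w x = braid_op s (adj i * w)%g (sg i x).
Proof.
have [k] := ubnP (inversions w); elim: k w i x => // k IH w i x wk hx di.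
have step w' j y : (inversions w' < inversions w)%N -> descent w' j -> homog n y ->
    braid_op s w' y = braid_op s (adj j * w')%g (sg j y).
  by move=> hw hj hy; apply: IH => //; apply: leq_trans hw _.
have inv_gt j : descent w j -> (inversions (adj j * w)%g < inversions w)%N.
  by move=> hj; rewrite [X in (_ < X)%N](inversions_adj hj).
have inv_gt2 j j' : descent w j -> descent (adj j * w)%g j' ->
    (inversions (adj j' * (adj j * w))%g < inversions w)%N.
  move=> hj hj'; apply: ltn_trans (inv_gt _ hj).
  by rewrite [X in (_ < X)%N](inversions_adj hj').
have sgn j : (j.+1 < n)%N by exact: hi_subproof.
(* The local confluence of the choice of a descent. *)
have confl j j' : (j < j')%N -> descent w j -> descent w j' ->
    braid_op s (adj j * w)%g (sg j x) = braid_op s (adj j' * w)%g (sg j' x).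
  move=> jj dj dj'; have [far|near] := ltnP j.+1 j'.
    have d1 : descent (adj j * w)%g j'.
      by rewrite /descent !permM adj_lo ?adj_hi ?far.
    have d2 : descent (adj j' * w)%g j.
      by rewrite /descent !permM adj_lo ?adj_hi ?far ?orbT.
    rewrite (step _ j') ?inv_gt //; last exact: homog_sigma.
    rewrite (step (adj j' * w)%g j) ?inv_gt //; last exact: homog_sigma.
    by rewrite !mulgA (adj_comm far) (sigma_at_comm hx).
  have ej : j' = j.+1 :> nat by lia.
  have elo : lo j' = hi j by apply: val_inj.
  have nlh : lo j != hi j' by rewrite -val_eqE /=; lia.
  have nhh : hi j != hi j' by rewrite -val_eqE /=; lia.
  have nll : lo j != lo j' by rewrite -val_eqE /=; lia.
  have a1 : adj j (hi j') = hi j' by rewrite /adj tpermD.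
  have a2 : adj j' (lo j) = lo j by rewrite /adj tpermD // eq_sym.
  have a3 : adj j' (hi j) = hi j' by rewrite -elo /adj tpermL.
  have a4 : adj j (hi j) = lo j by rewrite /adj tpermR.
  have a5 : adj j (lo j) = hi j by rewrite /adj tpermL.
  have a6 : adj j' (hi j') = hi j by rewrite -elo /adj tpermR.
  have dj2 : (w (hi j') < w (hi j))%N by rewrite -elo.
  have d1 : descent (adj j * w)%g j'.
    by rewrite /descent !permM a1 elo a4; apply: ltn_trans dj.
  have d2 : descent (adj j' * (adj j * w))%g j.
    by rewrite /descent !permM a2 a3 a1 a5.
  have d3 : descent (adj j' * w)%g j.
    by rewrite /descent !permM a2 a3; apply: ltn_trans dj.
  have d4 : descent (adj j * (adj j' * w))%g j'.
    by rewrite /descent !permM elo a4 a1 a2 a6.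
  have h1 y : homog n y -> homog n (sg j y) by apply: homog_sigma.
  have h2 y : homog n y -> homog n (sg j' y) by apply: homog_sigma.
  rewrite (step _ j') ?inv_gt //; last exact: h1.
  rewrite (step _ j) ?inv_gt2 //; last exact/h2/h1.
  rewrite (step (adj j' * w)%g j) ?inv_gt //; last exact: h2.
  rewrite (step (adj j * (adj j' * w))%g j') ?inv_gt2 //; last exact/h1/h2.
  rewrite !mulgA -[(adj j * adj j' * adj j)%g]mulgA adj_braid // mulgA ej.
  by rewrite (sigma_at_yb hx) // -ej.
have [j dj ->] : exists2 j, descent w j &
    forall x, braid_op s w x = braid_op s (adj j * w)%g (sg j x).
  by apply: braid_op_pick; rewrite (inversions_adj di).
have [ij|ij|/val_inj->] := ltngtP i j => //; last by apply: confl.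
by apply/esym/confl.
Qed.

(** The last letter of a reduced expression is a descent: otherwise the permutation of the
    remaining letters would have more inversions than there are letters. *)
Lemma braid_op_reduced (l : seq 'I_n.-1) x : homog n x ->
  size l = inversions (word_perm l) ->
  braid_op s (word_perm l) x = foldr (fun i => sg i) x l.
Proof.
elim/last_ind: l x => [|l i IH] x hx.
  by rewrite /= => _; rewrite /braid_op /reduced_expr inversions1.
rewrite size_rcons foldr_rcons word_perm_rcons => e.
have le := size_word_perm l.
have [h|h] := ltnP ((adj i * word_perm l)%g (hi i)) ((adj i * word_perm l)%g (lo i)).
  rewrite (braid_op_descent hx h) mulgA adjV mul1g IH //; first exact: homog_sigma.
  by have := inversions_adj h; rewrite mulgA adjV mul1g -e => -[].
have h' : descent (word_perm l) i.
  rewrite /descent; move: h; rewrite !permM /adj tpermL tpermR leq_eqVlt => /orP[/eqP|//].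
  by move=> /val_inj/perm_inj/(congr1 val) /=; lia.
by have := inversions_adj h'; rewrite -e; lia.
Qed.

End Perm.

End Matsumoto.

(** * The block transposition *)

(** A reduced expression of the block transposition [chi i j]. Read from right to left, it
    carries the letters of the left block through the right block, the last one first;
    [run j] is the passage of a single letter. *)
Fixpoint run j : seq nat := if j is j'.+1 then j' :: run j' else [::].
Fixpoint block_word i j : seq nat :=
  if i is i'.+1 then run j ++ map succn (block_word i' j) else [::].

(** The permutation of positions described by a word, on natural numbers so that words
    for different degrees can be compared. *)
Definition word_act (l : seq nat) y :=
  foldr (fun i y : nat => if y == i then i.+1 else if y == i.+1 then i else y) y l.

Lemma word_act_run j y : word_act (run j) y = if y == 0 then j else if (y <= j)%N then y.-1 else y.
Proof.
elim: j => [|j IH] /=; first by case: y => [|[|y]].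
by rewrite -/(word_act _ _) IH; do ![case: ifP]; lia.
Qed.

Lemma word_act_succ l y : word_act (map succn l) y = if y is y'.+1 then (word_act l y').+1 else 0.
Proof.
elim: l => [|i l IH]; first by case: y.
by rewrite /= -!/(word_act _ _) IH; case: y {IH} => [|y] //=; rewrite !eqSS; do ![case: ifP].
Qed.

Lemma word_act_block i j y : word_act (block_word i j) y =
  if (y < i)%N then (j + y)%N else if (y < i + j)%N then (y - i)%N else y.
Proof.
elim: i y => [|i IH] y; first by rewrite /= subn0; case: ifP.
rewrite /= /word_act foldr_cat -!/(word_act _ _) word_act_succ word_act_run.
by case: y => [|y] /=; rewrite ?IH; [lia | do ![case: ifP]; lia].
Qed.

Lemma size_block_word i j : size (block_word i j) = (i * j)%N.
Proof.
have sr : size (run j) = j by elim: j => //= j ->.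
by elim: i => [|i IH] //=; rewrite size_cat size_map IH sr mulSn.
Qed.

Lemma run_lt j : all (fun k => k < j)%N (run j).
Proof.
elim: j => //= j IH; rewrite ltnSn /=; apply: sub_all IH => k; lia.
Qed.

Lemma block_word_lt i j : all (fun k => k.+1 < i + j)%N (block_word i j).
Proof.
elim: i => //= i IH; rewrite all_cat all_map; apply/andP; split.
  by apply: sub_all (run_lt j) => k; lia.
by apply: sub_all IH => k /=; lia.
Qed.

Lemma map_val_ex n (l : seq nat) : all (fun k => k < n)%N l ->
  exists l' : seq 'I_n, map val l' = l.
Proof.
elim: l => [|k l IH] /=; first by exists [::].
by move=> /andP[kn /IH[l' <-]]; exists (Ordinal kn :: l').
Qed.

Lemma word_act_perm n (l : seq 'I_n.-1) x :
  val (word_perm l x) = word_act (map val l) (val x).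
Proof. by elim: l => [|i l IH] /=; rewrite ?perm1 // permM adj_val IH. Qed.

(** Every letter of the left block overtakes every letter of the right one. This bound is
    the length of [block_word], which is therefore reduced. *)
Lemma inversions_chi i j : (i * j <= inversions (chi i j))%N.
Proof.
rewrite -{1}(card_ord i) -{1}(card_ord j) -card_prod.
pose f (p : 'I_i * 'I_j) : 'I_(i + j) * 'I_(i + j) := (lshift j p.1, rshift i p.2).
have finj : injective f.
  by move=> [a b] [c d] [e1 /addnI e2]; congr (_, _); apply: val_inj.
rewrite -(card_imset _ finj); apply/subset_leq_card/subsetP => _ /imsetP[[a b] _ ->].
rewrite !inE /= !permE !chi_funE /= ltn_ord.
by have := ltn_ord a; have := ltn_ord b; case: ifP; lia.
Qed.

(** * The braiding of the tensor algebra and concatenation *)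

Section Hexagons.
Variables (K : fieldType) (V : lmodType K) (s : {linear V ⊗ V -> V ⊗ V}).
Hypothesis sP : braiding s.
Local Notation T := (talg V).
Local Notation S := (braid_at s).

Definition braid_word (l : seq nat) (x : T) : T := foldr (fun i => S i) x l.

Lemma braid_word_linear l : linear (braid_word l).
Proof. by elim: l => [|i l IH] a x y //=; rewrite IH linearP. Qed.

Lemma braid_word_homog l n x : homog n x -> homog n (braid_word l x).
Proof. by elim: l => //= i l IH hx; apply/homog_braid_at/IH. Qed.

Lemma braid_word_cat l l' x : braid_word (l ++ l') x = braid_word l (braid_word l' x).
Proof. exact: foldr_cat. Qed.

Lemma braid_word_catl l n x y : homog n x -> all (fun k => k.+1 < n)%N l ->
  braid_word l (x ** y) = braid_word l x ** y.
Proof.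
move=> hx; elim: l => //= i l IH /andP[ni /IH->].
by rewrite /braid_at /at2 (at_catl _ _ (braid_word_homog l hx)) // addn2.
Qed.

Lemma braid_word_shift l n x y : homog n x -> braid_word (map (addn n) l) (x ** y) = x ** braid_word l y.
Proof. by move=> hx; elim: l => //= i l ->; rewrite /braid_at /at2 (at_shift _ _ _ _ hx). Qed.

Lemma braid_word_comm l l' x : all (fun i => all (fun j => i.+1 < j)%N l') l ->
  braid_word l (braid_word l' x) = braid_word l' (braid_word l x).
Proof.
have cons i k y : braid_word (i :: k) y = S i (braid_word k y) by [].
elim: l => [//|i l IH] /andP[il hl]; rewrite !cons IH //; move: (braid_word l x) => y {IH hl}.
elim: l' il => [//|j l' IH] /andP[ij hl]; rewrite !cons -IH //.
exact/esym/braid_at_comm.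
Qed.

Lemma braid_op_chi i j x : homog (i + j) x -> braid_op s (chi i j) x = braid_word (block_word i j) x.
Proof.
move=> hx; have [|l lE] := @map_val_ex (i + j).-1 (block_word i j).
  by apply: sub_all (block_word_lt i j) => k; lia.
have wE : word_perm l = chi i j.
  apply/permP => y; apply: val_inj.
  by rewrite word_act_perm lE word_act_block permE chi_funE /= ltn_ord.
have sz : size l = (i * j)%N by rewrite -(size_map val) lE size_block_word.
rewrite -wE (braid_op_reduced sP) //; last first.
  by apply/eqP; rewrite eqn_leq size_word_perm wE sz inversions_chi.
have bnd (k : 'I_(i + j).-1) : (k.+1 < i + j)%N by exact: hi_subproof.
rewrite -lE /braid_word; elim: (l) => //= k r IH.
rewrite IH (@sigma_at_local _ _ _ _ (i + j)) //; exact: braid_word_homog.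
Qed.

Lemma tcat_split i (x : T) : tcat V (split_at V i x) = x.
Proof.
move: x; apply: linear_eq_words => [a x y|a x y|w]; rewrite ?linearP //.
by rewrite /split_at wliftE tcatE cat_take_drop.
Qed.

Lemma beta_word0 t : beta s (word t ⊠ word [::]) = word [::] ⊠ word t.
Proof. by rewrite wlift2E; case: t. Qed.

Lemma beta_0word t : beta s (word [::] ⊠ word t) = word t ⊠ word [::].
Proof. by rewrite wlift2E. Qed.

Lemma block_word0 i : block_word i 0 = [::].
Proof. by elim: i => //= i ->. Qed.

Lemma tcat_beta t u : tcat V (beta s (word t ⊠ word u)) =
  braid_word (block_word (size t) (size u)) (word (t ++ u)).
Proof.
case: t => [|a t]; first by rewrite beta_0word tcatE cats0.
case: u => [|b u]; first by rewrite beta_word0 tcatE cats0 block_word0.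
rewrite wlift2E /beta_word tcat_split braid_op_chi //.
by rewrite -size_cat; apply: homog_word.
Qed.

Lemma bihomog_split i j (z : T ⊗ T) : bihomog i j z -> split_at V i (tcat V z) = z.
Proof.
move=> hz; apply: (@linear_eq_lspan _ _ _ _ (fun z => split_at V i (tcat V z)) id z _ _ _ hz).
- by move=> a x y; rewrite !linearP.
- by [].
move=> _ [t [u [ti _ ->]]]; rewrite tcatE /split_at wliftE -ti.
by rewrite take_size_cat // drop_size_cat.
Qed.

(** Cutting after [i] letters undoes concatenation in bidegree [(i, j)]. Identities for
    [beta] are thereby reduced to identities between products of the [sigma_i]. *)
Lemma bihomog_inj i j (z z' : T ⊗ T) : bihomog i j z -> bihomog i j z' ->
  tcat V z = tcat V z' -> z = z'.
Proof. by move=> /bihomog_split {2}<- /bihomog_split {2}<- ->. Qed.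

Lemma bihomog_word t u : bihomog (size t) (size u) (word t ⊠ word u : T ⊗ T).
Proof. by apply: lspan_gen; exists t, u. Qed.

(** The expression carrying [t ++ t'] through [u] is the one for [t'], moved to the right
    by the size of [t], followed by the one for [t]. *)
Lemma beta_cat_l t t' u : beta s (word (t ++ t') ⊠ word u) =
  tensmap idfun (tcat V) (assoc T T T (op1 (beta s) (op2 (beta s)
    (word t ⊠ word t' ⊠ word u)))).
Proof.
rewrite op2E.
pose G q (y : T ⊗ T) : T ⊗ T := tensmap idfun (tcat V) (assoc T T T (y ⊠ q)).
pose F (z : T ⊗ T) := tensmap idfun (tcat V)
  (assoc T T T (op1 (beta s) (unassoc T T T (word t ⊠ z)))).
rewrite -[RHS]/(F _).
have [L1 L2] := tpair_bilin T T.
have [M1 M2] := tpair_bilin (T ⊗ T) T.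
have [N1 N2] := tpair_bilin T (T ⊗ T).
have Gl q : linear (G q) by move=> a x y; rewrite /G M1 !linearP.
have Fl : linear F by move=> a x y; rewrite /F N2 !linearP.
have FE p q : F (word p ⊠ q) = G q (beta s (word t ⊠ word p)).
  by rewrite /F unassocE /op1 tensmapE.
have Gh q i j y : bihomog i j y -> bihomog i (j + size q) (G (word q) y).
  apply: lspan_linear; first exact: Gl.
  move=> _ [v [w [<- <- ->]]]; rewrite /G assocE tensmapE tcatE -size_cat.
  exact: bihomog_word.
have Gt q y : tcat V (G q y) = tcat V y ** q.
  move: y; apply: tens_fext => [a x y|a x y|v w].
  - by rewrite Gl linearP.
  - by rewrite linearP tcatl.
  by rewrite /G assocE tensmapE tcatA.
have hz := bihomog_beta s t' u.
apply: (@bihomog_inj (size u) (size t + size t')).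
- by rewrite -size_cat; apply: bihomog_beta.
- apply: (lspan_linear Fl _ hz) => _ [p [q [pu qt ->]]].
  rewrite FE -qt -pu; apply: Gh; exact: bihomog_beta.
rewrite tcat_beta size_cat -catA -tcatE.
have -> : block_word (size t + size t') (size u) =
    block_word (size t) (size u) ++ map (addn (size t)) (block_word (size t') (size u)).
  elim: (size t) => [|i IH] /=; first by rewrite map_id_in.
  by rewrite IH map_cat catA -map_comp; congr (_ ++ _).
rewrite braid_word_cat (braid_word_shift _ _ (homog_word t)) -tcat_beta.
apply: (@linear_eq_lspan _ _ _ _ (fun z => braid_word _ (word t ** tcat V z))
   (fun z => tcat V (F z)) _ _ _ _ hz).
- by move=> a x y; rewrite linearP tcatr braid_word_linear.
- by move=> a x y; rewrite Fl linearP.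
move=> _ [p [q [pu qt ->]]].
rewrite FE Gt tcat_beta -pu tcatE tcatE catA -tcatE.
by rewrite (braid_word_catl _ (homog_word _)) // size_cat; apply: block_word_lt.
Qed.

(** Carrying the letters one after the other through [j + j'] letters, or first all of
    them through [j] letters and then through [j'], orders the same crossings differently;
    the crossings that are exchanged have no strand in common. *)
Lemma braid_block_add c i j j' x :
  braid_word (map (addn c) (block_word i (j + j'))) x =
  braid_word (map (addn c) (map (addn j) (block_word i j') ++ block_word i j)) x.
Proof.
elim: i c x => [|i IH] c x //=.
have runD : run (j + j') = map (addn j) (run j') ++ run j.
  by elim: j' {IH} => [|j' IH]; rewrite ?addn0 // addnS /= IH.
have mapS d l : map (addn d) (map succn l) = map (addn d.+1) l.
  by rewrite -map_comp; apply: eq_map => k /=; rewrite addnS.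
rewrite runD !map_cat !mapS !braid_word_cat IH !map_cat !braid_word_cat; congr braid_word.
have -> : map (addn c.+1) (map (addn j) (block_word i j')) =
    map (addn c) (map (addn j.+1) (block_word i j')).
  by rewrite -!map_comp; apply: eq_map => k /=; lia.
apply: braid_word_comm; apply/allP => a /mapP[k kj ->].
apply/allP => b /mapP[k' /mapP[k'' _ ->] ->].
by have /allP/(_ _ kj) := run_lt j; lia.
Qed.

(** As for [beta_cat_l], the two ways of ordering the crossings being compared by
    [braid_block_add]. *)
Lemma beta_cat_r t u u' : beta s (word t ⊠ word (u ++ u')) =
  tensmap (tcat V) idfun (op2 (beta s) (op1 (beta s) (word t ⊠ word u ⊠ word u'))).
Proof.
rewrite /op1 tensmapE.
pose G p (y : T ⊗ T) : T ⊗ T := tensmap (tcat V) idfun (unassoc T T T (p ⊠ y)).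
pose F (z : T ⊗ T) := tensmap (tcat V) idfun (op2 (beta s) (z ⊠ word u')).
rewrite -[RHS]/(F _).
have [L1 L2] := tpair_bilin T T.
have [M1 M2] := tpair_bilin (T ⊗ T) T.
have [N1 N2] := tpair_bilin T (T ⊗ T).
have Gl q : linear (G q) by move=> a x y; rewrite /G N2 !linearP.
have Fl : linear F by move=> a x y; rewrite /F M1 !linearP.
have FE p q : F (p ⊠ word q) = G p (beta s (word q ⊠ word u')).
  by rewrite /F op2E.
have Gh p i j y : bihomog i j y -> bihomog (size p + i) j (G (word p) y).
  apply: lspan_linear; first exact: Gl.
  move=> _ [v [w [<- <- ->]]]; rewrite /G unassocE tensmapE tcatE -size_cat.
  exact: bihomog_word.
have Gt p y : tcat V (G p y) = p ** tcat V y.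
  move: y; apply: tens_fext => [a x y|a x y|v w].
  - by rewrite Gl linearP.
  - by rewrite linearP tcatr.
  by rewrite /G unassocE tensmapE tcatA.
have hz := bihomog_beta s t u.
apply: (@bihomog_inj (size u + size u') (size t)).
- by rewrite -size_cat; apply: bihomog_beta.
- apply: (lspan_linear Fl _ hz) => _ [p [q [pu qt ->]]].
  rewrite FE -qt -pu; apply: Gh; exact: bihomog_beta.
rewrite tcat_beta size_cat catA -tcatE.
have map0 l : map (addn 0) l = l by rewrite map_id_in.
rewrite -[block_word _ _]map0 braid_block_add map0 braid_word_cat.
rewrite (braid_word_catl _ (homog_word _)); last by rewrite size_cat; apply: block_word_lt.
rewrite -tcat_beta.
apply: (@linear_eq_lspan _ _ _ _ (fun z => braid_word _ (tcat V z ** word u'))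
   (fun z => tcat V (F z)) _ _ _ _ hz).
- by move=> a x y; rewrite linearP tcatl braid_word_linear.
- by move=> a x y; rewrite Fl linearP.
move=> _ [p [q [pu qt ->]]].
rewrite FE Gt tcat_beta -pu -tcatA tcatE.
by rewrite (braid_word_shift _ _ (homog_word _)) qt.
Qed.

Lemma beta_letters (z : V ⊗ V) :
  beta s (tensmap (@inj1 K V) (@inj1 K V) z) = tensmap (@inj1 K V) (@inj1 K V) (s z).
Proof.
move: z; apply: tens_fext => [a x y|a x y|x y]; rewrite ?linearP //.
have hs (z : V ⊗ V) : bihomog 1 1 (tensmap (@inj1 K V) (@inj1 K V) z).
  move: z; apply: pmod_ind => [|c [a b] z IH]; first by rewrite linear0; apply: lspan0.
  rewrite linearP; apply: lspan_add IH; apply: lspan_scale.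
  rewrite -/(tpair a b) tensmapE; exact: (bihomog_word [:: a] [:: b]).
rewrite tensmapE; apply: (@bihomog_inj 1 1) => //; first exact: (bihomog_beta s [:: x] [:: y]).
transitivity (S 0 (inj2 V (x ⊠ y))).
  by rewrite inj2E; exact: (tcat_beta [:: x] [:: y]).
rewrite /braid_at at2_0z -[LHS]/(inj2 V (s _)).
move: (s _); apply: tens_fext => [a x' y'|a x' y'|x' y']; rewrite ?linearP //.
by rewrite tensmapE inj2E tcatE.
Qed.

End Hexagons.

(** * Words of tensors and the sizes of their slots *)

Section Slots.
Variables (K : fieldType) (A : lmodType K).
Local Notation TA := (talg A).
Implicit Types (s : {linear A ⊗ A -> A ⊗ A}) (m : {linear A ⊗ A -> A}).

Lemma at2_small f n i (X : TA) : homog n X -> (n < i.+2)%N -> at2 f i X = 0.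
Proof. by move=> hX ni; apply: at_small hX _; rewrite addn2. Qed.

Lemma homog_mul_pred m n i X : homog n X -> homog n.-1 (mul_at m i X).
Proof.
case: n => [|n] hX; last exact: homog_mul_at.
by rewrite /mul_at (at2_small _ hX) //; apply: lspan0.
Qed.

Lemma braid_homog2 s z : homog 2 ((inj2 A \o s) z).
Proof. exact: homog_inj2. Qed.

Lemma mul_homog1 m z : homog 1 ((@inj1 K A \o m) z).
Proof. exact: homog_inj1. Qed.

Lemma local_braid s c d : local (c + 2 + d) (c + 2 + d) (fun i => braid_at s (c + i)).
Proof. exact: local_at (on2_homog (@braid_homog2 s)). Qed.

Lemma local_mul m c d : local (c + 2 + d) (c + 1 + d) (fun i => mul_at m (c + i)).
Proof. exact: local_at (on2_homog (@mul_homog1 m)). Qed.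

Lemma at2_braid f s i j X : (i.+1 < j)%N ->
  at2 f j (braid_at s i X) = braid_at s i (at2 f j X).
Proof.
move=> ij; rewrite -(subnKC ij) -[i.+2]addn2.
exact: at_comm (on2_homog (@braid_homog2 s)).
Qed.

Lemma at2_mul f m i j X : (i < j)%N ->
  at2 f j (mul_at m i X) = mul_at m i (at2 f j.+1 X).
Proof.
move=> ij; have e1 : (i + 1 + (j - i.+1))%N = j by lia.
have e2 : (i + 2 + (j - i.+1))%N = j.+1 by lia.
have := at_comm 2 (on2 f) i (j - i.+1) X (on2_homog (@mul_homog1 m)).
rewrite e1 e2; exact.
Qed.

End Slots.

Section Shapes.
Variables (K : fieldType) (V : lmodType K).
Local Notation T := (talg V).

(** The sizes of the slots. They are exchanged by [beta] and so make sense for elements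
    that are no longer single words, which is what the inductions below require. *)
Definition shaped (sh : seq nat) : talg T -> Prop :=
  lspan (fun x => exists2 ws, map size ws = sh & x = word (map (@word K V) ws)).

Lemma shaped_word ws : shaped (map size ws) (word (map (@word K V) ws)).
Proof. by apply: lspan_gen; exists ws. Qed.

Lemma shaped_cat sh sh' X Y : shaped sh X -> shaped sh' Y -> shaped (sh ++ sh') (X ** Y).
Proof.
apply: pair_lspan => _ _ [t <- ->] [u <- ->]; rewrite tcatE -!map_cat.
exact: shaped_word.
Qed.

Lemma shaped_homog sh X : shaped sh X -> homog (size sh) X.
Proof.
elim=> [|c x v [ws <- ->] _ IH]; first exact: lspan0.
apply: lspan_add IH; apply: lspan_scale; rewrite size_map -(size_map (@word K V)).
exact: homog_word.
Qed.

Lemma map_size_cat (ws : seq (seq V)) sh sh' : map size ws = sh ++ sh' ->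
  exists ws1 ws2, [/\ ws = ws1 ++ ws2, map size ws1 = sh & map size ws2 = sh'].
Proof.
move=> h; exists (take (size sh) ws), (drop (size sh) ws).
by rewrite cat_take_drop map_take map_drop h take_size_cat // drop_size_cat.
Qed.

Lemma shaped_at2 (f : {linear T ⊗ T -> talg T}) sh1 a b sh2 sh' X :
  (forall t u, size t = a -> size u = b -> shaped sh' (f (word t ⊠ word u))) ->
  shaped (sh1 ++ a :: b :: sh2) X -> shaped (sh1 ++ sh' ++ sh2) (at2 f (size sh1) X).
Proof.
move=> hf; apply: lspan_map => _ [ws e ->]; rewrite -/(shaped _ _).
have [ws1 [ws2 [-> e1 e2]]] := map_size_cat e.
case: ws2 e2 => [|t [|u ws2]] //= [ta ub e2].
rewrite map_cat -tcatE -[size sh1]addn0 /at2 at_shift; last first.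
  by rewrite -e1 size_map -(size_map (@word K V)); apply: homog_word.
rewrite -/(at2 f) at2_0w; apply: shaped_cat; first by rewrite -e1; apply: shaped_word.
by apply: shaped_cat; [apply: hf | rewrite -e2; apply: shaped_word].
Qed.

Lemma shaped_shift (F G : nat -> talg T -> talg T) n m n' m' a sh X :
  local n m F -> local n' m' G -> (forall Y, shaped sh Y -> F 0 Y = G 0 Y) ->
  shaped (a :: sh) X -> F 1 X = G 1 X.
Proof.
move=> [F1 F2 _ _] [G1 G2 _ _] h; apply: linear_eq_lspan => //.
move=> _ [[|w ws] // [_ e] ->].
rewrite -[word _](tcatE [:: word w] (map (@word K V) ws)) F2 G2 h //.
by rewrite -e; apply: shaped_word.
Qed.

Definition pr1 : {linear T -> V} := on1 idfun.
Definition letter (x : T) : T := inj1 (pr1 x).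
Lemma letter_linear : linear letter.
Proof. by move=> a x y; rewrite /letter !linearP. Qed.
HB.instance Definition _ := GRing.isLinear.Build K T (talg V) _ letter letter_linear.

Lemma pr1_word w : pr1 (word w) = if w is [:: x] then x else 0.
Proof. exact: wliftE. Qed.

Lemma letter1 w : size w = 1 -> letter (word w) = word w.
Proof. by case: w => [|x []] // _; rewrite /letter pr1_word. Qed.

Lemma letter0 w : size w != 1 -> letter (word w) = 0.
Proof. by case: w => [|x [|y w]] // _; rewrite /letter pr1_word linear0. Qed.

(** Concatenation, cut down to the case of a single letter on the right. With the
    restriction built into the map, the rules for appending a letter hold without conditions
    on the elements to which they are applied. *)
Definition app (z : T ⊗ T) : T := tcat V (tensmap idfun letter z).
Lemma app_linear : linear app.
Proof. by move=> a x y; rewrite /app !linearP. Qed.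
HB.instance Definition _ := GRing.isLinear.Build K (T ⊗ T) (talg V) _ app app_linear.

Lemma appE x y : app (x ⊠ y) = x ** letter y.
Proof. by rewrite /app tensmapE. Qed.

End Shapes.

(** * The braiding and an appended letter *)

Section Rules.
Variables (K : fieldType) (V : lmodType K) (s : {linear V ⊗ V -> V ⊗ V}).
Hypothesis sP : braiding s.
Local Notation T := (talg V).
Local Notation B := (braid_at (beta s)).
Local Notation C := (mul_at (@app K V)).

(** [beta_cat_l] again: [beta] preserves the sizes of words, so the factor that had to be
    a letter still has to. *)
Lemma beta_app_l z :
  beta s (tensmap (@app K V) idfun z) =
  tensmap idfun (@app K V) (assoc T T T (op1 (beta s) (op2 (beta s) z))).
Proof.
have [M1 M2] := tpair_bilin (T ⊗ T) T.
have [N1 N2] := tpair_bilin T (T ⊗ T).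
move: z; apply: tens3_fext => [a x y|a x y|x y z]; rewrite ?linearP //.
move: x; apply: linear_eq_words => [a x x'|a x x'|t].
- by rewrite (tpair_bilin _ _).1 M1 !linearP.
- by rewrite (tpair_bilin _ _).1 M1 !linearP.
move: y; apply: linear_eq_words => [a x x'|a x x'|t'].
- by rewrite (tpair_bilin _ _).2 M1 !linearP.
- by rewrite (tpair_bilin _ _).2 M1 !linearP.
move: z; apply: linear_eq_words => [a x x'|a x x'|u].
- by rewrite M2 !linearP.
- by rewrite M2 !linearP.
rewrite tensmapE -[X in X ⊠ _]/(app _) appE op2E.
pose F (f : {linear T ⊗ T -> T}) (z : T ⊗ T) := tensmap idfun f
  (assoc T T T (op1 (beta s) (unassoc T T T (word t ⊠ z)))).
have Fl f : linear (F f) by move=> a x y; rewrite /F N2 !linearP.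
pose G (f : {linear T ⊗ T -> T}) q (y : T ⊗ T) : T ⊗ T := tensmap idfun f (assoc T T T (y ⊠ q)).
have Gl f q : linear (G f q) by move=> a x y; rewrite /G M1 !linearP.
have FE f p q : F f (word p ⊠ q) = G f q (beta s (word t ⊠ word p)).
  by rewrite /F unassocE /op1 tensmapE.
have hz := bihomog_beta s t' u.
rewrite -[RHS]/(F (@app K V) _).
have [t1|t1] := eqVneq (size t') 1%N.
  rewrite letter1 // tcatE beta_cat_l // op2E -[LHS]/(F (tcat V) _).
  apply: (linear_eq_lspan (Fl _) (Fl _) _ hz) => _ [p [q [_ qt ->]]].
  rewrite !FE; move: (beta _ _); apply: tens_fext; try exact: Gl.
  by move=> a b; rewrite /G !assocE !tensmapE /= appE letter1 // qt.
rewrite letter0 // tcat0r tpair0l linear0; apply/esym.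
apply: (@linear_eq_lspan _ _ _ _ (F (@app K V)) (fun=> 0) _ (Fl _) _ _ hz).
  by move=> a x y; rewrite scaler0 addr0.
move=> _ [p [q [_ qt ->]]].
rewrite !FE; move: (beta _ _); apply: (@tens_fext _ _ _ _ _ (fun=> 0)); first exact: Gl.
  by move=> a x y; rewrite scaler0 addr0.
by move=> a b; rewrite /G !assocE !tensmapE /= appE letter0 ?qt // tcat0r tpair0r.
Qed.

Lemma beta_app_r z :
  beta s (tensmap idfun (@app K V) (assoc T T T z)) =
  tensmap (@app K V) idfun (op2 (beta s) (op1 (beta s) z)).
Proof.
have [M1 M2] := tpair_bilin (T ⊗ T) T.
have [N1 N2] := tpair_bilin T (T ⊗ T).
move: z; apply: tens3_fext => [a x y|a x y|x y z]; rewrite ?linearP //.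
move: x; apply: linear_eq_words => [a x x'|a x x'|t].
- by rewrite (tpair_bilin _ _).1 M1 !linearP.
- by rewrite (tpair_bilin _ _).1 M1 !linearP.
move: y; apply: linear_eq_words => [a x x'|a x x'|u].
- by rewrite (tpair_bilin _ _).2 M1 !linearP.
- by rewrite (tpair_bilin _ _).2 M1 !linearP.
move: z; apply: linear_eq_words => [a x x'|a x x'|u'].
- by rewrite M2 !linearP.
- by rewrite M2 !linearP.
rewrite assocE tensmapE -[X in _ ⊠ X]/(app _) appE /op1 tensmapE.
pose G (f : {linear T ⊗ T -> T}) p (y : T ⊗ T) : T ⊗ T :=
  tensmap f idfun (unassoc T T T (p ⊠ y)).
pose F (f : {linear T ⊗ T -> T}) (z : T ⊗ T) :=
  tensmap f idfun (op2 (beta s) (z ⊠ word u')).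
have Gl f q : linear (G f q) by move=> a x y; rewrite /G N2 !linearP.
have Fl f : linear (F f) by move=> a x y; rewrite /F M1 !linearP.
have FE f p q : F f (p ⊠ word q) = G f p (beta s (word q ⊠ word u')).
  by rewrite /F op2E.
have hz := bihomog_beta s t u.
rewrite -[RHS]/(F (@app K V) _).
have [t1|t1] := eqVneq (size u') 1%N.
  rewrite letter1 // tcatE beta_cat_r // /op1 tensmapE -[LHS]/(F (tcat V) _).
  apply: (linear_eq_lspan (Fl _) (Fl _) _ hz) => _ [p [q [_ qt ->]]].
  rewrite !FE; apply: (linear_eq_lspan (Gl _ _) (Gl _ _) _ (bihomog_beta s q u')).
  move=> _ [v [w [vu _ ->]]].
  by rewrite /G !unassocE !tensmapE /= appE letter1 // vu.
rewrite letter0 // tcat0r tpair0r linear0; apply/esym.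
have z0 : linear (fun _ : T ⊗ T => 0 : T ⊗ T) by move=> a x y; rewrite scaler0 addr0.
apply: (linear_eq_lspan (Fl _) z0 _ hz) => _ [p [q [_ qt ->]]].
rewrite !FE; apply: (linear_eq_lspan (Gl _ _) z0 _ (bihomog_beta s q u')).
move=> _ [v [w [vu _ ->]]].
by rewrite /G !unassocE !tensmapE /= appE letter0 ?vu // tcat0r tpair0l.
Qed.

Lemma beta_slidel : slidel (Z := talg T) B C.
Proof.
apply: (local_eq
  (local_comp (local_mul (@app K V) 0 1) (local_braid (beta s) 0 0))
  (local_comp (local_comp (local_braid (beta s) 1 0) (local_braid (beta s) 0 1))
     (local_mul (@app K V) 1 0))).
  move=> i w wi; have hw := homog_word w; rewrite !add0n !add1n.
  rewrite [B i.+1 _](at2_small _ hw) ?linear0; last by lia.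
  by rewrite [LHS](at2_small _ (homog_mul_pred _ _ hw)) //; lia.
move=> w /word3E[z ->]; rewrite !addn0.
by rewrite braid_at_1t braid_at_0t mul_at_0t mul_at_1t /braid_at at2_0z -beta_app_l.
Qed.

Lemma beta_slider : slider (Z := talg T) B C.
Proof.
apply: (local_eq
  (local_comp (local_mul (@app K V) 1 0) (local_braid (beta s) 0 0))
  (local_comp (local_comp (local_braid (beta s) 0 1) (local_braid (beta s) 1 0))
     (local_mul (@app K V) 0 1))).
  move=> i w wi; have hw := homog_word w; rewrite !add0n !add1n.
  rewrite [C i.+1 _](at2_small _ hw) ?linear0; last by lia.
  by rewrite [B i.+1 _](at2_small _ (homog_braid_at _ _ hw)) ?linear0 //; lia.
move=> w /word3E[z ->]; rewrite !addn0.
rewrite braid_at_0t braid_at_1t mul_at_0t.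
rewrite mul_at_1t /braid_at at2_0z; exact: (congr1 (inj2 T) (beta_app_r z)).
Qed.

Lemma shaped_beta sh1 a b sh2 X : shaped (sh1 ++ a :: b :: sh2) X ->
  shaped (sh1 ++ b :: a :: sh2) (B (size sh1) X).
Proof.
apply: (@shaped_at2 _ _ _ _ _ _ _ [:: b; a]) => t u <- <-.
have := bihomog_beta s t u; rewrite -[X in shaped _ X]/(inj2 T (beta s _)).
apply: lspan_map => _ [v [w [<- <- ->]]]; rewrite inj2E; exact: (shaped_word [:: v; w]).
Qed.

Lemma shaped_app sh1 a sh2 X : shaped (sh1 ++ a :: 1%N :: sh2) X ->
  shaped (sh1 ++ a.+1 :: sh2) (C (size sh1) X).
Proof.
apply: (@shaped_at2 _ _ _ _ _ _ _ [:: a.+1]) => t u <- u1.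
rewrite -[X in shaped _ X]/(inj1 (app (word t ⊠ word u))) appE letter1 // tcatE.
by rewrite -addn1 -u1 -size_cat; apply: (shaped_word [:: t ++ u]).
Qed.

End Rules.

(** * Insertion of a unit *)

Section Insert.
Variables (K : fieldType) (A : lmodType K) (e : A).
Local Notation TA := (talg A).

Lemma on0_multilin : multilin (fun w : seq A => if w is [::] then word [:: e] else 0).
Proof. by move=> a [|z l] x y r /=; rewrite scaler0 addr0. Qed.
Definition on0 : {linear TA -> TA} := wlift on0_multilin.
Definition ins i := at_slot 0 on0 i.

Lemma on0_homog (x : TA) : homog 0 x -> homog 1 (on0 x).
Proof.
apply: lspan_map => _ [[|a w] // _ ->]; rewrite wliftE.
exact: (homog_word [:: e]).
Qed.

Lemma ins0 Y : ins 0 Y = word [:: e] ** Y.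
Proof. by rewrite -{1}[Y]tcat1l /ins at0_word // wliftE. Qed.

Lemma ins_shift n j X Y : homog n X -> ins (n + j) (X ** Y) = X ** ins j Y.
Proof. exact: at_shift. Qed.

Lemma at2_ins f i j X : (i <= j)%N -> at2 f j.+1 (ins i X) = ins i (at2 f j X).
Proof.
move=> ij; have e1 : (i + 1 + (j - i))%N = j.+1 by lia.
have e2 : (i + 0 + (j - i))%N = j by lia.
by have := at_comm 2 (on2 f) i (j - i) X on0_homog; rewrite e1 e2.
Qed.

Lemma ins_braid s i j X : (i.+1 < j)%N ->
  ins j (braid_at s i X) = braid_at s i (ins j X).
Proof.
move=> ij; rewrite -(subnKC ij) -[i.+2]addn2.
exact: at_comm (on2_homog (@braid_homog2 K A s)).
Qed.

Lemma ins_mul m i j X : (i < j)%N -> ins j (mul_at m i X) = mul_at m i (ins j.+1 X).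
Proof.
move=> ij; have e1 : (i + 1 + (j - i.+1))%N = j by lia.
have e2 : (i + 2 + (j - i.+1))%N = j.+1 by lia.
by have := at_comm 0 on0 i (j - i.+1) X (on2_homog (@mul_homog1 K A m)); rewrite e1 e2.
Qed.

(** When its left input is fed with [e], the box [f] becomes a diagram [G] on one
    strand. *)
Lemma at2_ins_l (f : {linear A ⊗ A -> TA}) G n i X : (forall i, linear (G i)) ->
  (forall i a Y, G i.+1 (word [:: a] ** Y) = word [:: a] ** G i Y) ->
  (forall a Y, G 0 (word [:: a] ** Y) = f (e ⊠ a) ** Y) ->
  homog n X -> (i < n)%N -> at2 f i (ins i X) = G i X.
Proof.
move=> G1 G2 G3 hX ni.
apply: (@linear_eq_lspan _ _ _ _ (fun X => at2 f i (ins i X)) _ _ _ _ _ hX) => //.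
  by move=> a x y; rewrite !linearP.
move=> _ [w wn ->]; elim: i n w wn ni {hX} => [|i IH] n [|a w] wn ni; try by move: ni; rewrite -wn.
  rewrite ins0 -[word (a :: w)](tcatE [:: a]) G3 tcatA -at2_0; congr (at2 f 0 (_ ** _)).
  by rewrite inj2E tcatE.
rewrite -[word (a :: w)](tcatE [:: a]) /ins /at2 !at_cons G2 -/(ins _) -/(at2 _).
by rewrite (IH n.-1) //; move: wn ni => /=; lia.
Qed.

Lemma at2_ins_r (f : {linear A ⊗ A -> TA}) G n i X : (forall i, linear (G i)) ->
  (forall i a Y, G i.+1 (word [:: a] ** Y) = word [:: a] ** G i Y) ->
  (forall a Y, G 0 (word [:: a] ** Y) = f (a ⊠ e) ** Y) ->
  homog n X -> (i < n)%N -> at2 f i (ins i.+1 X) = G i X.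
Proof.
move=> G1 G2 G3 hX ni.
apply: (@linear_eq_lspan _ _ _ _ (fun X => at2 f i (ins i.+1 X)) _ _ _ _ _ hX) => //.
  by move=> a x y; rewrite !linearP.
move=> _ [w wn ->]; elim: i n w wn ni {hX} => [|i IH] n [|a w] wn ni; try by move: ni; rewrite -wn.
  rewrite -[word (a :: w)](tcatE [:: a]) G3 /ins at_cons -/(ins _) ins0 tcatA -at2_0.
  by congr (at2 f 0 (_ ** _)); rewrite inj2E tcatE.
rewrite -[word (a :: w)](tcatE [:: a]) /ins /at2 !at_cons G2 -/(ins _) -/(at2 _).
by rewrite (IH n.-1) //; move: wn ni => /=; lia.
Qed.

Section BraidUnit.
Variables (s : {linear A ⊗ A -> A ⊗ A}) (sU : braid_unit s e).

Lemma braid_ins_l n i X : homog n X -> (i < n)%N -> braid_at s i (ins i X) = ins i.+1 X.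
Proof.
apply: (@at2_ins_l _ (fun i => ins i.+1)) => [j|j a Y|a Y]; first exact: linearP.
- exact: at_cons.
rewrite /ins at_cons -/(ins _) ins0 -[X in _ = X ** _]/(inj2 A (s _)) (sU a).1.
by rewrite inj2E tcatA tcatE.
Qed.

Lemma braid_ins_r n i X : homog n X -> (i < n)%N -> braid_at s i (ins i.+1 X) = ins i X.
Proof.
apply: (@at2_ins_r _ ins) => [j|j a Y|a Y]; first exact: linearP.
- exact: at_cons.
rewrite ins0 -[X in _ = X ** _]/(inj2 A (s _)) (sU a).2.
by rewrite inj2E tcatA tcatE.
Qed.

End BraidUnit.

Section MulUnit.
Variables (m : {linear A ⊗ A -> A}) (mU : unit_of m e).

Lemma mul_ins_l n i X : homog n X -> (i < n)%N -> mul_at m i (ins i X) = X.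
Proof.
apply: (@at2_ins_l _ (fun=> id)) => [j|j a Y|a Y] //.
by rewrite -[X in _ = X ** _]/(inj1 (m _)) (mU a).1.
Qed.

Lemma mul_ins_r n i X : homog n X -> (i < n)%N -> mul_at m i (ins i.+1 X) = X.
Proof.
apply: (@at2_ins_r _ (fun=> id)) => [j|j a Y|a Y] //.
by rewrite -[X in _ = X ** _]/(inj1 (m _)) (mU a).2.
Qed.

End MulUnit.

End Insert.

(** * Induction on the sizes of the slots *)

Section Induction.
Variables (K : fieldType) (V : lmodType K).
Local Notation T := (talg V).
Local Notation U := (ins (word [::] : T)).
Local Notation C := (mul_at (@app K V)).

(** Together with [shaped_app_inv] the case distinction on the size of a slot: an empty
    slot has been inserted, and a nonempty one ends in a letter. *)
Lemma shaped_ins_inv sh1 sh2 X : shaped (sh1 ++ 0%N :: sh2) X ->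
  exists2 Y, shaped (sh1 ++ sh2) Y & X = U (size sh1) Y.
Proof.
elim=> [|c x v [ws e ->] _ [Y hY ->]].
  by exists 0; [exact: lspan0 | rewrite linear0].
have [ws1 [ws2 [-> e1]]] := map_size_cat e; case: ws2 => [|[|y t] ws2] // [e2].
exists (c *: word (map (@word K V) (ws1 ++ ws2)) + Y).
  apply: lspan_add hY; apply: lspan_scale; rewrite -e1 -e2 -map_cat.
  exact: shaped_word.
rewrite linearP; congr (_ *: _ + _).
rewrite !map_cat -[word (_ ++ map _ ws2)]tcatE -[size sh1]addn0.
rewrite ins_shift ?ins0 ?tcatE //.
by rewrite -e1 size_map -(size_map (@word K V)); apply: homog_word.
Qed.

Lemma shaped_app_inv sh1 a sh2 X : shaped (sh1 ++ a.+1 :: sh2) X ->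
  exists2 Y, shaped (sh1 ++ a :: 1%N :: sh2) Y & X = C (size sh1) Y.
Proof.
elim=> [|c x v [ws e ->] _ [Y hY ->]].
  by exists 0; [exact: lspan0 | rewrite linear0].
have [ws1 [ws2 [-> e1]]] := map_size_cat e; case: ws2 => [|w ws2] //.
case/lastP: w => // t y; rewrite /= size_rcons => -[ea e2].
exists (c *: word (map (@word K V) (ws1 ++ t :: [:: y] :: ws2)) + Y).
  apply: lspan_add hY; apply: lspan_scale; rewrite -e1 -e2 -ea.
  by rewrite -[_ :: 1%N :: _]/(map size (t :: [:: y] :: ws2)) -map_cat; apply: shaped_word.
rewrite linearP; congr (_ *: _ + _).
rewrite !map_cat -[word (_ ++ map _ [:: t, _ & ws2])]tcatE -[size sh1]addn0.
rewrite /mul_at /at2 at_shift.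
  rewrite -tcatE; congr (_ ** _).
  rewrite -/(at2 _) at2_0w -[X in X ** _]/(inj1 (app _)) appE letter1 // tcatE tcatE.
  by rewrite cats1.
by rewrite -e1 size_map -(size_map (@word K V)); apply: homog_word.
Qed.

Lemma shaped_at2_0 (f : {linear T ⊗ T -> talg T}) sh1 a b sh2 X :
  (forall t u, size t = a -> size u = b -> f (word t ⊠ word u) = 0) ->
  shaped (sh1 ++ a :: b :: sh2) X -> at2 f (size sh1) X = 0.
Proof.
move=> hf; elim=> [|c _ Y [ws e ->] _ IH]; first exact: linear0.
rewrite linearP IH addr0; apply/eqP; rewrite scaler_eq0; apply/orP; right; apply/eqP.
have [ws1 [ws2 [-> e1 e2]]] := map_size_cat e.
case: ws2 e2 => [|t [|u ws2]] //= [ta ub _].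
rewrite map_cat -tcatE -[size sh1]addn0 /at2 at_shift; last first.
  by rewrite -e1 size_map -(size_map (@word K V)); apply: homog_word.
by rewrite -/(at2 f) at2_0w hf // tcat0l tcat0r.
Qed.

Lemma homog_shapes w : lspan (fun x => exists2 ws, size ws = size w &
  x = word (map (@word K V) ws)) (word w).
Proof.
elim: w => [|a w IH]; first by apply: lspan_gen; exists [::].
rewrite -[word _](tcatE [:: a]).
have ha : lspan (fun x : T => exists t, x = word t) a.
  elim/pmod_ind: a => [|c t x hx]; first exact: lspan0.
  by apply: lspanD hx; exists t.
have h1 : lspan (fun x : talg T => exists t : seq V, x = word [:: word t]) (inj1 a).
  apply: lspan_map ha => _ [t ->]; apply: lspan_gen; by exists t.
apply: pair_lspan h1 IH => _ _ [t ->] [ws e ->]; apply: lspan_gen.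
by exists (t :: ws); rewrite /= ?e // tcatE.
Qed.

Lemma local_eq_words n m m' F G : local n m F -> local n m' G ->
  (forall i (w : seq T), (size w < i + n)%N -> F i (word w) = G i (word w)) ->
  (forall ws, size ws = n ->
     F 0 (word (map (@word K V) ws)) = G 0 (word (map (@word K V) ws))) ->
  forall i X, F i X = G i X.
Proof.
move=> LF LG small base; apply: (local_eq LF LG small) => w wn.
case: LF => F1 _ _ _; case: LG => G1 _ _ _.
apply: (linear_eq_lspan (F1 0) (G1 0) _ (homog_shapes w)) => _ [ws e ->].
by apply: base; rewrite e.
Qed.

Lemma local_eq_shaped n m m' F G : local n m F -> local n m' G ->
  (forall i (w : seq T), (size w < i + n)%N -> F i (word w) = G i (word w)) ->
  (forall sh X, size sh = n -> shaped sh X -> F 0 X = G 0 X) ->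
  forall i X, F i X = G i X.
Proof.
move=> LF LG small base; apply: (local_eq_words LF LG small) => ws wn.
by apply: (base (map size ws)); [rewrite size_map | apply: shaped_word].
Qed.

Definition lett2 := tensmap (@inj1 K V) (@inj1 K V).
Definition lett3 := tensmap lett2 (@inj1 K V).

Lemma lett3_unassoc a z : lett3 (unassoc V V V (a ⊠ z)) = unassoc T T T (inj1 a ⊠ lett2 z).
Proof.
have [L1 L2] := tpair_bilin V (V ⊗ V); have [N1 N2] := tpair_bilin T (T ⊗ T).
move: z; apply: tens_fext => [c x y|c x y|b c].
- by rewrite L2 !linearP.
- by rewrite linearP N2 linearP.
by rewrite unassocE /lett3 /lett2 !tensmapE unassocE.
Qed.

Lemma lett3_assoc z : assoc T T T (lett3 z) =
  tensmap (@inj1 K V) lett2 (assoc V V V z).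
Proof.
move: z; apply: tens3_fext => [x y z|x y z|a b c]; rewrite ?linearP //.
by rewrite /lett3 /lett2 !tensmapE !assocE !tensmapE.
Qed.

Section BraidLetters.
Variables (s : {linear V ⊗ V -> V ⊗ V}) (sP : braiding s).

Lemma op1_lett3 z : op1 (beta s) (lett3 z) = lett3 (op1 s z).
Proof.
move: z; apply: tens_fext => [x y z|x y z|z c]; rewrite ?linearP //.
by rewrite /op1 /lett3 !tensmapE /lett2 beta_letters.
Qed.

Lemma op2_lett3 z : op2 (beta s) (lett3 z) = lett3 (op2 s z).
Proof.
move: z; apply: tens3_fext => [x y z|x y z|a b c]; rewrite ?linearP //.
rewrite op2E lett3_unassoc /lett3 /lett2 !tensmapE op2E -[inj1 b ⊠ _]tensmapE.
by rewrite beta_letters.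
Qed.

End BraidLetters.

Lemma letters2_eq m m' F G rest X : local 2 m F -> local 2 m' G ->
  (forall z, F 0 (inj2 T (lett2 z)) = G 0 (inj2 T (lett2 z))) ->
  shaped (1 :: 1 :: rest)%N X -> F 0 X = G 0 X.
Proof.
move=> [F1 _ _ F5] [G1 _ _ G5] h.
move=> hX; apply: (linear_eq_lspan (F1 0) (G1 0) _ hX) => _ [ws e ->].
case: ws e => [|[|x [|? ?]] [|[|y [|? ?]] ws]] // _.
have e : word (map (@word K V) ([:: x] :: [:: y] :: ws)) =
    inj2 T (lett2 (x ⊠ y)) ** word (map (@word K V) ws).
  by rewrite /lett2 tensmapE inj2E tcatE.
by rewrite e F5 ?G5 ?h //; apply: homog_inj2.
Qed.

Lemma letters3_eq m m' F G rest X : local 3 m F -> local 3 m' G ->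
  (forall z, F 0 (inj3 (lett3 z)) = G 0 (inj3 (lett3 z))) ->
  shaped (1 :: 1 :: 1 :: rest)%N X -> F 0 X = G 0 X.
Proof.
move=> [F1 _ _ F5] [G1 _ _ G5] h.
move=> hX; apply: (linear_eq_lspan (F1 0) (G1 0) _ hX).
move=> _ [ws e ->]; case: ws e => [|[|x [|? ?]] [|[|y [|? ?]] [|[|z [|? ?]] ws]]] // _.
have e : word (map (@word K V) ([:: x] :: [:: y] :: [:: z] :: ws)) =
    inj3 (lett3 (x ⊠ y ⊠ z)) ** word (map (@word K V) ws).
  by rewrite /lett3 /lett2 !tensmapE inj3E inj2E !tcatE.
by rewrite e F5 ?G5 ?h //; apply: homog_inj3.
Qed.

End Induction.

(** * The braiding of the tensor algebra *)

Section Far.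
Variables (K : fieldType) (A : lmodType K).
Implicit Types (s : {linear A ⊗ A -> A ⊗ A}) (m : {linear A ⊗ A -> A}).

Lemma local_id n : local n n (fun _ => id : talg A -> talg A).
Proof. by split. Qed.

Lemma braid_braid_far s s' : far2 (Z := talg A) (braid_at s) (braid_at s').
Proof. by move=> i j X; exact: at2_braid. Qed.

Lemma braid_mul_far s m : far2 (Z := talg A) (braid_at s) (mul_at m).
Proof. by move=> i j X; exact: at2_braid. Qed.

Lemma mul_braid_far s m : far1 (Z := talg A) (mul_at m) (braid_at s).
Proof. by move=> i j X; exact: at2_mul. Qed.

Lemma mul_mul_far m m' : far1 (Z := talg A) (mul_at m) (mul_at m').
Proof. by move=> i j X; exact: at2_mul. Qed.

Lemma braid_ins s e i j X : (i <= j)%N ->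
  braid_at s j.+1 (ins e i X) = ins e i (braid_at s j X).
Proof. exact: at2_ins. Qed.

Lemma mul_ins m e i j X : (i <= j)%N ->
  mul_at m j.+1 (ins e i X) = ins e i (mul_at m j X).
Proof. exact: at2_ins. Qed.

End Far.

Section BetaBraiding.
Variables (K : fieldType) (V : lmodType K) (s : {linear V ⊗ V -> V ⊗ V}).
Local Notation T := (talg V).
Local Notation B := (braid_at (beta s)).
Local Notation C := (mul_at (@app K V)).
Local Notation U := (ins (word [::] : T)).

Lemma beta_unit : braid_unit (beta s) (word [::]).
Proof.
have [L1 L2] := tpair_bilin T T.
move=> x; split; move: x; apply: linear_eq_words => [a x y|a x y|w].
- by rewrite L2 linearP.
- by rewrite L1.
- exact: beta_0word.
- by rewrite L1 linearP.
- by rewrite L2.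
- exact: beta_word0.
Qed.

Lemma beta_ins_l sh i X : shaped sh X -> (i < size sh)%N -> B i (U i X) = U i.+1 X.
Proof. by move=> /shaped_homog; apply: braid_ins_l; exact: beta_unit. Qed.

Lemma beta_ins_r sh i X : shaped sh X -> (i < size sh)%N -> B i (U i.+1 X) = U i X.
Proof. by move=> /shaped_homog; apply: braid_ins_r; exact: beta_unit. Qed.

Hypothesis sP : braiding s.

Lemma yb_local_l : local 3 3 (fun i X => B i (B i.+1 (B i X))).
Proof.
exact: local_comp (local_comp (local_braid (beta s) 0 1) (local_braid (beta s) 1 0))
  (local_braid (beta s) 0 1).
Qed.

Lemma yb_local_r : local 3 3 (fun i X => B i.+1 (B i (B i.+1 X))).
Proof.
exact: local_comp (local_comp (local_braid (beta s) 1 0) (local_braid (beta s) 0 1))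
  (local_braid (beta s) 1 0).
Qed.

(** By induction on the total size: a slot with at least two letters is cut into a word
    and a letter, everything slides past an empty slot, and for three letters this is the
    Yang-Baxter equation of [s]. *)
Lemma beta_yb_shaped d a b c rest X : (a + b + c < d)%N -> shaped [:: a, b, c & rest] X ->
  B 0 (B 1 (B 0 X)) = B 1 (B 0 (B 1 X)).
Proof.
have BB := @braid_braid_far _ _ (beta s) (beta s).
have BC := @braid_mul_far _ _ (beta s) (@app K V).
have CB := @mul_braid_far _ _ (beta s) (@app K V).
have Cl := beta_slidel sP; have Cr := beta_slider sP.
elim: d a b c rest X => // d IH a b c rest X abc hX.
have yb1 e a' b' c' rest' Y : (a' + b' + c' < d)%N -> shaped [:: e, a', b', c' & rest'] Y ->
    B 1 (B 2 (B 1 Y)) = B 2 (B 1 (B 2 Y)).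
  move=> lt; apply: (shaped_shift yb_local_l yb_local_r) => Z.
  exact: IH lt.
case: a abc hX => [|[|a]] abc hX.
- have [Y hY ->] := @shaped_ins_inv _ _ [::] [:: b, c & rest] X hX.
  have hBY := shaped_beta s (sh1 := [::]) hY.
  rewrite (beta_ins_l hY) // (beta_ins_l (i := 1) hY) // braid_ins // (beta_ins_l hBY) // (beta_ins_l (i := 1) hBY) //.
  by rewrite ins_braid.
- case: b abc hX => [|[|b]] abc hX.
  + have [Y hY ->] := @shaped_ins_inv _ _ [:: 1%N] [:: c & rest] X hX.
    have hBY := shaped_beta s (sh1 := [::]) hY.
    rewrite (beta_ins_r hY) // (beta_ins_l (i := 1) hY) // braid_ins // (beta_ins_l hBY) //.
    by rewrite -ins_braid // (beta_ins_r (i := 1) hBY).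
  + case: c abc hX => [|[|c]] abc hX.
    * have [Y hY ->] := @shaped_ins_inv _ _ [:: 1; 1]%N rest X hX.
      have hBY := shaped_beta s (sh1 := [::]) hY.
      rewrite -ins_braid // (beta_ins_r (i := 1) hY) // (beta_ins_r (i := 1) hBY) //.
      by rewrite (beta_ins_r hBY) // (beta_ins_r hY) // braid_ins.
    * apply: (letters3_eq yb_local_l yb_local_r) hX => z.
      rewrite !(braid_at_0t, braid_at_1t, op1_lett3 sP, op2_lett3 sP).
      exact: (congr1 (fun z => inj3 (lett3 V z)) (sP.2 z)).
    have [Y hY ->] := @shaped_app_inv _ _ [:: 1; 1]%N c.+1 rest X hX.
    have h0 := shaped_beta s (sh1 := [::]) (shaped_beta s (sh1 := [:: 1%N]) hY).
    apply: (yb_step2 _ _ _ BB BC CB Cr); first by apply: IH hY; lia.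
    by apply: yb1 h0; lia.
  have [Y hY ->] := @shaped_app_inv _ _ [:: 1]%N b.+1 [:: c & rest] X hX.
  have h0 := shaped_beta s (sh1 := [::]) hY.
  have h2 := shaped_beta s (sh1 := [:: _; _]) hY.
  apply: (yb_step1 _ _ _ BB BC CB Cl Cr); first by apply: yb1 h0; lia.
  by apply: IH h2; lia.
have [Y hY ->] := @shaped_app_inv _ _ [::] a.+1 [:: b, c & rest] X hX.
have h2 := shaped_beta s (sh1 := [:: _; _]) (shaped_beta s (sh1 := [:: _]) hY).
apply: (yb_step0 _ _ _ BB BC CB Cl); first by apply: yb1 hY; lia.
by apply: IH h2; lia.
Qed.

Lemma beta_yb : yang_baxter (Z := talg T) B.
Proof.
apply: (local_eq_shaped yb_local_l yb_local_r).
  move=> i w wi; have hw := homog_word w.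
  have z X : homog (size w) X -> B i.+1 X = 0.
    by move=> hX; apply: at2_small hX _; lia.
  by rewrite !z ?linear0 //; [exact: lspan0 | exact: homog_braid_at].
move=> [|a [|b [|c [|? ?]]]] X // _ hX.
exact: (@beta_yb_shaped (a + b + c).+1 a b c [::]).
Qed.

End BetaBraiding.

Section BetaInverse.
Variables (K : fieldType) (V : lmodType K) (s s' : {linear V ⊗ V -> V ⊗ V}).
Local Notation T := (talg V).
Local Notation B := (braid_at (beta s)).
Local Notation B' := (braid_at (beta s')).
Local Notation C := (mul_at (@app K V)).
Local Notation U := (ins (word [::] : T)).
Hypotheses (sP : braiding s) (sP' : braiding s') (sK : cancel s s').

Lemma beta_cancel_local : local 2 2 (fun i X => B' i (B i X)).
Proof. exact: local_comp (local_braid (beta s) 0 0) (local_braid (beta s') 0 0). Qed.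

(** Both [beta s] and [beta s'] slide past concatenation, so it suffices that they are
    inverse to each other on letters. *)
Lemma beta_cancel_shaped d a b rest X : (a + b < d)%N -> shaped [:: a, b & rest] X ->
  B' 0 (B 0 X) = X.
Proof.
have Cl := beta_slidel sP; have Cr := beta_slider sP.
have Cl' := beta_slidel sP'; have Cr' := beta_slider sP'.
elim: d a b rest X => // d IH a b rest X ab hX.
have inv1 e a' b' rest' Y : (a' + b' < d)%N -> shaped [:: e, a', b' & rest'] Y ->
    B' 1 (B 1 Y) = Y.
  move=> lt; apply: (shaped_shift beta_cancel_local (local_id T 2)) => Z.
  exact: IH lt.
case: a ab hX => [|[|a]] ab hX.
- have [Y hY ->] := @shaped_ins_inv _ _ [::] [:: b & rest] X hX.
  by rewrite (beta_ins_l _ hY) // (beta_ins_r _ hY).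
- case: b ab hX => [|[|b]] ab hX.
  + have [Y hY ->] := @shaped_ins_inv _ _ [:: 1%N] rest X hX.
    by rewrite (beta_ins_r _ hY) // (beta_ins_l _ hY).
  + apply: (letters2_eq beta_cancel_local (local_id T 2)) hX => z.
    have sV w : beta s (lett2 V w) = lett2 V (s w) by exact: beta_letters.
    have sV' w : beta s' (lett2 V w) = lett2 V (s' w) by exact: beta_letters.
    rewrite /braid_at !at2_0z -[LHS]/(inj2 T (beta s' (beta s (lett2 V z)))).
    by rewrite sV sV' sK.
  have [Y hY ->] := @shaped_app_inv _ _ [:: 1%N] b.+1 rest X hX.
  have h0 := shaped_beta s (sh1 := [::]) hY.
  apply: (inverse_step1 _ _ _ _ Cr Cl'); first by apply: inv1 h0; lia.
  by apply: IH hY; lia.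
have [Y hY ->] := @shaped_app_inv _ _ [::] a.+1 [:: b & rest] X hX.
have h1 := shaped_beta s (sh1 := [:: _]) hY.
apply: (inverse_step0 _ _ _ _ Cl Cr'); first by apply: IH h1; lia.
by apply: inv1 hY; lia.
Qed.

Lemma beta_cancel : cancel (beta s) (beta s').
Proof.
apply: ttalg_ext (beta s' \o beta s : {linear _ -> _}) idfun _ => t u.
apply: inj2_inj; rewrite -[LHS]/(inj2 T (beta s' (beta s (word t ⊠ word u)))).
have h : shaped [:: size t; size u] (inj2 T (word t ⊠ word u)).
  by rewrite inj2E; apply: (shaped_word [:: t; u]).
have := beta_cancel_shaped (ltnSn _) h.
by rewrite /braid_at !at2_0z.
Qed.

End BetaInverse.

Section BetaBijective.
Variables (K : fieldType) (V : lmodType K) (s : {linear V ⊗ V -> V ⊗ V}).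
Hypothesis sP : braiding s.

Lemma beta_bijective : bijective (beta s).
Proof.
have [g sK gK] := sP.1.
have lg : linear g.
  by move=> a x y; apply: (can_inj sK); rewrite gK linearP !gK.
pose gL := GRing.isLinear.Build K (V ⊗ V) (V ⊗ V) _ g lg.
pose s' : {linear V ⊗ V -> V ⊗ V} := HB.pack g gL.
have s'E : s' =1 g by [].
have o1 z : op1 s (op1 s' z) = z.
  move: z; apply: tens_fext => [a x y|a x y|p c]; rewrite ?linearP //.
  by rewrite /op1 !tensmapE s'E gK.
have o2 z : op2 s (op2 s' z) = z.
  move: z; apply: tens3_fext => [x y z|x y z|a b c]; rewrite ?linearP //.
  apply: inj3_inj; rewrite -braid_at_1t -braid_at_1t inj3E inj2E tcatE.
  rewrite -[word _](tcatE [:: a] [:: b; c]) /braid_at /at2 !at_cons -!/(at2 _).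
  by rewrite -inj2E !at2_0z; congr (_ ** inj2 _ _); exact: gK.
have o1' : injective (op1 s).
  move=> x y e; have k z : op1 s' (op1 s z) = z.
    move: z; apply: tens_fext => [a x' y'|a x' y'|p c]; rewrite ?linearP //.
    by rewrite /op1 !tensmapE s'E sK.
  by rewrite -(k x) e k.
have o2' : injective (op2 s).
  move=> x y e; have k z : op2 s' (op2 s z) = z.
    move: z; apply: tens3_fext => [x' y' z|x' y' z|a b c]; rewrite ?linearP //.
    apply: inj3_inj; rewrite -braid_at_1t -braid_at_1t inj3E inj2E tcatE.
    rewrite -[word _](tcatE [:: a] [:: b; c]) /braid_at /at2 !at_cons -!/(at2 _).
    by rewrite -inj2E !at2_0z; congr (_ ** inj2 _ _); exact: sK.
  by rewrite -(k x) e k.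
have sP' : braiding s'.
  split; first by exists s.
  move=> z; rewrite -[LHS]/(op1 s' (op2 s' (op1 s' z))) -[RHS]/(op2 s' (op1 s' (op2 s' z))).
  apply/o1'/o2'/o1'; rewrite o1 o2 o1.
  have := sP.2 (op2 s' (op1 s' (op2 s' z))).
  rewrite -[X in X = _]/(op1 s (op2 s (op1 s _))) -[X in _ = X]/(op2 s (op1 s (op2 s _))).
  by rewrite o2 o1 o2.
exists (beta s'); first exact: beta_cancel.
exact: beta_cancel.
Qed.

Lemma beta_braiding : braiding (beta s).
Proof.
split; first exact: beta_bijective.
move=> z; apply: inj3_inj.
rewrite -[X in inj3 X = _]/(op1 (beta s) (op2 (beta s) (op1 (beta s) z))).
rewrite -[X in _ = inj3 X]/(op2 (beta s) (op1 (beta s) (op2 (beta s) z))).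
have := beta_yb sP 0 (inj3 z).
by rewrite !(braid_at_0t, braid_at_1t).
Qed.

End BetaBijective.

(** * Recursion for the product *)

Section JoinRecursion.
Variables (K : fieldType) (V : lmodType K) (s : {linear V ⊗ V -> V ⊗ V}).
Variable m : {linear V ⊗ V -> V}.
Local Notation T := (talg V).
Local Notation cop := (cop_beta s).
Local Notation iter_cop := (cop_beta_iter s).

Definition Mletter (z : T ⊗ T) : T := inj1 (Mmap m z).
Lemma Mletter_linear : linear Mletter.
Proof. by move=> a x y; rewrite /Mletter !linearP. Qed.
HB.instance Definition _ :=
  GRing.isLinear.Build K (T ⊗ T) (talg V) _ Mletter Mletter_linear.

Lemma head_catl n (X Y : talg (T ⊗ T)) : homog n.+1 X ->
  apply_head cop (X ** Y) = apply_head cop X ** Y.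
Proof.
move=> hX; apply: (@linear_eq_lspan _ _ _ _ (fun X => apply_head cop (X ** Y))
  (fun X => apply_head cop X ** Y) _ _ _ _ hX).
- by move=> a x y; rewrite tcatl linearP.
- by move=> a x y; rewrite linearP tcatl.
move=> _ [[|a w] // _ ->]; move: Y; apply: linear_eq_words => [b x y|b x y|v].
- by rewrite tcatr linearP.
- by rewrite tcatr.
by rewrite tcatE /apply_head !wliftE /= -tcatA tcatE.
Qed.

Lemma homog_iter n z : homog n.+1 (iter_cop n z).
Proof.
elim: n => [|n IH]; first exact: homog_inj1.
rewrite -[iter_cop _ _]/(apply_head cop (iter_cop n z)).
apply: lspan_map IH => _ [[|a w] // [wn] ->].
rewrite /apply_head wliftE /=; apply: (@homog_cat _ _ 2 n); first exact: homog_inj2.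
exact: homog_wordE.
Qed.

(** The iterated coproduct splits the first factor again and again. Singling out the
    very first splitting fixes the last factor, which is why the recursion below yields the
    last letter of a product. *)
Lemma cop_beta_iterSr n z :
  iter_cop n.+1 z = tcat _ (tensmap (iter_cop n) (@inj1 K (T ⊗ T)) (cop z)).
Proof.
elim: n => [|n IH].
  rewrite -[LHS]/(apply_head cop (word [:: z])) /apply_head wliftE.
  rewrite -[LHS]/(inj2 (T ⊗ T) (cop z) ** word [::]) tcat1.
  move: (cop z); apply: tens_fext => [a x y|a x y|p q]; rewrite ?linearP //.
  by rewrite inj2E tensmapE tcatE.
rewrite -[LHS]/(apply_head cop (iter_cop n.+1 z)) IH.
move: (cop z); apply: tens_fext => [a x y|a x y|p q]; rewrite ?linearP //.
rewrite !tensmapE (head_catl _ (homog_iter n p)); congr (_ ** _).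
Qed.

Lemma talgmap_cat (A A' : lmodType K) (f : {linear A -> A'}) (x y : talg A) :
  talgmap f (x ** y) = talgmap f x ** talgmap f y.
Proof.
move: x; apply: linear_eq_words => [a x x'|a x x'|w].
- by rewrite tcatl linearP.
- by rewrite linearP tcatl.
move: y; apply: linear_eq_words => [a x x'|a x x'|w'].
- by rewrite tcatr linearP.
- by rewrite linearP tcatr.
by rewrite tcatE !talgmapE tcatE map_cat.
Qed.

Lemma join_term1 z : join_term s m 1 z = Mletter z.
Proof. exact: talgmapE. Qed.

Lemma join_termS n z :
  join_term s m n.+2 z = tcat V (tensmap (join_term s m n.+1) Mletter (cop z)).
Proof.
rewrite -[LHS]/(talgmap (Mmap m) (iter_cop n.+1 z)) cop_beta_iterSr.
move: (cop z); apply: tens_fext => [a x y|a x y|p q]; rewrite ?linearP //.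
by rewrite !tensmapE talgmap_cat; congr (_ ** _); exact: talgmapE.
Qed.

(** The contribution, under [f ⊗ M], of the splitting that keeps [a] on the far left and
    [d] on the far right; [y] stands for the braided middle factors. *)
Definition cop_term (f : {linear T ⊗ T -> T}) (a d : T) (y : T ⊗ T) : T :=
  tcat V (tensmap f Mletter (unassoc T T (T ⊗ T) (a ⊠ assoc T T T (y ⊠ d)))).

Lemma cop_term_linear f a d : linear (cop_term f a d).
Proof.
move=> c x y; rewrite /cop_term (tpair_bilin _ _).1 linearP (tpair_bilin _ _).2.
by rewrite !linearP.
Qed.

Lemma cop_termE f a d v w : cop_term f a d (v ⊠ w) = f (a ⊠ v) ** Mletter (w ⊠ d).
Proof. by rewrite /cop_term assocE unassocE tensmapE. Qed.

Lemma cop_sum f t u : tcat V (tensmap f Mletter (cop (word t ⊠ word u))) =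
  \sum_(i < (size t).+1) \sum_(j < (size u).+1)
    cop_term f (word (take i t)) (word (drop j u))
      (beta s (word (drop i t) ⊠ word (take j u))).
Proof.
rewrite -[cop _]/(tens_interchange (beta s) (tensmap (delta V) (delta V) (word t ⊠ word u))).
rewrite tensmapE /delta !wliftE !big_mkord.
have [B1 B2] := tpair_bilin (T ⊗ T) (T ⊗ T).
rewrite (linear_big_sum (B1 _)) !linear_sum; apply: eq_bigr => i _.
rewrite (linear_big_sum (B2 _)) !linear_sum; apply: eq_bigr => j _.
by rewrite tens_interchangeE.
Qed.

Lemma eps2_word t u : eps2 V (word t ⊠ word u) =
  ((nilp t)%:R * (nilp u)%:R : K) *: word [::].
Proof. by rewrite /eps2 tliftE /eps !wliftE. Qed.

Lemma Mletter_word t u : Mletter (word t ⊠ word u) = inj1 (M_word m t u).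
Proof. by rewrite /Mletter /Mmap wlift2E. Qed.

(** The braiding exchanges the sizes of the middle words, so that the vanishing of a
    summand can be tested on words. *)
Lemma cop_term_beta0 (f : {linear T ⊗ T -> T}) a b c d :
  (forall v w, size v = size c -> size w = size b ->
     f (word a ⊠ word v) ** Mletter (word w ⊠ word d) = 0) ->
  cop_term f (word a) (word d) (beta s (word b ⊠ word c)) = 0.
Proof.
move=> h; apply: (@linear_eq_lspan _ _ _ _ (cop_term f (word a) (word d)) (fun=> 0) _ _ _ _
  (bihomog_beta s b c)).
- exact: cop_term_linear.
- by move=> k x y; rewrite scaler0 addr0.
by move=> _ [v [w [vc wb ->]]]; rewrite cop_termE h.
Qed.

Lemma counit_Mletter z : tcat V (tensmap (eps2 V) Mletter (cop z)) = Mletter z.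
Proof.
rewrite -[LHS]/((tcat V \o tensmap (eps2 V) Mletter \o cop) z).
rewrite -[RHS]/((Mletter : {linear _ -> _}) z).
move: z; apply: ttalg_ext => t u.
rewrite -[LHS]/(tcat V (tensmap (eps2 V) Mletter (cop (word t ⊠ word u)))) cop_sum.
rewrite big_ord_recl big_ord_recl !big1 ?addr0 /=.
- by rewrite take0 drop0 take0 drop0 beta_word0 cop_termE eps2_word /= mulr1 scale1r tcat1l.
- move=> i _; rewrite big1 // => j _; apply: cop_term_beta0 => v w _ _.
  rewrite eps2_word [nilp (take _ _)](_ : _ = false) ?mul0r ?scale0r ?tcat0l //.
  by rewrite /nilp size_takel //; exact: ltn_ord.
- move=> j _; apply: cop_term_beta0 => v w vs _.
  rewrite eps2_word [nilp v](_ : _ = false) ?mulr0 ?scale0r ?tcat0l //.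
  by rewrite /nilp vs size_takel //; exact: ltn_ord.
Qed.

(** Finitely many pure tensors occur in [Y], hence one truncation of the series [join]
    serves for all of them. *)
Lemma join_partial (Y : (T ⊗ T) ⊗ (T ⊗ T)) : exists N, forall N', (N <= N')%N ->
  tcat V (tensmap (join s m) Mletter Y) = tcat V (tensmap (eps2 V) Mletter Y) +
    \sum_(1 <= n < N') tcat V (tensmap (join_term s m n) Mletter Y).
Proof.
move: Y; apply: pmod_ind => [|c [p q] x [N hN]].
  by exists 0 => N' _; rewrite !linear0 big1 ?addr0 // => n _; rewrite !linear0.
have [N1 hN1] := join_funE s m p; exists (N + N1)%N => N' hN'.
rewrite -/(tpair p q) !linearP (hN N') ?tensmapE; last by lia.
rewrite -[join s m p]/(join_fun s m p) (hN1 N'); last by lia.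
have e : (eps2 V p + \sum_(1 <= n < N') join_term s m n p) ** Mletter q =
  eps2 V p ** Mletter q + \sum_(1 <= n < N') join_term s m n p ** Mletter q.
  rewrite -{1}[eps2 V p]scale1r tcatl scale1r; congr (_ + _).
  exact: (linear_big_sum (@tcatl _ _ (Mletter q))).
rewrite e scalerDr addrACA; congr (_ + _).
rewrite scaler_sumr -big_split; apply: eq_bigr => n _.
by rewrite !linearP tensmapE.
Qed.

(** Splitting off the last factor turns the term of index [n + 2] of the series into that
    of index [n + 1], and that of index [1], by the counit property, into [ε ⊗ ε]. *)
Lemma join_rec z :
  join s m z = eps2 V z + tcat V (tensmap (join s m) Mletter (cop z)).
Proof.
have [N hN] := join_funE s m z; have [N1 hN1] := join_partial (cop z).
rewrite -[join s m z]/(join_fun s m z) (hN (N + N1).+2); last by lia.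
congr (_ + _); rewrite (hN1 (N + N1).+1); last by lia.
rewrite big_nat_recl // join_term1 counit_Mletter; congr (_ + _).
by apply: eq_big_nat => -[|n] // _; rewrite join_termS.
Qed.

Lemma join_words t u : join s m (word t ⊠ word u) =
  ((nilp t)%:R * (nilp u)%:R : K) *: word [::] +
  \sum_(i < (size t).+1) \sum_(j < (size u).+1)
    cop_term (join s m) (word (take i t)) (word (drop j u))
      (beta s (word (drop i t) ⊠ word (take j u))).
Proof. by rewrite join_rec eps2_word cop_sum. Qed.

Lemma cop_term0 f a c : cop_term f (word a) (word [::]) (beta s (word [::] ⊠ word c)) = 0.
Proof. by rewrite beta_0word cop_termE Mletter_word linear0 tcat0r. Qed.

Lemma cop_term_l f a b c d : (1 < size b)%N ->
  cop_term f (word a) (word d) (beta s (word b ⊠ word c)) = 0.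
Proof.
move=> b2; apply: cop_term_beta0 => v w _ wb; rewrite Mletter_word.
by move: b2; rewrite -wb; case: w {wb} => [|x [|x' w]] //= _; rewrite linear0 tcat0r.
Qed.

Lemma cop_term_r f a b c d : (1 < size d)%N ->
  cop_term f (word a) (word d) (beta s (word b ⊠ word c)) = 0.
Proof.
move=> d2; apply: cop_term_beta0 => v w _ _; rewrite Mletter_word.
have -> : M_word m w d = 0 by case: d d2 => [|y [|y' d]] //= _; case: w => [|x [|x' w]].
by rewrite linear0 tcat0r.
Qed.

Lemma join_unit_l (x : T) : join s m (word [::] ⊠ x) = x.
Proof.
have [L1 L2] := tpair_bilin T T.
move: x; apply: linear_eq_words => [a x y|//|u]; first by rewrite L2 linearP.
elim/last_ind: u => [|u y IH]; rewrite join_words big_ord1.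
  by rewrite big_ord1 cop_term0 addr0 mulr1 scale1r.
rewrite size_rcons !big_ord_recr /= big1 ?add0r => [|j _]; last first.
  by apply: cop_term_r; rewrite size_drop size_rcons; have := ltn_ord j; lia.
rewrite [drop (size u).+1 _]drop_oversize ?size_rcons // cop_term0 addr0.
have -> : nilp (rcons u y) = false by case: (u).
rewrite mulr0 scale0r add0r -cats1 take_size_cat // drop_size_cat //.
by rewrite beta_0word cop_termE Mletter_word IH tcatE.
Qed.

Lemma join_unit_r (x : T) : join s m (x ⊠ word [::]) = x.
Proof.
have [L1 L2] := tpair_bilin T T.
move: x; apply: linear_eq_words => [a x y|//|t]; first by rewrite L1 linearP.
elim/last_ind: t => [|t x IH]; rewrite join_words; first by
  rewrite !big_ord1 cop_term0 addr0 mulr1 scale1r.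
rewrite size_rcons !big_ord_recr /= big1 ?add0r => [|i _]; last first.
  rewrite big_ord1; apply: cop_term_l; rewrite size_drop size_rcons.
  by have := ltn_ord i; lia.
rewrite !big_ord0 !add0r /= [drop (size t).+1 _]drop_oversize ?size_rcons // cop_term0 addr0.
have -> : nilp (rcons t x) = false by case: (t).
rewrite mul0r scale0r add0r -cats1 take_size_cat // drop_size_cat //.
by rewrite beta_word0 cop_termE Mletter_word IH tcatE.
Qed.

Lemma join_unit : unit_of (join s m) (word [::]).
Proof. by move=> x; split; [apply: join_unit_l | apply: join_unit_r]. Qed.

(** [M] leaves only the splittings that cut off at most one letter from each word, and at
    least one letter in all. *)
Lemma join_rcons t x u y :
  join s m (word (rcons t x) ⊠ word (rcons u y)) =
  join s m (word (rcons t x) ⊠ word u) ** word [:: y] +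
  cop_term (join s m) (word t) (word [::]) (beta s (word [:: x] ⊠ word (rcons u y))) +
  cop_term (join s m) (word t) (word [:: y]) (beta s (word [:: x] ⊠ word u)).
Proof.
rewrite join_words.
have -> : nilp (rcons t x) = false by case: (t).
rewrite mul0r scale0r add0r !size_rcons big_ord_recr big_ord_recr /=.
rewrite big1 ?add0r => [|i _]; last first.
  rewrite big1 // => j _; apply: cop_term_l; rewrite size_drop size_rcons.
  by have := ltn_ord i; lia.
rewrite ![\sum_(j < (size u).+2) _]big_ord_recr /=.
rewrite ![\sum_(j < (size u).+1) _]big_ord_recr /=.
rewrite !big1 ?add0r => [|j _|j _]; try by
  apply: cop_term_r; rewrite size_drop size_rcons; have := ltn_ord j; lia.
rewrite ![drop (size u).+1 _]drop_oversize ?size_rcons //.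
rewrite [drop (size t).+1 _]drop_oversize ?size_rcons // cop_term0 addr0.
rewrite ![take _.+1 _]take_oversize ?size_rcons //.
rewrite -!cats1 !take_size_cat // !drop_size_cat //.
rewrite beta_0word cop_termE Mletter_word /= -[inj1 y]/(word [:: y]).
by rewrite addrC -addrA; congr (_ + _); rewrite addrC.
Qed.

End JoinRecursion.

(** * The product of two letters *)

Section Letters.
Variables (K : fieldType) (V : lmodType K) (m : {linear V ⊗ V -> V}).
Local Notation T := (talg V).

(** [m] on letters, extended by zero: in this form the conditions on [m] become relations
    between operators on all words of tensors. *)
Definition lmul (z : T ⊗ T) : T := inj1 (m (tensmap (pr1 V) (pr1 V) z)).
Lemma lmul_linear : linear lmul.
Proof. by move=> a x y; rewrite /lmul !linearP. Qed.
HB.instance Definition _ := GRing.isLinear.Build K (T ⊗ T) (talg V) _ lmul lmul_linear.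

Local Notation N := (mul_at lmul).
Local Notation C := (mul_at (@app K V)).

Lemma lmulE x y : lmul (x ⊠ y) = inj1 (m (pr1 V x ⊠ pr1 V y)).
Proof. by rewrite /lmul tensmapE. Qed.

Lemma pr1_0 w : size w != 1 -> pr1 V (word w) = 0.
Proof. by rewrite pr1_word; case: w => [|x [|y w]]. Qed.

Lemma lmul0l t y : size t != 1 -> lmul (word t ⊠ y) = 0.
Proof. by move=> t1; rewrite lmulE pr1_0 // tpair0l !linear0. Qed.

Lemma lmul0r x u : size u != 1 -> lmul (x ⊠ word u) = 0.
Proof. by move=> u1; rewrite lmulE (pr1_0 u1) tpair0r !linear0. Qed.

Lemma lmul_lett2 z : lmul (lett2 V z) = inj1 (m z).
Proof.
move: z; apply: tens_fext => [a x y|a x y|x y]; rewrite ?linearP //.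
by rewrite /lett2 tensmapE lmulE /pr1 !on1E.
Qed.

Lemma shaped_lmul sh1 sh2 X : shaped (sh1 ++ [:: 1, 1 & sh2])%N X ->
  shaped (sh1 ++ 1%N :: sh2) (N (size sh1) X).
Proof.
apply: (@shaped_at2 _ _ _ _ _ _ _ [:: 1%N]) => t u _ _.
rewrite -[X in shaped _ X]/(inj1 (lmul _)) lmulE; exact: (shaped_word [:: [:: _]]).
Qed.

Lemma shaped_lmul0 sh1 a b sh2 X : (a != 1) || (b != 1) ->
  shaped (sh1 ++ [:: a, b & sh2])%N X -> N (size sh1) X = 0.
Proof.
move=> ab; apply: shaped_at2_0 => t u ta ub.
rewrite -[LHS]/(inj1 (lmul _)).
rewrite -ta -ub in ab; case/orP: ab => h; first by rewrite lmul0l // linear0.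
by rewrite lmul0r // linear0.
Qed.

Lemma lmul0_lett3 z : N 0 (inj3 (lett3 V z)) = inj2 T (lett2 V (tensmap m idfun z)).
Proof.
rewrite mul_at_0t; congr (inj2 T _); move: z.
apply: tens_fext => [a x y|a x y|p c]; rewrite ?linearP //.
by rewrite /lett3 /lett2 !tensmapE -[X in X ⊠ _]/(lmul _) lmul_lett2.
Qed.

Lemma lmul1_lett3 z :
  N 1 (inj3 (lett3 V z)) = inj2 T (lett2 V (tensmap idfun m (assoc V V V z))).
Proof.
rewrite mul_at_1t; congr (inj2 T _); rewrite lett3_assoc; move: (assoc _ _ _ z).
apply: tens_fext => [a x y|a x y|a p]; rewrite ?linearP //.
by rewrite /lett2 !tensmapE -[X in _ ⊠ X]/(lmul _) lmul_lett2.
Qed.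

Lemma lmul0_lett2 z : N 0 (inj2 T (lett2 V z)) = inj1 (inj1 (m z)).
Proof. by rewrite /mul_at at2_0z -[LHS]/(inj1 (lmul _)) lmul_lett2. Qed.

Lemma mul_at_cons (m' : {linear T ⊗ T -> T}) p q w :
  mul_at m' 0 (word [:: p, q & w]) = word (m' (p ⊠ q) :: w).
Proof. by rewrite /mul_at at2_0w tcatE. Qed.

Lemma lmul_assoc : assoc_product m -> forall i X, N i (N i X) = N i (N i.+1 X).
Proof.
move=> mA.
apply: (local_eq_shaped (local_comp (local_mul lmul 0 1) (local_mul lmul 0 0))
                       (local_comp (local_mul lmul 1 0) (local_mul lmul 0 0))).
  move=> i w wi; have hw : homog (size w) (word w) := homog_word w; rewrite !add0n add1n.
  rewrite [N i.+1 _](at2_small _ hw) ?linear0; last by lia.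
  by rewrite (at2_small _ (homog_mul_pred _ _ hw)) //; lia.
move=> [|a [|b [|c [|? ?]]]] X // _ hX; rewrite !addn0.
have [b1|b1] := eqVneq b 1%N; last first.
  rewrite (shaped_lmul0 (sh1 := [::]) _ hX) ?b1 ?orbT // linear0.
  by rewrite (shaped_lmul0 (sh1 := [:: a]) _ hX) ?b1 // linear0.
subst b; have [a1|a1] := eqVneq a 1%N; last first.
  rewrite (shaped_lmul0 (sh1 := [::]) _ hX) ?a1 // linear0.
  have [c1|c1] := eqVneq c 1%N; last first.
    by rewrite (shaped_lmul0 (sh1 := [:: a]) _ hX) ?c1 ?orbT // linear0.
  subst c; have h := shaped_lmul (sh1 := [:: a]) hX.
  by rewrite (shaped_lmul0 (sh1 := [::]) _ h) ?a1.
subst a; have [c1|c1] := eqVneq c 1%N; last first.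
  rewrite (shaped_lmul0 (sh1 := [:: 1%N]) _ hX) ?c1 ?orbT // linear0.
  have h := shaped_lmul (sh1 := [::]) hX.
  by rewrite (shaped_lmul0 (sh1 := [::]) _ h) ?c1 ?orbT.
subst c.
apply: (letters3_eq (local_comp (local_mul lmul 0 1) (local_mul lmul 0 0))
                       (local_comp (local_mul lmul 1 0) (local_mul lmul 0 0))) hX => z.
rewrite !addn0 lmul0_lett3 lmul1_lett3 !lmul0_lett2.
exact: (congr1 (fun v => inj1 (inj1 v)) (mA z)).
Qed.

Section Slide.
Variable s : {linear V ⊗ V -> V ⊗ V}.
Hypothesis sP : braiding s.
Local Notation B := (braid_at (beta s)).
Local Notation U := (ins (word [::] : T)).

Lemma beta0_lett2 z : B 0 (inj2 T (lett2 V z)) = inj2 T (lett2 V (s z)).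
Proof.
by rewrite /braid_at at2_0z; exact: (congr1 (inj2 T) (beta_letters sP z)).
Qed.

Lemma beta0_lett3 z : B 0 (inj3 (lett3 V z)) = inj3 (lett3 V (op1 s z)).
Proof. by rewrite braid_at_0t op1_lett3. Qed.

Lemma beta1_lett3 z : B 1 (inj3 (lett3 V z)) = inj3 (lett3 V (op2 s z)).
Proof. by rewrite braid_at_1t op2_lett3. Qed.

Lemma slidel_local1 (m' : {linear T ⊗ T -> T}) :
  local 3 2 (fun i X => B i (mul_at m' i X)).
Proof.
exact: local_comp (local_mul m' 0 1) (local_braid (beta s) 0 0).
Qed.

Lemma slidel_local2 (m' : {linear T ⊗ T -> T}) :
  local 3 2 (fun i X => mul_at m' i.+1 (B i (B i.+1 X))).
Proof.
exact: local_comp (local_comp (local_braid (beta s) 1 0) (local_braid (beta s) 0 1))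
     (local_mul m' 1 0).
Qed.

Lemma slider_local1 (m' : {linear T ⊗ T -> T}) :
  local 3 2 (fun i X => B i (mul_at m' i.+1 X)).
Proof.
exact: local_comp (local_mul m' 1 0) (local_braid (beta s) 0 0).
Qed.

Lemma slider_local2 (m' : {linear T ⊗ T -> T}) :
  local 3 2 (fun i X => mul_at m' i (B i.+1 (B i X))).
Proof.
exact: local_comp (local_comp (local_braid (beta s) 0 1) (local_braid (beta s) 1 0))
     (local_mul m' 0 1).
Qed.


Lemma slidel_small (m' : {linear T ⊗ T -> T}) i (w : seq T) : (size w < i + 3)%N ->
  B i (mul_at m' i (word w)) = mul_at m' i.+1 (B i (B i.+1 (word w))).
Proof.
move=> wi; have hw : homog (size w) (word w) := homog_word w.
rewrite [B i.+1 _](at2_small _ hw) ?linear0; last by lia.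
by rewrite [LHS](at2_small _ (homog_mul_pred _ _ hw)) //; lia.
Qed.

Lemma slider_small (m' : {linear T ⊗ T -> T}) i (w : seq T) : (size w < i + 3)%N ->
  B i (mul_at m' i.+1 (word w)) = mul_at m' i (B i.+1 (B i (word w))).
Proof.
move=> wi; have hw : homog (size w) (word w) := homog_word w.
rewrite [mul_at m' i.+1 _](at2_small _ hw) ?linear0; last by lia.
by rewrite [B i.+1 _](at2_small _ (homog_braid_at _ _ hw)) ?linear0 //; lia.
Qed.

Hypothesis mP : YB_compatible m s.

Lemma lmul_slidel_letters rest X : shaped [:: 1, 1, 1 & rest]%N X ->
  B 0 (N 0 X) = N 1 (B 0 (B 1 X)).
Proof.
apply: (letters3_eq (slidel_local1 lmul) (slidel_local2 lmul)) => z.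
have l1 := congr1 (B 0) (lmul0_lett3 z).
have l2 := beta0_lett2 (tensmap m idfun z).
have r1 := congr1 (fun X => N 1 (B 0 X)) (beta1_lett3 z).
have r2 := congr1 (N 1) (beta0_lett3 (op2 s z)).
have r3 := lmul1_lett3 (op1 s (op2 s z)).
have c := congr1 (fun v => inj2 T (lett2 V v)) (mP.1 z).
exact: etrans l1 (etrans l2 (etrans (esym c) (esym (etrans r1 (etrans r2 r3))))).
Qed.

Lemma lmul_slider_letters rest X : shaped [:: 1, 1, 1 & rest]%N X ->
  B 0 (N 1 X) = N 0 (B 1 (B 0 X)).
Proof.
apply: (letters3_eq (slider_local1 lmul) (slider_local2 lmul)) => z.
have l1 := congr1 (B 0) (lmul1_lett3 z).
have l2 := beta0_lett2 (tensmap idfun m (assoc V V V z)).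
have r1 := congr1 (fun X => N 0 (B 1 X)) (beta0_lett3 z).
have r2 := congr1 (N 0) (beta1_lett3 (op1 s z)).
have r3 := lmul0_lett3 (op2 s (op1 s z)).
have c := congr1 (fun v => inj2 T (lett2 V v)) (mP.2 z).
exact: etrans l1 (etrans l2 (etrans (esym c) (esym (etrans r1 (etrans r2 r3))))).
Qed.

(** The third slot is built up letter by letter, starting from the compatibility of [m]
    with [s] on letters. *)
Lemma lmul_slidel_shaped c rest X : shaped [:: 1, 1, c & rest]%N X ->
  B 0 (N 0 X) = N 1 (B 0 (B 1 X)).
Proof.
elim: c rest X => [|c IH] rest X hX.
  have [Y hY ->] := @shaped_ins_inv _ _ [:: 1; 1]%N rest X hX.
  have hBY := shaped_beta s (sh1 := [::]) hY.
  have hNY := shaped_lmul (sh1 := [::]) hY.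
  have e0 : U 1 (N 0 Y) = N 0 (U 2 Y) by exact: ins_mul.
  have e1 : B 0 (U 1 (N 0 Y)) = U 0 (N 0 Y) by exact: beta_ins_r hNY _.
  have e2 : B 1 (U 2 Y) = U 1 Y by exact: beta_ins_r hY _.
  have e3 : B 0 (U 1 Y) = U 0 Y by exact: beta_ins_r hY _.
  have e4 : N 1 (U 0 Y) = U 0 (N 0 Y) by exact: mul_ins.
  exact: etrans (congr1 (B 0) (esym e0)) (etrans e1 (esym (etrans
    (congr1 (fun Z => N 1 (B 0 Z)) e2) (etrans (congr1 (N 1) e3) e4)))).
have [Y hY ->] := @shaped_app_inv _ _ [:: 1; 1]%N c rest X hX.
have h := shaped_beta s (sh1 := [::]) (shaped_beta s (sh1 := [:: 1%N]) hY).
apply: (slidel_step _ _ _ _ (braid_braid_far _ _) (mul_mul_far _ _) (mul_mul_far _ _)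
  (beta_slider sP)); first exact: IH hY.
exact: (shaped_shift (slidel_local1 lmul) (slidel_local2 lmul) (@lmul_slidel_letters rest)) h.
Qed.

Lemma lmul_slider_shaped c rest X : shaped [:: c, 1, 1 & rest]%N X ->
  B 0 (N 1 X) = N 0 (B 1 (B 0 X)).
Proof.
elim: c rest X => [|c IH] rest X hX.
  have [Y hY ->] := @shaped_ins_inv _ _ [::] [:: 1, 1 & rest]%N X hX.
  have hNY := shaped_lmul (sh1 := [::]) hY.
  have e0 : N 1 (U 0 Y) = U 0 (N 0 Y) by exact: mul_ins.
  have e1 : B 0 (U 0 (N 0 Y)) = U 1 (N 0 Y) by exact: beta_ins_l hNY _.
  have e2 : B 0 (U 0 Y) = U 1 Y by exact: beta_ins_l hY _.
  have e3 : B 1 (U 1 Y) = U 2 Y by exact: beta_ins_l hY _.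
  have e4 : U 1 (N 0 Y) = N 0 (U 2 Y) by exact: ins_mul.
  exact: etrans (congr1 (B 0) e0) (etrans e1 (etrans e4 (esym (etrans
    (congr1 (fun Z => N 0 (B 1 Z)) e2) (congr1 (N 0) e3))))).
have [Y hY ->] := @shaped_app_inv _ _ [::] c [:: 1, 1 & rest]%N X hX.
have h := shaped_beta s (sh1 := [:: c; 1%N]) (shaped_beta s (sh1 := [:: c]) hY).
apply: (slider_step _ _ _ _ (braid_braid_far _ _) (mul_mul_far _ _) (mul_mul_far _ _)
  (beta_slidel sP)); last exact: IH h.
exact: (shaped_shift (slider_local1 lmul) (slider_local2 lmul) (@lmul_slider_letters rest)) hY.
Qed.

Lemma lmul_slidel : slidel B N.
Proof.
apply: (local_eq_shaped (slidel_local1 lmul) (slidel_local2 lmul)).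
  exact: slidel_small.
move=> [|a [|b [|c [|? ?]]]] X // _ hX.
have [/andP[/eqP a1 /eqP b1]|ab] := boolP ((a == 1) && (b == 1))%N.
  by subst a b; apply: lmul_slidel_shaped hX.
rewrite negb_and in ab; rewrite (shaped_lmul0 (sh1 := [::]) ab hX) linear0.
have h := shaped_beta s (sh1 := [::]) (shaped_beta s (sh1 := [:: a]) hX).
by rewrite (shaped_lmul0 (sh1 := [:: c]) ab h).
Qed.

Lemma lmul_slider : slider B N.
Proof.
apply: (local_eq_shaped (slider_local1 lmul) (slider_local2 lmul)).
  exact: slider_small.
move=> [|a [|b [|c [|? ?]]]] X // _ hX.
have [/andP[/eqP b1 /eqP c1]|bc] := boolP ((b == 1) && (c == 1))%N.
  by subst b c; apply: lmul_slider_shaped hX.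
rewrite negb_and in bc; rewrite (shaped_lmul0 (sh1 := [:: a]) bc hX) linear0.
have h := shaped_beta s (sh1 := [:: b]) (shaped_beta s (sh1 := [::]) hX).
by rewrite (shaped_lmul0 (sh1 := [::]) bc h).
Qed.

End Slide.

(** * The quasi-shuffle rule *)

Section QuasiShuffleRule.
Variable s : {linear V ⊗ V -> V ⊗ V}.
Local Notation B := (braid_at (beta s)).
Local Notation J := (mul_at (join s m)).

(** For [z = v ⊠ w], the product of [t] and [v] followed by the letter [w], and likewise
    in [join_last] by the letter [m (w ⊠ y)]. They are stated as linear functions of [z] in
    order to be applied to values of [beta]. *)
Definition join_last (t y : T) (z : T ⊗ T) : T :=
  tcat V (tensmap (join s m) lmul (unassoc T T (T ⊗ T) (t ⊠ assoc T T T (z ⊠ y)))).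
Lemma join_last_linear t y : linear (join_last t y).
Proof.
move=> c x x'; rewrite /join_last (tpair_bilin _ _).1 linearP (tpair_bilin _ _).2.
by rewrite !linearP.
Qed.
Lemma join_lastE t y v w : join_last t y (v ⊠ w) = join s m (t ⊠ v) ** lmul (w ⊠ y).
Proof. by rewrite /join_last assocE unassocE tensmapE. Qed.

Definition join_app (t : T) (z : T ⊗ T) : T :=
  app (tensmap (join s m) idfun (unassoc T T T (t ⊠ z))).
Lemma join_app_linear t : linear (join_app t).
Proof. by move=> c x x'; rewrite /join_app (tpair_bilin _ _).2 !linearP. Qed.
Lemma join_appE t v w : join_app t (v ⊠ w) = join s m (t ⊠ v) ** letter w.
Proof. by rewrite /join_app unassocE tensmapE appE. Qed.

(** [join_rcons] for arbitrary words [x] and [y]: unless both are letters, every term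
    vanishes. *)
Lemma join_quasi_shuffle t x u y :
  join s m ((word t ** letter (word x)) ⊠ (word u ** letter (word y))) =
  join s m ((word t ** letter (word x)) ⊠ word u) ** letter (word y) +
  join_app (word t) (beta s (word x ⊠ (word u ** letter (word y)))) +
  join_last (word t) (word y) (beta s (word x ⊠ word u)).
Proof.
have z0 : linear (fun _ : T ⊗ T => 0 : T) by move=> a p q; rewrite scaler0 addr0.
have last0 : (size x != 1) || (size y != 1) ->
    join_last (word t) (word y) (beta s (word x ⊠ word u)) = 0.
  move=> xy; apply: (linear_eq_lspan (join_last_linear _ _) z0 _ (bihomog_beta s x u)).
  move=> _ [v [w [_ wx ->]]]; rewrite -wx in xy; rewrite join_lastE.
  by case/orP: xy => h; rewrite ?(lmul0l _ h) ?(lmul0r _ h) tcat0r.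
have [y1|y1] := eqVneq (size y) 1%N; last first.
  rewrite (letter0 y1) last0 ?y1 ?orbT // !tcat0r !tpair0r linear0.
  by rewrite [beta s 0]linear0 /join_app tpair0r !linear0 !addr0.
rewrite (letter1 y1) tcatE.
have [x1|x1] := eqVneq (size x) 1%N; last first.
  rewrite (letter0 x1) last0 ?x1 // tcat0r !tpair0l !linear0 tcat0l add0r addr0.
  apply/esym; apply: (linear_eq_lspan (join_app_linear _) z0 _ (bihomog_beta s x (u ++ y))).
  by move=> _ [v [w [_ wx ->]]]; rewrite join_appE letter0 ?wx // tcat0r.
rewrite (letter1 x1) tcatE.
case: x x1 {last0} => [|x []] // _; case: y y1 => [|y []] // _.
rewrite !cats1 join_rcons; congr (_ + _ + _).
  apply: (linear_eq_lspan (cop_term_linear _ _ _ _) (join_app_linear _) _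
    (bihomog_beta s [:: x] (rcons u y))).
  move=> _ [v [w [_ w1 ->]]]; case: w w1 => [|w [|? ?]] // _; rewrite cop_termE join_appE Mletter_word.
  by rewrite letter1.
apply: (linear_eq_lspan (cop_term_linear _ _ _ _) (join_last_linear _ _) _
    (bihomog_beta s [:: x] u)).
move=> _ [v [w [_ w1 ->]]]; case: w w1 => [|w [|? ?]] // _; rewrite cop_termE join_lastE Mletter_word.
by rewrite lmulE !pr1_word.
Qed.

Lemma join_slots i X : J i (C i (C i.+2 X)) =
  C i (J i (C i X)) + C i (J i (B i.+1 (C i.+2 X))) + C i (J i (N i.+2 (B i.+1 X))).
Proof.
move: i X; apply: (local_eq_words
 (local_comp (local_comp (local_mul (@app K V) 2 0) (local_mul (@app K V) 0 1))
    (local_mul (join s m) 0 0))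
 (local_add (local_add
   (local_comp (local_comp (local_mul (@app K V) 0 2) (local_mul (join s m) 0 1))
     (local_mul (@app K V) 0 0))
   (local_comp (local_comp (local_comp (local_mul (@app K V) 2 0)
     (local_braid (beta s) 1 0)) (local_mul (join s m) 0 1)) (local_mul (@app K V) 0 0)))
   (local_comp (local_comp (local_comp (local_braid (beta s) 1 1)
     (local_mul lmul 2 0)) (local_mul (join s m) 0 1)) (local_mul (@app K V) 0 0)))).
  move=> i w wi; have hw : homog (size w) (word w) := homog_word w; rewrite !add0n !add1n add2n.
  have c2 : C i.+2 (word w) = 0 by apply: at2_small hw _; lia.
  have n2 : N i.+2 (B i.+1 (word w)) = 0.
    by apply: at2_small (homog_braid_at _ _ hw) _; lia.
  rewrite c2 n2 !linear0 !addr0.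
  by rewrite [RHS](at2_small _ (homog_mul_pred _ _ (homog_mul_pred _ _ hw))) //; lia.
move=> [|t [|x [|u [|y [|? ?]]]]] // _; rewrite !addn0.
rewrite -[map _ _]/([:: word t; word x; word u; word y]).
have cons2 (m' : {linear T ⊗ T -> T}) p q p' q' :
    mul_at m' 2 (word [:: p; q; p'; q']) = word [:: p; q; m' (p' ⊠ q')].
  rewrite -[word [:: p, _ & _]](tcatE [:: p; q] [:: p'; q']) /mul_at /at2.
  by rewrite (at_shift _ _ 0 _ (homog_word [:: p; q])) -/(at2 _) at2_0w !tcatE.
have B1 p q q' w : B 1 (word [:: p, q, q' & w]) =
    inj1 p ** inj2 T (beta s (q ⊠ q')) ** word w.
  rewrite -[word _](tcatE [:: p] [:: q, q' & w]) /braid_at /at2 at_cons -/(at2 _) at2_0w.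
  by rewrite tcatA.
have CJapp (z : T ⊗ T) :
    C 0 (J 0 (inj1 (word t) ** inj2 T z)) = inj1 (join_app (word t) z).
  move: z; apply: tens_fext => [a p q|a p q|p q].
  - by rewrite linearP tcatr !linearP.
  - by rewrite join_app_linear linearP.
  by rewrite inj2E tcatE !mul_at_cons -[LHS]/(inj1 (app _)) appE join_appE.
have CJlast (z : T ⊗ T) :
    C 0 (J 0 (N 2 (inj1 (word t) ** inj2 T z ** word [:: word y]))) =
    inj1 (join_last (word t) (word y) z).
  move: z; apply: tens_fext => [a p q|a p q|p q].
  - by rewrite linearP tcatr tcatl !linearP.
  - by rewrite join_last_linear linearP.
  rewrite inj2E !tcatE cons2 !mul_at_cons -[LHS]/(inj1 (app _)) appE join_lastE.
  congr (inj1 (_ ** _)); exact: (letter1 (w := [:: _]) erefl).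
have e1 : J 0 (C 0 (C 2 (word [:: word t; word x; word u; word y]))) =
    inj1 (join s m ((word t ** letter (word x)) ⊠ (word u ** letter (word y)))).
  rewrite cons2 !mul_at_cons.
  rewrite -[LHS]/(inj1 (join s m (app (word t ⊠ word x) ⊠ app (word u ⊠ word y)))).
  by rewrite !appE.
have e2 : C 0 (J 0 (C 0 (word [:: word t; word x; word u; word y]))) =
    inj1 (join s m ((word t ** letter (word x)) ⊠ word u) ** letter (word y)).
  rewrite !mul_at_cons.
  rewrite -[LHS]/(inj1 (app (join s m (app (word t ⊠ word x) ⊠ word u) ⊠ word y))).
  by rewrite !appE.
have e3 : C 0 (J 0 (B 1 (C 2 (word [:: word t; word x; word u; word y])))) =
    inj1 (join_app (word t) (beta s (word x ⊠ (word u ** letter (word y))))).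
  apply: (etrans (congr1 (fun X => C 0 (J 0 (B 1 X))) (cons2 _ _ _ _ _))).
  apply: (etrans (congr1 (fun X => C 0 (J 0 X)) (B1 _ _ _ [::]))).
  apply: (etrans (congr1 (fun X => C 0 (J 0 X)) (tcat1 _))).
  apply: (etrans (CJapp _)).
  exact: (congr1 (fun v => inj1 (join_app (word t) (beta s (word x ⊠ v)))) (appE _ _)).
have e4 : C 0 (J 0 (N 2 (B 1 (word [:: word t; word x; word u; word y])))) =
    inj1 (join_last (word t) (word y) (beta s (word x ⊠ word u))).
  apply: (etrans (congr1 (fun X => C 0 (J 0 (N 2 X))) (B1 _ _ _ [:: word y]))).
  exact: CJlast.
apply: (etrans e1); rewrite join_quasi_shuffle.
transitivity (inj1 (join s m ((word t ** letter (word x)) ⊠ word u) ** letter (word y)) +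
  inj1 (join_app (word t) (beta s (word x ⊠ (word u ** letter (word y))))) +
  inj1 (join_last (word t) (word y) (beta s (word x ⊠ word u)))).
  by rewrite !linearD.
by congr (_ + _ + _); apply/esym.
Qed.

End QuasiShuffleRule.
End Letters.

(** * The product and the braiding of the tensor algebra *)

Section JoinAlgebra.
Variables (K : fieldType) (V : lmodType K) (s : {linear V ⊗ V -> V ⊗ V}).
Variable m : {linear V ⊗ V -> V}.
Local Notation T := (talg V).
Local Notation B := (braid_at (beta s)).
Local Notation C := (mul_at (@app K V)).
Local Notation N := (mul_at (lmul m)).
Local Notation J := (mul_at (join s m)).
Local Notation U := (ins (word [::] : T)).
Hypotheses (sP : braiding s) (mC : YB_compatible m s).

Lemma join_ins_l sh i X : shaped sh X -> (i < size sh)%N -> J i (U i X) = X.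
Proof. by move=> /shaped_homog; apply: mul_ins_l; exact: join_unit. Qed.

Lemma join_ins_r sh i X : shaped sh X -> (i < size sh)%N -> J i (U i.+1 X) = X.
Proof. by move=> /shaped_homog; apply: mul_ins_r; exact: join_unit. Qed.

(** By induction on the total size: an empty factor of the product is a unit, and
    otherwise both factors end in a letter, so that the quasi-shuffle rule applies. *)
Lemma join_slidel_shaped d a b c rest X : (a + b + c < d)%N ->
  shaped [:: a, b, c & rest] X -> B 0 (J 0 X) = J 1 (B 0 (B 1 X)).
Proof.
elim: d a b c rest X => // d IH a b c rest X abc hX.
case: a abc hX => [|a] abc hX.
  have [Y hY ->] := @shaped_ins_inv _ _ [::] [:: b, c & rest] X hX.
  have hBY := shaped_beta s (sh1 := [::]) hY.
  have l : J 0 (U 0 Y) = Y by exact: join_ins_l hY _.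
  have r1 : B 1 (U 0 Y) = U 0 (B 0 Y) by exact: braid_ins.
  have r2 : B 0 (U 0 (B 0 Y)) = U 1 (B 0 Y) by exact: beta_ins_l hBY _.
  have r3 : J 1 (U 1 (B 0 Y)) = B 0 Y by exact: join_ins_l hBY _.
  exact: etrans (congr1 (B 0) l) (esym (etrans
    (congr1 (fun Z => J 1 (B 0 Z)) r1) (etrans (congr1 (J 1) r2) r3))).
case: b abc hX => [|b] abc hX.
  have [Y hY ->] := @shaped_ins_inv _ _ [:: a.+1] [:: c & rest] X hX.
  have hBY := shaped_beta s (sh1 := [::]) hY.
  have l : J 0 (U 1 Y) = Y by exact: join_ins_r hY _.
  have r1 : B 1 (U 1 Y) = U 2 Y by exact: beta_ins_l hY _.
  have r2 : U 2 (B 0 Y) = B 0 (U 2 Y) by exact: ins_braid.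
  have r3 : J 1 (U 2 (B 0 Y)) = B 0 Y by exact: join_ins_r hBY _.
  exact: etrans (congr1 (B 0) l) (esym (etrans
    (congr1 (fun Z => J 1 (B 0 Z)) r1) (etrans (congr1 (J 1) (esym r2)) r3))).
have [Y1 hY1 ->] := @shaped_app_inv _ _ [::] a [:: b.+1, c & rest] X hX.
have [Y hY ->] := @shaped_app_inv _ _ [:: a; 1%N] b [:: c & rest] Y1 hY1.
have h1 := shaped_beta s (sh1 := [:: _; _]) (shaped_app (sh1 := [::]) hY).
have h21 := shaped_beta s (sh1 := [:: _]) (shaped_app (sh1 := [:: _; _]) hY).
have h2 := shaped_beta s (sh1 := [:: _; _]) h21.
have h31 := shaped_lmul m (sh1 := [:: _; _]) (shaped_beta s (sh1 := [:: _]) hY).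
have h3 := shaped_beta s (sh1 := [:: _; _]) h31.
apply: (join_slidel_step _ _ _ _ _ (fun i => linearD (B i))
  (braid_braid_far _ _) (braid_mul_far _ _) (braid_mul_far _ _)
  (mul_braid_far _ _) (mul_braid_far _ _) (beta_yb sP) (beta_slidel sP) (lmul_slidel sP mC)
  (join_slots m s)).
- by apply: IH h1; lia.
- by apply: IH h2; lia.
- by apply: IH h3; lia.
Qed.

Lemma join_slider_shaped d a b c rest X : (a + b + c < d)%N ->
  shaped [:: c, a, b & rest] X -> B 0 (J 1 X) = J 0 (B 1 (B 0 X)).
Proof.
elim: d a b c rest X => // d IH a b c rest X abc hX.
case: a abc hX => [|a] abc hX.
  have [Y hY ->] := @shaped_ins_inv _ _ [:: c] [:: b & rest] X hX.
  have hBY := shaped_beta s (sh1 := [::]) hY.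
  have l : J 1 (U 1 Y) = Y by exact: join_ins_l hY _.
  have r1 : B 0 (U 1 Y) = U 0 Y by exact: beta_ins_r hY _.
  have r2 : B 1 (U 0 Y) = U 0 (B 0 Y) by exact: braid_ins.
  have r3 : J 0 (U 0 (B 0 Y)) = B 0 Y by exact: join_ins_l hBY _.
  exact: etrans (congr1 (B 0) l) (esym (etrans
    (congr1 (fun Z => J 0 (B 1 Z)) r1) (etrans (congr1 (J 0) r2) r3))).
case: b abc hX => [|b] abc hX.
  have [Y hY ->] := @shaped_ins_inv _ _ [:: c; a.+1] rest X hX.
  have hBY := shaped_beta s (sh1 := [::]) hY.
  have l : J 1 (U 2 Y) = Y by exact: join_ins_r hY _.
  have r1 : U 2 (B 0 Y) = B 0 (U 2 Y) by exact: ins_braid.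
  have r2 : B 1 (U 2 (B 0 Y)) = U 1 (B 0 Y) by exact: beta_ins_r hBY _.
  have r3 : J 0 (U 1 (B 0 Y)) = B 0 Y by exact: join_ins_r hBY _.
  exact: etrans (congr1 (B 0) l) (esym (etrans
    (congr1 (fun Z => J 0 (B 1 Z)) (esym r1)) (etrans (congr1 (J 0) r2) r3))).
have [Y1 hY1 ->] := @shaped_app_inv _ _ [:: c] a [:: b.+1 & rest] X hX.
have [Y hY ->] := @shaped_app_inv _ _ [:: c; a; 1%N] b rest Y1 hY1.
have h1 := shaped_app (sh1 := [:: _]) hY.
have h2 := shaped_beta s (sh1 := [:: _; _]) (shaped_app (sh1 := [:: _; _; _]) hY).
have h3 := shaped_lmul m (sh1 := [:: _; _; _]) (shaped_beta s (sh1 := [:: _; _]) hY).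
apply: (join_slider_step _ _ _ _ _ (fun i => linearD (B i))
  (braid_braid_far _ _) (braid_mul_far _ _) (braid_mul_far _ _)
  (mul_braid_far _ _) (mul_braid_far _ _) (beta_yb sP) (beta_slider sP) (lmul_slider sP mC)
  (join_slots m s)).
- by apply: IH h1; lia.
- by apply: IH h2; lia.
- by apply: IH h3; lia.
Qed.

Lemma join_slidel : slidel B J.
Proof.
apply: (local_eq_shaped (slidel_local1 s (join s m)) (slidel_local2 s (join s m))).
  exact: slidel_small.
move=> [|a [|b [|c [|? ?]]]] X // _ hX.
exact: (@join_slidel_shaped (a + b + c).+1 a b c [::]).
Qed.

Lemma join_slider : slider B J.
Proof.
apply: (local_eq_shaped (slider_local1 s (join s m)) (slider_local2 s (join s m))).
  exact: slider_small.
move=> [|c [|a [|b [|? ?]]]] X // _ hX.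
exact: (@join_slider_shaped (a + b + c).+1 a b c [::]).
Qed.

Hypothesis mA : assoc_product m.

(** Again an empty slot is a unit, and three nonempty slots end in letters. *)
Lemma join_assoc_shaped d a b c rest X : (a + b + c < d)%N ->
  shaped [:: a, b, c & rest] X -> J 0 (J 0 X) = J 0 (J 1 X).
Proof.
elim: d a b c rest X => // d IH a b c rest X abc hX.
case: a abc hX => [|a] abc hX.
  have [Y hY ->] := @shaped_ins_inv _ _ [::] [:: b, c & rest] X hX.
  have hJY : homog (size rest).+1 (J 0 Y) := homog_mul_at _ _ (shaped_homog hY).
  have l : J 0 (U 0 Y) = Y by exact: join_ins_l hY _.
  have r1 : J 1 (U 0 Y) = U 0 (J 0 Y) by exact: mul_ins.
  have r2 : J 0 (U 0 (J 0 Y)) = J 0 Y by exact: (mul_ins_l (join_unit s m) hJY).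
  exact: etrans (congr1 (J 0) l) (esym (etrans (congr1 (J 0) r1) r2)).
case: b abc hX => [|b] abc hX.
  have [Y hY ->] := @shaped_ins_inv _ _ [:: a.+1] [:: c & rest] X hX.
  have l : J 0 (U 1 Y) = Y by exact: join_ins_r hY _.
  have r : J 1 (U 1 Y) = Y by exact: join_ins_l hY _.
  exact: (congr1 (J 0) (etrans l (esym r))).
case: c abc hX => [|c] abc hX.
  have [Y hY ->] := @shaped_ins_inv _ _ [:: a.+1; b.+1] rest X hX.
  have hJY : homog (size rest).+1 (J 0 Y) := homog_mul_at _ _ (shaped_homog hY).
  have l1 : U 1 (J 0 Y) = J 0 (U 2 Y) by exact: ins_mul.
  have l2 : J 0 (U 1 (J 0 Y)) = J 0 Y by exact: (mul_ins_r (join_unit s m) hJY).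
  have r : J 1 (U 2 Y) = Y by exact: join_ins_r hY _.
  exact: etrans (congr1 (J 0) (esym l1)) (etrans l2 (esym (congr1 (J 0) r))).
have [Y1 hY1 ->] := @shaped_app_inv _ _ [::] a [:: b.+1, c.+1 & rest] X hX.
have [Y2 hY2 ->] := @shaped_app_inv _ _ [:: a; 1%N] b [:: c.+1 & rest] Y1 hY1.
have [Y hY ->] := @shaped_app_inv _ _ [:: a; 1%N; b; 1%N] c rest Y2 hY2.
have c0 := shaped_app (sh1 := [::]) hY.
have c2 := shaped_app (sh1 := [:: _; _]) hY.
have b1 := shaped_beta s (sh1 := [:: _]) hY.
have b1c2 := shaped_beta s (sh1 := [:: _]) c2.
have n2b1 := shaped_lmul m (sh1 := [:: _; _]) b1.
have h1 := shaped_app (sh1 := [::]) c2.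
have h2 := shaped_beta s (sh1 := [:: _; _]) (shaped_app (sh1 := [:: _; _; _]) c0).
have h3 := shaped_lmul m (sh1 := [:: _; _; _]) (shaped_beta s (sh1 := [:: _; _]) c0).
have h4 := shaped_beta s (sh1 := [:: _; _]) (shaped_app (sh1 := [:: _; _; _]) b1c2).
have h5 := shaped_lmul m (sh1 := [:: _; _; _]) (shaped_beta s (sh1 := [:: _; _]) b1c2).
have h6 := shaped_beta s (sh1 := [:: _; _]) (shaped_app (sh1 := [:: _; _; _]) n2b1).
have h7 := shaped_lmul m (sh1 := [:: _; _; _]) (shaped_beta s (sh1 := [:: _; _]) n2b1).
apply: (join_assoc_step _ _ _ _ _ (fun i => linearD (B i)) (fun i => linearD (C i))
  (fun i => linearD (J i)) (braid_braid_far _ _) (braid_mul_far _ _) (braid_mul_far _ _)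
  (mul_braid_far _ _) (mul_mul_far _ _) (mul_mul_far _ _) (mul_mul_far _ _)
  (mul_mul_far _ _) (mul_braid_far _ _) (mul_mul_far _ _) (mul_mul_far _ _)
  (lmul_slidel sP mC) (lmul_assoc mA) (join_slots m s) join_slider).
- by apply: IH h1; lia.
- by apply: IH h2; lia.
- by apply: IH h3; lia.
- by apply: IH h4; lia.
- by apply: IH h5; lia.
- by apply: IH h6; lia.
- by apply: IH h7; lia.
Qed.

Lemma join_assoc_slots X : homog 3 X -> J 0 (J 0 X) = J 0 (J 1 X).
Proof.
have lJ i : linear (J i) by move=> a x y; rewrite linearP.
move=> hX; apply: (@linear_eq_lspan _ _ _ _ (fun X => J 0 (J 0 X)) (fun X => J 0 (J 1 X))
  _ _ _ _ hX).
- by move=> a x y; rewrite !lJ.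
- by move=> a x y; rewrite !lJ.
move=> _ [w w3 ->].
apply: (@linear_eq_lspan _ _ _ _ (fun X => J 0 (J 0 X)) (fun X => J 0 (J 1 X))
  _ _ _ _ (homog_shapes w)).
- by move=> a x y; rewrite !lJ.
- by move=> a x y; rewrite !lJ.
move=> _ [ws e ->]; rewrite w3 in e.
have := shaped_word ws; case: ws e => [|t [|u [|v [|? ?]]]] // _.
exact: (join_assoc_shaped (ltnSn _)).
Qed.

Lemma join_assoc_product : assoc_product (join s m).
Proof.
move=> z; apply: inj1_inj.
have l1 := mul_at_0t (join s m) z; have r1 := mul_at_1t (join s m) z.
have J2 (y : T ⊗ T) : J 0 (inj2 T y) = inj1 (join s m y) by rewrite /mul_at at2_0z.
exact: etrans (esym (J2 _)) (etrans (congr1 (J 0) (esym l1)) (etrans (join_assoc_slots (homog_inj3 z))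
  (etrans (congr1 (J 0) r1) (J2 _)))).
Qed.

Lemma join_compatible : YB_compatible (join s m) (beta s).
Proof.
have B2 (y : T ⊗ T) : B 0 (inj2 T y) = inj2 T (beta s y) by rewrite /braid_at at2_0z.
split=> z; apply: inj2_inj.
  have l1 := mul_at_0t (join s m) z.
  have r1 := braid_at_1t (beta s) z.
  have r2 := braid_at_0t (beta s) (op2 (beta s) z).
  have r3 := mul_at_1t (join s m) (op1 (beta s) (op2 (beta s) z)).
  exact: etrans (esym r3) (etrans (congr1 (J 1) (esym r2))
    (etrans (congr1 (fun X => J 1 (B 0 X)) (esym r1)) (etrans (esym (join_slidel 0 (inj3 z)))
      (etrans (congr1 (B 0) l1) (B2 _))))).
have l1 := mul_at_1t (join s m) z.
have r1 := braid_at_0t (beta s) z.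
have r2 := braid_at_1t (beta s) (op1 (beta s) z).
have r3 := mul_at_0t (join s m) (op2 (beta s) (op1 (beta s) z)).
exact: etrans (esym r3) (etrans (congr1 (J 0) (esym r2))
    (etrans (congr1 (fun X => J 0 (B 1 X)) (esym r1)) (etrans (esym (join_slider 0 (inj3 z)))
      (etrans (congr1 (B 0) l1) (B2 _))))).
Qed.

End JoinAlgebra.

(** * Restriction to letters *)

Section Converse.
Variables (K : fieldType) (V : lmodType K) (s : {linear V ⊗ V -> V ⊗ V}).
Variable m : {linear V ⊗ V -> V}.
Hypothesis sP : braiding s.
Local Notation T := (talg V).

Lemma join_term_homog n z : homog n.+1 (join_term s m n.+1 z).
Proof.
rewrite -[join_term _ _ _ _]/(talgmap (Mmap m) (cop_beta_iter s n z)).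
apply: lspan_map (homog_iter s n z) => _ [w wn ->]; rewrite talgmapE.
by apply: homog_wordE; rewrite size_map.
Qed.

Lemma homog_eq0 (Z : lmodType K) (f : {linear T -> Z}) n x :
  (forall w, size w = n -> f (word w) = 0) -> homog n x -> f x = 0.
Proof.
move=> h; elim=> [|c y v [w wn ->] _ IH]; first exact: linear0.
by rewrite linearP IH h // scaler0 addr0.
Qed.

(** The term of index [n] of the series [join] consists of words of length [n]. *)
Lemma pr1_join z : pr1 V (join s m z) = Mmap m z.
Proof.
have [N hN] := join_funE s m z.
rewrite -[join s m z]/(join_fun s m z) (hN N.+2); last by lia.
rewrite big_ltn // !linearD linear_sum big_nat big1 ?addr0; last first.
  move=> [|[|n]] // _; apply: homog_eq0 (join_term_homog _ _) => w wn.
  by rewrite pr1_0 // wn.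
rewrite join_term1 /Mletter /pr1 on1E -[RHS]add0r; congr (_ + _).
rewrite -/(pr1 V) -[LHS]/((pr1 V \o eps2 V) z) -[RHS]/((\0%R : {linear _ -> _}) z).
by move: z {N hN}; apply: ttalg_ext => t u /=; rewrite eps2_word linearZ /= pr1_word scaler0.
Qed.

Lemma Mmap_lett2 z : Mmap m (lett2 V z) = m z.
Proof.
move: z; apply: tens_fext => [a x y|a x y|x y]; rewrite ?linearP //.
by rewrite /lett2 tensmapE /Mmap wlift2E.
Qed.

(** Both sides vanish on words that are not letters, because [beta] preserves sizes. *)
Lemma pr2_beta z : tensmap (pr1 V) (pr1 V) (beta s z) = s (tensmap (pr1 V) (pr1 V) z).
Proof.
have [M1 M2] := tpair_bilin T T.
rewrite -[LHS]/((tensmap (pr1 V) (pr1 V) \o beta s) z).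
rewrite -[RHS]/((s \o tensmap (pr1 V) (pr1 V)) z); move: z; apply: ttalg_ext => t u.
rewrite -[LHS]/(tensmap (pr1 V) (pr1 V) (beta s (word t ⊠ word u))).
rewrite -[RHS]/(s (tensmap (pr1 V) (pr1 V) (word t ⊠ word u))) tensmapE.
have z0 : linear (fun _ : T ⊗ T => 0 : V ⊗ V) by move=> a p q; rewrite scaler0 addr0.
have lp : linear (tensmap (pr1 V) (pr1 V)) by exact: linearP.
have [tu|tu] := boolP ((size t == 1) && (size u == 1))%N; last first.
  transitivity (0 : V ⊗ V).
    apply: (linear_eq_lspan lp z0 _ (bihomog_beta s t u)) => _ [v [w [vu wt ->]]].
    rewrite tensmapE; move: tu; rewrite -vu -wt negb_and => /orP[h|h].
      by rewrite (pr1_0 h) tpair0r.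
    by rewrite (pr1_0 h) tpair0l.
  move: tu; rewrite negb_and => /orP[h|h].
    by rewrite (pr1_0 h) tpair0l linear0.
  by rewrite (pr1_0 h) tpair0r linear0.
case: t u tu => [|x [|? ?]] [|y [|? ?]] // _.
have -> : word [:: x] ⊠ word [:: y] = lett2 V (x ⊠ y) by rewrite /lett2 tensmapE.
rewrite !pr1_word (beta_letters sP); move: (s _) => z; move: z.
apply: tens_fext => [a p q|a p q|a b]; rewrite ?linearP //.
by rewrite !tensmapE /pr1 !on1E.
Qed.

Lemma pr2_join_l z :
  tensmap (pr1 V) (pr1 V) (tensmap (join s m) idfun (lett3 V z)) = tensmap m idfun z.
Proof.
move: z; apply: tens_fext => [a x y|a x y|p c]; rewrite ?linearP //.
rewrite /lett3 !tensmapE pr1_join -[tensmap _ _ p]/(lett2 V p) Mmap_lett2.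
by congr (_ ⊠ _); exact: on1E.
Qed.

Lemma pr2_join_r z :
  tensmap (pr1 V) (pr1 V) (tensmap idfun (join s m) (assoc T T T (lett3 V z))) =
  tensmap idfun m (assoc V V V z).
Proof.
rewrite lett3_assoc; move: (assoc V V V z).
apply: tens_fext => [a x y|a x y|c p]; rewrite ?linearP //.
rewrite !tensmapE pr1_join Mmap_lett2.
by congr (_ ⊠ _); exact: on1E.
Qed.

(** Apply the identities of the tensor algebra to letters and project the result to
    letters. *)
Lemma compatible_letters : YB_compatible (join s m) (beta s) -> YB_compatible m s.
Proof.
move=> [h1 h2]; split=> z.
  have := congr1 (tensmap (pr1 V) (pr1 V)) (h1 (lett3 V z)).
  rewrite -[X in tensmap _ _ X = _]/(tensmap idfun (join s m)
    (assoc T T T (op1 (beta s) (op2 (beta s) (lett3 V z))))).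
  rewrite -[X in _ = tensmap _ _ X]/(beta s (tensmap (join s m) idfun (lett3 V z))).
  by rewrite op2_lett3 // op1_lett3 // pr2_join_r pr2_beta pr2_join_l.
have := congr1 (tensmap (pr1 V) (pr1 V)) (h2 (lett3 V z)).
rewrite -[X in tensmap _ _ X = _]/(tensmap (join s m) idfun
  (op2 (beta s) (op1 (beta s) (lett3 V z)))).
rewrite -[X in _ = tensmap _ _ X]/(beta s (tensmap idfun (join s m) (assoc T T T (lett3 V z)))).
by rewrite op1_lett3 // op2_lett3 // pr2_join_l pr2_beta pr2_join_r.
Qed.

Lemma eps_join z : eps V (join s m (lett2 V z)) = 0.
Proof.
have [N hN] := join_funE s m (lett2 V z).
rewrite -[join s m _]/(join_fun s m _) (hN N); last by [].
rewrite linearD linear_sum big_nat big1 ?addr0; last first.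
  move=> [|n] // _; apply: homog_eq0 (join_term_homog _ _) => w wn.
  by rewrite /eps wliftE; case: w wn.
move: z {N hN}; apply: (@tens_fext _ _ _ _ _ (fun=> 0)) => [a x y|a x y|x y].
- by rewrite !linearP.
- by rewrite scaler0 addr0.
by rewrite /lett2 tensmapE eps2_word mul0r scale0r linear0.
Qed.

Lemma Mmap_r x c : Mmap m (x ⊠ inj1 c) = (eps V x : K) *: c + m (pr1 V x ⊠ c).
Proof.
have [M1 M2] := tpair_bilin T T; have [L1 L2] := tpair_bilin V V.
move: x; apply: linear_eq_words => [a x y|a x y|w].
- by rewrite M1 linearP.
- rewrite (linearP (eps V)) (linearP (pr1 V)) L1 (linearP m) scalerDr addrACA.
  by rewrite scalerDl -scalerA.
rewrite /Mmap wlift2E /eps wliftE pr1_word.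
by case: w => [|x [|? ?]]; rewrite /= ?tpair0l ?linear0 ?scale1r ?scale0r ?addr0 ?add0r.
Qed.

Lemma Mmap_l x c : Mmap m (inj1 c ⊠ x) = (eps V x : K) *: c + m (c ⊠ pr1 V x).
Proof.
have [M1 M2] := tpair_bilin T T; have [L1 L2] := tpair_bilin V V.
move: x; apply: linear_eq_words => [a x y|a x y|w].
- by rewrite M2 linearP.
- rewrite (linearP (eps V)) (linearP (pr1 V)) L2 (linearP m) scalerDr addrACA.
  by rewrite scalerDl -scalerA.
rewrite /Mmap wlift2E /eps wliftE pr1_word.
by case: w => [|x [|? ?]]; rewrite /= ?tpair0r ?linear0 ?scale1r ?scale0r ?addr0 ?add0r.
Qed.

(** In degree one, only [M] is left of the outer product. In the inner product, [M] sees
    the component of degree one, which is [m], and that of degree zero, which vanishes for two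
    letters. *)
Lemma assoc_letters : assoc_product (join s m) -> assoc_product m.
Proof.
move=> h; apply: tens3_fext => [a x y|a x y|a b c].
- by rewrite -[X in X = _]/(m (tensmap m idfun _)) !linearP.
- by rewrite -[X in X = _]/(m (tensmap idfun m (assoc V V V _))) !linearP.
have := congr1 (pr1 V) (h (inj1 a ⊠ inj1 b ⊠ inj1 c)).
rewrite -[X in pr1 V X = _]/(join s m (tensmap (join s m) idfun _)).
rewrite -[X in _ = pr1 V X]/(join s m (tensmap idfun (join s m) (assoc T T T _))).
rewrite assocE !tensmapE !pr1_join Mmap_r Mmap_l.
have l2 x y : inj1 x ⊠ inj1 y = lett2 V (x ⊠ y) by rewrite /lett2 tensmapE.
rewrite !pr1_join !l2 !eps_join !Mmap_lett2 !scale0r !add0r.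
rewrite -[X in _ -> X = _]/(m (tensmap m idfun _)).
rewrite -[X in _ -> _ = X]/(m (tensmap idfun m (assoc V V V _))).
by rewrite assocE !tensmapE.
Qed.

End Converse.

(** * Units *)

Section UnitBraiding.
Variables (K : fieldType) (A : lmodType K) (s : {linear A ⊗ A -> A ⊗ A}).
Variables (m : {linear A ⊗ A -> A}) (e : A).

(** With [x = e] the compatibility for [m (x ⊠ y)] says that the map
    [w ↦ (id ⊗ m) (s ⊗ id) (e ⊗ w)] fixes every value of [s], hence every [w], as [s] is onto;
    for [w = a ⊗ e] it gives [s (e ⊗ a)]. The other half is symmetric. *)
Lemma unit_braid_unit : bijective s -> YB_compatible m s -> unit_of m e -> braid_unit s e.
Proof.
move=> [g sK gK] [h1 h2] mU.
have [L1 L2] := tpair_bilin A A; have [M1 M2] := tpair_bilin (A ⊗ A) A.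
have [N1 N2] := tpair_bilin A (A ⊗ A).
pose F (w : A ⊗ A) := tensmap idfun m (assoc A A A (op1 s (unassoc A A A (e ⊠ w)))).
pose G (w : A ⊗ A) := tensmap m idfun (op2 s (w ⊠ e)).
have Fs w : F (s w) = s w.
  move: w; apply: tens_fext => [a x y|a x y|x y].
  - by rewrite linearP /F N2 !linearP.
  - by rewrite linearP.
  have := h1 (e ⊠ x ⊠ y); rewrite -[X in X = _]/(tensmap idfun m
    (assoc A A A (op1 s (op2 s _)))) -[X in _ = X]/(s (tensmap m idfun _)).
  by rewrite op2E tensmapE (mU x).1.
have Gs w : G (s w) = s w.
  move: w; apply: tens_fext => [a x y|a x y|x y].
  - by rewrite linearP /G M1 !linearP.
  - by rewrite linearP.
  have := h2 (x ⊠ y ⊠ e); rewrite -[X in X = _]/(tensmap m idfun (op2 s (op1 s _))).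
  rewrite -[X in _ = X]/(s (tensmap idfun m (assoc A A A _))) assocE.
  by rewrite /op1 !tensmapE (mU y).2.
move=> a; split.
  have := Fs (g (a ⊠ e)); rewrite gK /F unassocE /op1 tensmapE => <-.
  move: (s (e ⊠ a)); apply: tens_fext => [c x y|c x y|x y] //.
    by rewrite M1 !linearP.
  by rewrite assocE tensmapE (mU y).2.
have := Gs (g (e ⊠ a)); rewrite gK /G op2E => <-.
move: (s (a ⊠ e)); apply: tens_fext => [c x y|c x y|x y] //.
  by rewrite N2 !linearP.
by rewrite unassocE tensmapE (mU x).1.
Qed.

End UnitBraiding.

Theorem theorem4 (K : fieldType) (charK : [pchar K] =i pred0) (V : lmodType K)
    (s : {linear V ⊗ V -> V ⊗ V}) (s_braiding : braiding s)
    (m : {linear V ⊗ V -> V}) :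
  (YB_algebra (join s m) (word [::]) (beta s) <-> nonunital_YB_algebra m s) /\
  (forall e : V, unit_of m e ->
     (YB_algebra (join s m) (word [::]) (beta s) <-> YB_algebra m e s)).
Proof.
have main : YB_algebra (join s m) (word [::]) (beta s) <-> nonunital_YB_algebra m s.
  split=> [[[_ jA jC] _ _]|[_ mA mC]].
    by split=> //; [apply: assoc_letters jA | apply: compatible_letters jC].
  split; [split | exact: join_unit | exact: beta_unit].
  - exact: beta_braiding.
  - exact: join_assoc_product.
  - exact: join_compatible.
split; first exact: main.
move=> e mU; split=> [/main h|[h _ _]]; last by apply/main; exact: h.
split; [exact: h | exact: mU |].
by case: h => [[sB _] _ mC]; exact: unit_braid_unit sB mC mU.
Qed.
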